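(* Let $F$ be a Clairaut semi-invariant Riemannian map with $s=e^f$ from a Riemannian manifold $(M,g_M)$ to a Kähler manifold $(N,g_N,P)$ such that $(\mathrm{range}\,F_\ast)^\perp$ is totally geodesic and $\dim(D_2)>1$. Then $F$ is totally geodesic if and only if all of the following hold: (i) $\ker F_\ast$ is totally geodesic; (ii) $(\ker F_\ast)^\perp$ is totally geodesic; (iii) for $X,Y,Z\in\Gamma((\ker F_\ast)^\perp)$ such that $F_\ast Z=\phi F_\ast Y$, $$g_M(X,Z)\{B(\nabla^Nf)+C(\nabla^Nf)\}=\phi F_\ast(\nabla^M_XZ)+\omega F_\ast(\nabla^M_XZ)+B\nabla^{F\perp}_X\omega F_\ast Y+C\nabla^{F\perp}_X\omega F_\ast Y+F_\ast(\nabla^M_XY).$$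
   Context: $\nabla^M,\nabla^N$ are the Levi-Civita connections, $\nabla^Nf$ is the gradient of $f$, and $\Gamma(\cdot)$ denotes sections. $F:M\to N$ is smooth with $0<\mathrm{rank}\,F<\min\{\dim M,\dim N\}$; $(\ker F_\ast)^\perp\subset TM$ and $(\mathrm{range}\,F_\ast)^\perp\subset TN$ are orthogonal complements, and $\mathrm{range}\,F_\ast$, $(\mathrm{range}\,F_\ast)^\perp$ are regarded as complementary orthogonal distributions on $N$. $F$ is a Riemannian map if $g_N(F_\ast X,F_\ast Y)=g_M(X,Y)$ for all $X,Y\in\Gamma((\ker F_\ast)^\perp)$. $F$ is totally geodesic if its second fundamental form $(\nabla F_\ast)(X,Y)=\nabla^F_XF_\ast Y-F_\ast(\nabla^M_XY)$ vanishes identically on $TM$, $\nabla^F$ being the pullback of $\nabla^N$. A distribution is totally geodesic if the covariant derivative of any of its sections along any of its sections again lies in it. For $V\in\Gamma((\mathrm{range}\,F_\ast)^\perp)$, $\nabla^{F\perp}_XV$ denotes the $(\mathrm{range}\,F_\ast)^\perp$-component of $\nabla^N_{F_\ast X}V$. $(N,g_N,P)$ is Kähler: $P$ is a $(1,1)$ tensor with $P^2=-I$, $g_N(P\cdot,P\cdot)=g_N$, $\nabla^NP=0$. A Riemannian map $F$ to $N$ is semi-invariant if there are subbundles $D_1,D_2$ with $\mathrm{range}\,F_\ast=D_1\oplus D_2$ (orthogonal), $P(D_1)=D_1$ and $P(D_2)\subseteq(\mathrm{range}\,F_\ast)^\perp$. For $F_\ast X\in\Gamma(\mathrm{range}\,F_\ast)$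 write $PF_\ast X=\phi F_\ast X+\omega F_\ast X$ with $\phi F_\ast X\in\Gamma(D_1)$, $\omega F_\ast X\in\Gamma(PD_2)$. For $V\in\Gamma((\mathrm{range}\,F_\ast)^\perp)$ write $PV=BV+CV$ with $BV\in\Gamma(\mathrm{range}\,F_\ast)$ and $CV\in\Gamma(\eta)$, where $\eta$ is the orthogonal complement of $PD_2$ in $(\mathrm{range}\,F_\ast)^\perp$. $F$ is Clairaut if there is a function $s:N\to\mathbb R^+$ such that for every geodesic $\beta$ on $N$ the function $(s\circ\beta)\sin\theta(t)$ is constant, where $F_\ast X\in\Gamma(\mathrm{range}\,F_\ast)$ and $V\in\Gamma((\mathrm{range}\,F_\ast)^\perp)$ are the components of $\dot\beta(t)$ and $\theta(t)$ is the angle between $\dot\beta(t)$ and $V$. A Clairaut semi-invariant Riemannian map is a semi-invariant Riemannian map to a Kähler manifold that is Clairaut in this sense; ''with $s=e^f$'' means $s=e^f$ for a smooth function $f$ on $N$. For such maps $\nabla^Nf\in\Gamma((\mathrm{range}\,F_\ast)^\perp)$. *)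

(* Defs.v *)
(* MathComp-Analysis world. *)
From HB Require Import structures.
From mathcomp Require Import all_boot all_order all_algebra.
From mathcomp Require Import all_classical all_reals all_analysis.
Set Implicit Arguments.
Unset Strict Implicit.
Unset Printing Implicit Defensive.
Import Order.TTheory GRing.Theory Num.Theory.
Import numFieldNormedType.Exports.
Local Open Scope classical_set_scope.
Local Open Scope ring_scope.

(* Only used with U open: then the k-th clause is differentiability k times on
   U with all iterated directional derivatives continuous on U. *)
Fixpoint Ck_on (R : realType) (V W : normedModType R) (k : nat) (U : set V)
    (f : V -> W) {struct k} : Prop :=
  match k with
  | 0%N => forall x, U x -> {for x, continuous f}
  | k'.+1 => (forall x, U x -> differentiable f x) /\
             forall v : V, Ck_on k' U (fun x => 'd f x v)
  end.

Definition smooth_on (R : realType) (V W : normedModType R) (U : set V)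
    (f : V -> W) : Prop := forall k, Ck_on k U f.

(* A smooth n-manifold with an atlas indexed by points: (dom p, chart p) is a
   chart around p, and chart_inv p is the inverse of chart p on its image. *)
Record manifold (R : realType) (n : nat) := Manifold {
  carrier :> topologicalType ;
  carrier_hausdorff : hausdorff_space carrier ;
  carrier_second_countable : @second_countable carrier ;
  dom : carrier -> set carrier ;
  chart : carrier -> carrier -> 'rV[R]_n ;
  chart_inv : carrier -> 'rV[R]_n -> carrier ;
  dom_open : forall p, open (dom p) ;
  dom_center : forall p, dom p p ;
  chart_open : forall p, open (chart p @` dom p) ;
  chartK : forall p x, dom p x -> chart_inv p (chart p x) = x ;
  chart_continuous : forall p x, dom p x -> {for x, continuous (chart p)} ;
  chart_inv_continuous : forall p y, (chart p @` dom p) y ->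
    {for y, continuous (chart_inv p)} ;
  chart_smooth : forall p q,
    smooth_on (chart p @` (dom p `&` dom q)) (chart q \o chart_inv p)
}.

(* The tangent space at p is 'rV[R]_n, a tangent vector at p being given by its
   coordinates in the chart of index p; [tangent_coord q x v] are the
   coordinates, in the chart of index q, of the tangent vector v at x (for x in
   dom q).  Vector fields on M are thus functions M -> 'rV_n. *)
Definition tangent_coord (R : realType) (n : nat) (M : manifold R n) (q x : M)
    (v : 'rV[R]_n) : 'rV[R]_n :=
  'd (chart q \o chart_inv x) (chart x x) v.

Definition smooth_fun (R : realType) (n : nat) (M : manifold R n)
    (h : M -> R) : Prop :=
  forall p, smooth_on (chart p @` dom p) (h \o chart_inv p).

(* [dfun h p v] is the derivative v(h) of h along the tangent vector v at p. *)
Definition dfun (R : realType) (n : nat) (M : manifold R n) (h : M -> R)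
    (p : M) (v : 'rV[R]_n) : R :=
  'd (h \o chart_inv p) (chart p p) v.

Definition smooth_map (R : realType) (m n : nat) (M : manifold R m)
    (N : manifold R n) (F : M -> N) : Prop :=
  continuous F /\
  forall p q, smooth_on (chart p @` (dom p `&` F @^-1` dom q))
                (chart q \o F \o chart_inv p).

(* F_* at p *)
Definition tmap (R : realType) (m n : nat) (M : manifold R m)
    (N : manifold R n) (F : M -> N) (p : M) : 'Hom('rV[R]_m, 'rV[R]_n) :=
  linfun ('d (chart (F p) \o F \o chart_inv p) (chart p p)).

(* Smooth sections of the pullback bundle of TN by F: W p is a tangent vector
   at F p.  Vector fields on M are the case F = id. *)
Definition smooth_along (R : realType) (m n : nat) (M : manifold R m)
    (N : manifold R n) (F : M -> N) (W : M -> 'rV[R]_n) : Prop :=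
  forall p q, smooth_on (chart p @` (dom p `&` F @^-1` dom q))
    ((fun x => tangent_coord q (F x) (W x)) \o chart_inv p).

Definition vector_field (R : realType) (n : nat) (M : manifold R n)
    (X : M -> 'rV[R]_n) : Prop := @smooth_along R n n M M id X.

Definition section_along (R : realType) (m n : nat) (M : manifold R m)
    (N : manifold R n) (F : M -> N) (D : M -> set 'rV[R]_n)
    (W : M -> 'rV[R]_n) : Prop :=
  smooth_along F W /\ forall p, D p (W p).

Definition section (R : realType) (n : nat) (M : manifold R n)
    (D : M -> set 'rV[R]_n) (X : M -> 'rV[R]_n) : Prop :=
  @section_along R n n M M id D X.

(* Smooth subbundles of the pullback of TN by F: families of subspaces of the
   T_{F p} N having a smooth frame near every point (members of a local frame
   may always be taken globally defined, after shrinking its domain). *)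
Definition subbundle_along (R : realType) (m n : nat) (M : manifold R m)
    (N : manifold R n) (F : M -> N) (D : M -> {vspace 'rV[R]_n}) : Prop :=
  forall p : M, exists (k : nat) (E : 'I_k -> M -> 'rV[R]_n),
    (forall i, smooth_along F (E i)) /\
    (\forall x \near p, basis_of (D x) [tuple E i x | i < k]).

Definition tangent_distribution (R : realType) (n : nat) (M : manifold R n)
    (D : M -> {vspace 'rV[R]_n}) : Prop := @subbundle_along R n n M M id D.

Record riemannian_metric (R : realType) (n : nat) (M : manifold R n)
    (g : M -> 'rV[R]_n -> 'rV[R]_n -> R) : Prop := RiemannianMetric {
  metric_linear : forall p a u v w, g p (a *: u + v) w = a * g p u w + g p v w ;
  metric_sym : forall p u v, g p u v = g p v u ;
  metric_pos : forall p u, u != 0 -> 0 < g p u u ;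
  metric_smooth : forall X Y, vector_field X -> vector_field Y ->
    smooth_fun (fun p => g p (X p) (Y p))
}.

(* Orthogonal complement of U for the inner product b. *)
Definition orth (R : realType) (n : nat) (b : 'rV[R]_n -> 'rV[R]_n -> R)
    (U : set 'rV[R]_n) : set 'rV[R]_n :=
  [set v | forall u, U u -> b v u = 0].

(* v is the component of w in orth b U, for the splitting U (+) orth b U. *)
Definition perp_component (R : realType) (n : nat)
    (b : 'rV[R]_n -> 'rV[R]_n -> R) (U : set 'rV[R]_n)
    (w v : 'rV[R]_n) : Prop :=
  orth b U v /\ U (w - v).

Definition angle (R : realType) (n : nat) (b : 'rV[R]_n -> 'rV[R]_n -> R)
    (u v : 'rV[R]_n) : R :=
  (* with a^-1 = 0 for a = 0, the zero vector makes the angle pi/2 with any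
     vector *)
  acos (b u v / (Num.sqrt (b u u) * Num.sqrt (b v v))).

(* Connections on the pullback of TN by F, where D p u W is the covariant
   derivative at p of the section W in the direction of the tangent vector u
   at p.  Thus (nabla_X W)(p) is D p (X p) W, which builds in the
   C^oo(M)-linearity in X. *)
Record connection_along (R : realType) (m n : nat) (M : manifold R m)
    (N : manifold R n) (F : M -> N)
    (D : M -> 'rV[R]_m -> (M -> 'rV[R]_n) -> 'rV[R]_n) : Prop :=
  ConnectionAlong {
  connection_linear : forall p a u v W, smooth_along F W ->
    D p (a *: u + v) W = a *: D p u W + D p v W ;
  connection_additive : forall p u W W',
    smooth_along F W -> smooth_along F W' ->
    D p u (fun x => W x + W' x) = D p u W + D p u W' ;
  connection_leibniz : forall p u (h : M -> R) W,
    smooth_fun h -> smooth_along F W ->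
    D p u (fun x => h x *: W x) = dfun h p u *: W p + h p *: D p u W ;
  connection_smooth : forall X W, vector_field X -> smooth_along F W ->
    smooth_along F (fun p => D p (X p) W)
}.

(* Torsion-freeness is nabla_X Y - nabla_Y X = [X, Y], tested on functions. *)
Record levi_civita (R : realType) (n : nat) (M : manifold R n)
    (g : M -> 'rV[R]_n -> 'rV[R]_n -> R)
    (nabla : M -> 'rV[R]_n -> (M -> 'rV[R]_n) -> 'rV[R]_n) : Prop :=
  LeviCivita {
  levi_civita_connection : @connection_along R n n M M id nabla ;
  levi_civita_metric : forall p u Y Z, vector_field Y -> vector_field Z ->
    dfun (fun x => g x (Y x) (Z x)) p u
    = g p (nabla p u Y) (Z p) + g p (Y p) (nabla p u Z) ;
  levi_civita_torsion : forall p X Y h,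
    vector_field X -> vector_field Y -> smooth_fun h ->
    dfun h p (nabla p (X p) Y - nabla p (Y p) X)
    = dfun (fun x => dfun h x (Y x)) p (X p)
      - dfun (fun x => dfun h x (X x)) p (Y p)
}.

Record pullback_connection (R : realType) (m n : nat) (M : manifold R m)
    (N : manifold R n) (F : M -> N)
    (nablaN : N -> 'rV[R]_n -> (N -> 'rV[R]_n) -> 'rV[R]_n)
    (nablaF : M -> 'rV[R]_m -> (M -> 'rV[R]_n) -> 'rV[R]_n) : Prop :=
  PullbackConnection {
  pullback_is_connection : connection_along F nablaF ;
  pullback_compose : forall p u Y, vector_field Y ->
    nablaF p u (Y \o F) = nablaN (F p) (tmap F p u) Y
}.

Definition totally_geodesic_distribution (R : realType) (n : nat)
    (M : manifold R n)
    (nabla : M -> 'rV[R]_n -> (M -> 'rV[R]_n) -> 'rV[R]_n)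
    (D : M -> set 'rV[R]_n) : Prop :=
  forall X Y, section D X -> section D Y -> forall p, D p (nabla p (X p) Y).

Definition gradient (R : realType) (n : nat) (M : manifold R n)
    (g : M -> 'rV[R]_n -> 'rV[R]_n -> R) (f : M -> R)
    (G : M -> 'rV[R]_n) : Prop :=
  forall p u, g p (G p) u = dfun f p u.

(* Curves defined on an open interval J; the values outside J are irrelevant. *)
Definition smooth_curve (R : realType) (n : nat) (N : manifold R n)
    (J : set R) (beta : R -> N) : Prop :=
  (forall t, J t -> {for t, continuous beta}) /\
  forall q, smooth_on (J `&` beta @^-1` dom q) (chart q \o beta).

Definition velocity (R : realType) (n : nat) (N : manifold R n)
    (beta : R -> N) (t : R) : 'rV[R]_n :=
  'd (chart (beta t) \o beta) t 1.

Definition smooth_along_curve (R : realType) (n : nat) (N : manifold R n)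
    (J : set R) (beta : R -> N) (W : R -> 'rV[R]_n) : Prop :=
  forall q, smooth_on (J `&` beta @^-1` dom q)
              (fun t => tangent_coord q (beta t) (W t)).

(* D is the covariant derivative D/dt along beta induced by nabla. *)
Record curve_derivative (R : realType) (n : nat) (N : manifold R n)
    (nabla : N -> 'rV[R]_n -> (N -> 'rV[R]_n) -> 'rV[R]_n)
    (J : set R) (beta : R -> N)
    (D : (R -> 'rV[R]_n) -> R -> 'rV[R]_n) : Prop := CurveDerivative {
  curve_derivative_smooth : forall W,
    smooth_along_curve J beta W -> smooth_along_curve J beta (D W) ;
  curve_derivative_additive : forall W W' t, J t ->
    smooth_along_curve J beta W -> smooth_along_curve J beta W' ->
    D (fun s => W s + W' s) t = D W t + D W' t ;
  curve_derivative_leibniz : forall (h : R -> R) W t, J t ->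
    smooth_on J h -> smooth_along_curve J beta W ->
    D (fun s => h s *: W s) t = 'd h t 1 *: W t + h t *: D W t ;
  curve_derivative_compose : forall Y t, J t -> vector_field Y ->
    D (Y \o beta) t = nabla (beta t) (velocity beta t) Y
}.

Definition geodesic (R : realType) (n : nat) (N : manifold R n)
    (nabla : N -> 'rV[R]_n -> (N -> 'rV[R]_n) -> 'rV[R]_n)
    (J : set R) (beta : R -> N) : Prop :=
  [/\ open J, is_interval J, smooth_curve J beta &
    exists2 D, curve_derivative nabla J beta D &
      forall t, J t -> D (velocity beta) t = 0].

Definition kerF (R : realType) (m n : nat) (M : manifold R m)
    (N : manifold R n) (F : M -> N) (p : M) : set 'rV[R]_m :=
  [set` lker (tmap F p)].

Definition kerF_perp (R : realType) (m n : nat) (M : manifold R m)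
    (N : manifold R n) (gM : M -> 'rV[R]_m -> 'rV[R]_m -> R) (F : M -> N)
    (p : M) : set 'rV[R]_m :=
  orth (gM p) (kerF F p).

Definition ranF (R : realType) (m n : nat) (M : manifold R m)
    (N : manifold R n) (F : M -> N) (p : M) : set 'rV[R]_n :=
  [set` limg (tmap F p)].

Definition ranF_perp (R : realType) (m n : nat) (M : manifold R m)
    (N : manifold R n) (gN : N -> 'rV[R]_n -> 'rV[R]_n -> R) (F : M -> N)
    (p : M) : set 'rV[R]_n :=
  orth (gN (F p)) (ranF F p).

Definition riemannian_map (R : realType) (m n : nat) (M : manifold R m)
    (N : manifold R n) (gM : M -> 'rV[R]_m -> 'rV[R]_m -> R)
    (gN : N -> 'rV[R]_n -> 'rV[R]_n -> R) (F : M -> N) : Prop :=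
  [/\ smooth_map F,
    (forall p, 0 < \dim (limg (tmap F p)) < minn m n)%N &
    forall X Y, section (kerF_perp gM F) X -> section (kerF_perp gM F) Y ->
      forall p, gN (F p) (tmap F p (X p)) (tmap F p (Y p)) = gM p (X p) (Y p)].

Definition totally_geodesic_map (R : realType) (m n : nat) (M : manifold R m)
    (N : manifold R n) (F : M -> N)
    (nablaM : M -> 'rV[R]_m -> (M -> 'rV[R]_m) -> 'rV[R]_m)
    (nablaF : M -> 'rV[R]_m -> (M -> 'rV[R]_n) -> 'rV[R]_n) : Prop :=
  forall X Y, vector_field X -> vector_field Y -> forall p,
    nablaF p (X p) (fun x => tmap F x (Y x))
    - tmap F p (nablaM p (X p) Y) = 0.

Record kahler (R : realType) (n : nat) (N : manifold R n)
    (g : N -> 'rV[R]_n -> 'rV[R]_n -> R)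
    (nabla : N -> 'rV[R]_n -> (N -> 'rV[R]_n) -> 'rV[R]_n)
    (P : N -> 'End('rV[R]_n)) : Prop := Kahler {
  kahler_smooth : forall X, vector_field X ->
    vector_field (fun q => P q (X q)) ;
  kahler_square : forall q v, P q (P q v) = - v ;
  kahler_isometry : forall q u v, g q (P q u) (P q v) = g q u v ;
  kahler_parallel : forall q u X, vector_field X ->
    nabla q u (fun x => P x (X x)) = P q (nabla q u X)
}.

Record semi_invariant (R : realType) (m n : nat) (M : manifold R m)
    (N : manifold R n) (gN : N -> 'rV[R]_n -> 'rV[R]_n -> R)
    (P : N -> 'End('rV[R]_n)) (F : M -> N)
    (D1 D2 : M -> {vspace 'rV[R]_n}) : Prop := SemiInvariant {
  semi_invariant_D1 : subbundle_along F D1 ;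
  semi_invariant_D2 : subbundle_along F D2 ;
  semi_invariant_sum : forall p, limg (tmap F p) = (D1 p + D2 p)%VS ;
  semi_invariant_orth : forall p u v, u \in D1 p -> v \in D2 p ->
    gN (F p) u v = 0 ;
  semi_invariant_PD1 : forall p, (P (F p) @: D1 p)%VS = D1 p ;
  semi_invariant_PD2 : forall p v, v \in D2 p ->
    ranF_perp gN F p (P (F p) v)
}.

(* Orthogonal complement of P D2 in the orthogonal complement of the range. *)
Definition eta_space (R : realType) (m n : nat) (M : manifold R m)
    (N : manifold R n) (gN : N -> 'rV[R]_n -> 'rV[R]_n -> R)
    (P : N -> 'End('rV[R]_n)) (F : M -> N) (D2 : M -> {vspace 'rV[R]_n})
    (p : M) : set 'rV[R]_n :=
  ranF_perp gN F p `&` orth (gN (F p)) [set` (P (F p) @: D2 p)%VS].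

(* P w = phi w + omega w on the range of F_*. *)
Definition phi_omega_decomposition (R : realType) (m n : nat)
    (M : manifold R m) (N : manifold R n) (P : N -> 'End('rV[R]_n))
    (F : M -> N) (D1 D2 : M -> {vspace 'rV[R]_n})
    (phi omega : M -> 'rV[R]_n -> 'rV[R]_n) : Prop :=
  forall p w, ranF F p w ->
    [/\ phi p w \in D1 p, omega p w \in (P (F p) @: D2 p)%VS &
        P (F p) w = phi p w + omega p w].

(* P v = B v + C v on the orthogonal complement of the range of F_*. *)
Definition BC_decomposition (R : realType) (m n : nat)
    (M : manifold R m) (N : manifold R n)
    (gN : N -> 'rV[R]_n -> 'rV[R]_n -> R) (P : N -> 'End('rV[R]_n))
    (F : M -> N) (D2 : M -> {vspace 'rV[R]_n})
    (B C : M -> 'rV[R]_n -> 'rV[R]_n) : Prop :=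
  forall p v, ranF_perp gN F p v ->
    [/\ ranF F p (B p v), eta_space gN P F D2 p (C p v) &
        P (F p) v = B p v + C p v].

(* nablaFperp p u V is the normal component of nablaF p u V. *)
Definition normal_connection (R : realType) (m n : nat)
    (M : manifold R m) (N : manifold R n)
    (gN : N -> 'rV[R]_n -> 'rV[R]_n -> R) (F : M -> N)
    (nablaF nablaFperp : M -> 'rV[R]_m -> (M -> 'rV[R]_n) -> 'rV[R]_n) :
    Prop :=
  forall p u V, section_along F (ranF_perp gN F) V ->
    perp_component (gN (F p)) (ranF F p) (nablaF p u V) (nablaFperp p u V).

(* A distribution on all of N restricting to the range of F_* along F. *)
Definition range_distribution (R : realType) (m n : nat) (M : manifold R m)
    (N : manifold R n) (F : M -> N) (D : N -> {vspace 'rV[R]_n}) : Prop :=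
  tangent_distribution D /\ forall p, D (F p) = limg (tmap F p).

(* D is meant to be the range distribution; V is the component of the velocity
   in its orthogonal complement. *)
Definition clairaut (R : realType) (n : nat) (N : manifold R n)
    (g : N -> 'rV[R]_n -> 'rV[R]_n -> R)
    (nabla : N -> 'rV[R]_n -> (N -> 'rV[R]_n) -> 'rV[R]_n)
    (D : N -> {vspace 'rV[R]_n}) (s : N -> R) : Prop :=
  (forall q, 0 < s q) /\
  forall (J : set R) (beta : R -> N) (V : R -> 'rV[R]_n),
    geodesic nabla J beta ->
    (forall t, J t -> perp_component (g (beta t)) [set` D (beta t)]
                        (velocity beta t) (V t)) ->
    exists c : R, forall t, J t ->
      s (beta t) * sin (angle (g (beta t)) (velocity beta t) (V t)) = c.

(* Main.v *)
(* Restrict X, Y, Z to horizontal fields.  Testing the Clairaut relation along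
   the geodesic issued from T + V, with T <> 0 tangent and V normal to the range
   distribution, gives df(T + V) g(T, T) + g(V, nabla_(T+V) E) = 0 for tangent
   fields E extending T.  Hence grad f is normal to the range and, as the normal
   distribution is totally geodesic,
     nabla^F_X F_*Y = F_*(nabla^M_X Y) - g(X, Y) grad f.
   Inserting this in P (nabla^F_X F_*Y) = nabla^F_X (P F_*Y), where
   P F_*Y = F_*Z + omega F_*Y, turns the right-hand side of (iii) into
     g(X, Z) P grad f + g(X, Y) grad f - g(grad f, omega F_*Y) P F_*X.
   If F is totally geodesic then grad f = 0 along F.  Conversely, (iii) leaves
     g(X, Y) grad f = g(grad f, omega F_*Y) P F_*X,
   and dim D2 > 1 provides X = Y with F_*X a nonzero element of D2 orthogonal to
   P grad f; so grad f = 0 along F, and (i), (ii) handle the vertical fields.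

   The geodesics needed are built by Picard iteration on the geodesic equation in
   a chart; covariant derivatives along F and along curves are computed in
   coordinate fields extended to the whole manifold by bump functions. *)
Require Import Defs.
From HB Require Import structures.
From mathcomp Require Import all_boot all_order all_algebra.
From mathcomp Require Import ring lra.
From mathcomp Require Import all_classical all_reals all_analysis.
Set Implicit Arguments.
Unset Strict Implicit.
Unset Printing Implicit Defensive.
Import Order.TTheory GRing.Theory Num.Theory.
Import numFieldNormedType.Exports.
Local Open Scope classical_set_scope.
Local Open Scope ring_scope.

(* Unfolding ['d] makes unification diverge. *)
Local Opaque diff.

(** The identity drawn from the Clairaut relation is quadratic in T, while the formula for nabla^F_X
    F_*Y needs a bilinear one. Polarization requires g(T', nabla_T V) to be symmetric in T and T'.
    This is special to the points of F(M): elsewhere the range distribution is an arbitrary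
    extension, which may fail to be integrable, but at F p the symmetry follows from the
    torsion-freeness of the pullback connection. A field along F need not be induced by a field on
    N, since points of M with the same image may carry different vectors. So whenever a derivative
    has to be moved from one factor of an inner product to the other, the vector that gets extended
    is chosen so that the Clairaut identity, which concerns fields on N, becomes applicable. No
    smoothness of phi, omega, B, C is assumed: they are pointwise decompositions. The smooth fields
    built from them come from P and from the adjoint of F_*, which also produces all horizontal
    fields. *)

Lemma near_open (T : topologicalType) (x : T) (P : set T) :
  (\forall y \near x, P y) -> exists G, [/\ open G, G x & G `<=` P].
Proof.
by move=> H; have : nbhs x P by []; rewrite nbhsE => -[G [oG Gx] GP]; exists G.
Qed.

Lemma near_forall (T : topologicalType) (I : finType) (x : T) (P : I -> T -> Prop) :
  (forall i, \forall y \near x, P i y) -> \forall y \near x, forall i, P i y.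
Proof. by move=> H; apply: filter_forall. Qed.

Lemma sum_delta (R : pzRingType) n (a : 'I_n -> R) k :
  \sum_i a i * (k == i)%:R = a k.
Proof.
rewrite (bigD1 k) //= eqxx mulr1 big1 ?addr0 // => i ik.
by rewrite eq_sym (negPf ik) mulr0.
Qed.

(** * Calculus of smooth functions *)

Section Diff.
Context {R : realType}.
Implicit Types V W : normedModType R.

Lemma near_eq_diff V W (f g : V -> W) (x : V) :
  (\forall y \near x, f y = g y) -> differentiable f x ->
  differentiable g x /\ 'd g x = 'd f x :> (V -> W).
Proof.
move=> fg df; have fgx : f x = g x := nbhs_singleton fg.
have H : g \o shift x = cst (g x) + 'd f x +o_ 0 id.
  apply/eqaddoP => e e0.
  have /eqaddoP /(_ e e0) H := diff_locally df.
  have fg0 : \forall h \near 0, f (h + x) = g (h + x).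
    by move: fg; rewrite (near_shift 0 x); apply: filterS => h /=; rewrite subr0.
  near=> h.
  have E1 : f (h + x) = g (h + x) by near: h.
  suff : `|(f \o shift x - (cst (f x) + 'd f x)) h| <= e * `|h|.
    by rewrite !fctE /= E1 fgx.
  by near: h.
have E : 'd g x = 'd f x :> (V -> W) by apply: diff_unique H; exact: diff_continuous.
by split=> //; apply/diff_locallyP; split; rewrite E //; exact: diff_continuous.
Unshelve. all: by end_near. Qed.

Lemma diff_idv V (x v : V) : 'd (fun z : V => z) x v = v.
Proof. by rewrite (diff_lin (f := idfun)) // => z; exact: cvg_id. Qed.

Lemma diff_comp_near (V W Z : normedModType R) (f : V -> W) (g : W -> Z)
    (h : V -> Z) x y v : differentiable f x -> f x = y -> differentiable g y ->
  (\forall z \near x, g (f z) = h z) -> 'd h x v = 'd g y ('d f x v).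
Proof.
move=> df fxy dg gfh; subst y.
have [_ /(congr1 (fun k : V -> Z => k v)) E] :=
  near_eq_diff gfh (differentiable_comp df dg).
by apply: (etrans E); exact: (congr1 (fun k : V -> Z => k v) (diff_comp df dg)).
Qed.

Lemma diffDv V (f g : V -> R) x v : differentiable f x -> differentiable g x ->
  'd (fun y => f y + g y) x v = 'd f x v + 'd g x v.
Proof. by move=> df dg; exact: (congr1 (fun k : V -> R => k v) (diffD df dg)). Qed.

Lemma diff_cstv V (W : normedModType R) (a : W) (x v : V) : 'd (fun _ : V => a) x v = 0.
Proof. exact: (congr1 (fun k : V -> W => k v) (diff_cst a x)). Qed.

Lemma diffMv V (f g : V -> R) x v : differentiable f x -> differentiable g x ->
  'd (fun y => f y * g y) x v = 'd f x v * g x + f x * 'd g x v.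
Proof.
move=> df dg.
have E : 'd (fun y => f y * g y) x v = f x * 'd g x v + g x * 'd f x v.
  exact: (congr1 (fun k : V -> R => k v) (diffM df dg)).
by rewrite E; move: ('d f x v) ('d g x v) => a b; rewrite addrC (mulrC (g x)).
Qed.

Lemma diffZv V (a : R) (f : V -> R) x v : differentiable f x ->
  'd (fun y => a * f y) x v = a * 'd f x v.
Proof.
move=> df; have da : differentiable (fun _ : V => a) x by exact: differentiable_cst.
by rewrite diffMv // diff_cstv mul0r add0r.
Qed.

Lemma diff_rV V m (f : V -> 'rV[R]_m) x :
  (forall i, differentiable (fun y => f y 0 i : R) x) ->
  differentiable f x.
Proof.
move=> df.
have -> : f = \sum_(i < m) (fun y => f y 0 i *: delta_mx 0 i).
  apply/funext => y; rewrite fct_sumE; apply/rowP => j.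
  rewrite summxE (bigD1 j) //= !mxE !eqxx mulr1 big1 ?addr0 // => i ij.
  by rewrite !mxE eqxx /= eq_sym (negPf ij) mulr0.
apply: differentiable_sum => i; exact: differentiableZl.
Qed.

Lemma diff_coord V m (f : V -> 'rV[R]_m) x i : differentiable f x ->
  differentiable (fun y => f y 0 i : R) x /\
  forall v, 'd (fun y => f y 0 i : R) x v = 'd f x v 0 i.
Proof.
move=> df.
have lin : linear (fun N : 'rV[R]_m => N 0 i : R) by move=> a u v; rewrite !mxE.
pose L : {linear 'rV[R]_m -> R} := HB.pack (fun N : 'rV[R]_m => N 0 i : R)
  (GRing.isLinear.Build _ _ _ _ _ lin).
have cL : continuous L by exact: coord_continuous.
have dL : differentiable L (f x) by exact: linear_differentiable.
split; first exact: (differentiable_comp df dL).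
move=> v; have := diff_comp df dL; rewrite (diff_lin _ cL) => /(congr1 (@^~ v)).
by [].
Qed.

Lemma CkSE V W k (U : set V) (f : V -> W) : Ck_on k.+1 U f =
  ((forall x, U x -> differentiable f x) /\
   forall v : V, Ck_on k U (fun x => 'd f x v)).
Proof. by []. Qed.

Lemma CkS V W k (U : set V) (f : V -> W) : Ck_on k.+1 U f -> Ck_on k U f.
Proof.
elim: k f => [|k IH] f /= [df dk].
  by move=> x Ux; apply: differentiable_continuous; exact: df.
by split=> // v; apply: IH; exact: dk.
Qed.

Lemma Ck_sub V W k (U U' : set V) (f : V -> W) :
  U' `<=` U -> Ck_on k U f -> Ck_on k U' f.
Proof.
move=> UU; elim: k f => [|k IH] f /=; first by move=> cf x /UU; exact: cf.
by move=> [df dk]; split=> [x /UU /df //|v]; apply: IH.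
Qed.

Lemma Ck_ext V W k (U : set V) (f g : V -> W) :
  open U -> (forall x, U x -> f x = g x) -> Ck_on k U f -> Ck_on k U g.
Proof.
move=> oU; elim: k f g => [|k IH] f g fg /=.
  move=> cf x Ux; rewrite /prop_for /continuous_at -(fg _ Ux).
  apply: cvg_trans (cf x Ux); apply: near_eq_cvg.
  by near=> y; rewrite fg //; near: y; exact: open_nbhs_nbhs.
move=> [df dk].
have H x : U x -> differentiable g x /\ 'd g x = 'd f x :> (V -> W).
  move=> Ux; apply: near_eq_diff; last exact: df.
  by near=> y; rewrite fg //; near: y; exact: open_nbhs_nbhs.
split=> [x /H[]//|v].
apply: (IH (fun x => 'd f x v)); last exact: dk.
by move=> x /H[_ ->].
Unshelve. all: by end_near. Qed.

Lemma Ck_cst V W k (U : set V) (a : W) : Ck_on k U (fun=> a).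
Proof.
elim: k a => [|k IH] a /=; first by move=> x _; exact: cst_continuous.
split=> [x _|v]; first exact: differentiable_cst.
have -> : (fun x : V => 'd (fun=> a) x v) = fun=> 0; last exact: IH.
by apply/funext => x; have := @diff_cst R V W a x => /(congr1 (@^~ v)).
Qed.

Lemma Ck_lin V W k (U : set V) (f : {linear V -> W}) :
  continuous f -> Ck_on k U f.
Proof.
case: k => [|k] cf /=; first by move=> x _; exact: cf.
split=> [x _|v]; first exact: linear_differentiable.
have -> : (fun x : V => 'd f x v) = fun=> f v; last exact: Ck_cst.
by apply/funext => x; rewrite diff_lin.
Qed.

Lemma Ck_id V k (U : set V) : Ck_on k U (fun x : V => x).
Proof. by apply: (@Ck_lin V V k U idfun) => x; exact: cvg_id. Qed.

Lemma Ck_coord V m k (U : set V) (f : V -> 'rV[R]_m) : open U ->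
  Ck_on k U f <-> forall i, Ck_on k U (fun x => f x 0 i : R).
Proof.
move=> oU; elim: k f => [|k IH] f /=.
  split=> [cf i x Ux|cf x Ux].
    by apply: (@continuous_comp _ _ _ f (fun N : 'rV[R]_m => N 0 i));
      [exact: cf | exact: coord_continuous].
  apply/cvgrPdist_lt => e e0.
  have H i : \forall t \near x, `|f x 0 i - f t 0 i| < e.
    by have /cvgrPdist_lt /(_ e e0) := cf i x Ux.
  near=> t; rewrite /Num.norm /= mx_normrE; apply/bigmax_ltP; split=> //.
  move=> [i j] _; rewrite !mxE /= (ord1 i).
  by move: j; near: t; apply: filter_forall.
split=> [[df dk] i|H].
  split=> [x Ux|v]; first by have [] := diff_coord i (df x Ux).
  apply: (@Ck_ext _ _ _ _ (fun x => 'd f x v 0 i)) => // [x Ux|].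
    by have [_ ->] := diff_coord i (df x Ux).
  by have /IH := dk v.
have df x : U x -> differentiable f x.
  by move=> Ux; apply: diff_rV => i; have [] := H i => /(_ x Ux).
split=> // v; apply/IH => i.
apply: (@Ck_ext _ _ _ _ (fun x => 'd (fun y => f y 0 i : R) x v)) => // [x Ux|].
  by have [_ ->] := diff_coord i (df x Ux).
by have [_] := H i.
Unshelve. all: by end_near. Qed.

End Diff.

Local Opaque Ck_on.

(** * Closure properties of C^k functions *)

Section SmoothCalculus.
Context {R : realType}.
Implicit Types V W : normedModType R.

Lemma CkD V k (U : set V) (f g : V -> R) : open U ->
  Ck_on k U f -> Ck_on k U g -> Ck_on k U (fun x => f x + g x).
Proof.
move=> oU; elim: k f g => [|k IH] f g.
  by move=> cf cg x Ux; apply: continuousD; [exact: cf | exact: cg].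
rewrite !CkSE => -[df dkf] [dg dkg]; split=> [x Ux|v].
  by apply: differentiableD; [exact: df | exact: dg].
apply: (Ck_ext oU _ (IH _ _ (dkf v) (dkg v))) => x Ux.
exact: esym (congr1 (fun h : V -> R => h v) (diffD (df x Ux) (dg x Ux))).
Qed.

Lemma CkM V k (U : set V) (f g : V -> R) : open U ->
  Ck_on k U f -> Ck_on k U g -> Ck_on k U (fun x => f x * g x).
Proof.
move=> oU; elim: k f g => [|k IH] f g.
  by move=> cf cg x Ux; apply: continuousM; [exact: cf | exact: cg].
move=> /[dup] Hf; rewrite CkSE => -[df dkf].
move=> /[dup] Hg; rewrite CkSE => -[dg dkg]; rewrite CkSE; split=> [x Ux|v].
  by apply: differentiableM; [exact: df | exact: dg].
apply: (Ck_ext oU _ (CkD oU (IH _ _ (CkS Hf) (dkg v)) (IH _ _ (CkS Hg) (dkf v)))).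
move=> x Ux.
exact: esym (congr1 (fun h : V -> R => h v) (diffM (df x Ux) (dg x Ux))).
Qed.

Lemma Ck_sum V k (U : set V) I (r : seq I) (P : pred I) (f : I -> V -> R) :
  open U -> (forall i, P i -> Ck_on k U (f i)) ->
  Ck_on k U (fun x => \sum_(i <- r | P i) f i x).
Proof.
move=> oU H; elim: r => [|i r IH].
  by apply: (Ck_ext oU _ (Ck_cst _ _ (0 : R))) => x _; rewrite big_nil.
have [Pi|/negPf Pi] := boolP (P i).
  by apply: (Ck_ext oU _ (CkD oU (H i Pi) IH)) => x _; rewrite big_cons Pi.
by apply: (Ck_ext oU _ IH) => x _; rewrite big_cons Pi.
Qed.

Lemma CkV V k (U : set V) (f : V -> R) : open U ->
  (forall x, U x -> f x != 0) ->
  Ck_on k U f -> Ck_on k U (fun x => (f x)^-1).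
Proof.
move=> oU f0; elim: k => [|k IH].
  by move=> cf x Ux; apply: cvgV; [exact: f0 | exact: cf].
move=> /[dup] Hf; rewrite !CkSE => -[df dkf]; split=> [x Ux|v].
  by apply: differentiableV; [exact: df | exact: f0].
have fV := IH (CkS Hf).
apply: (Ck_ext oU _ (CkM oU (CkM oU (Ck_cst k U (- 1 : R)) (CkM oU fV fV)) (dkf v))).
move=> x Ux.
have E : 'd (fun y => (f y)^-1) x v = - (f x) ^- 2 * 'd f x v.
  by have /(congr1 (fun h : V -> R => h v)) := diffV (df x Ux) (f0 x Ux).
by apply: etrans (esym E); rewrite mulN1r -invfM.
Qed.

Lemma diff_delta m V (L : {linear 'rV[R]_m -> V}) v :
  L v = \sum_j v 0 j *: L (delta_mx 0 j).
Proof. by rewrite [in LHS](row_sum_delta v) linear_sum; apply: eq_bigr => j _; rewrite linearZ. Qed.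

(** Only derivatives in fixed directions enter [Ck_on], whereas the chain rule differentiates g in
    the moving direction ['d f x v]. Expanding that direction in the standard basis gives a sum of
    products covered by the induction. *)
Lemma Ck_comp V m k (U : set V) (U' : set 'rV[R]_m) (f : V -> 'rV[R]_m)
    (g : 'rV[R]_m -> R) : open U -> (forall x, U x -> U' (f x)) ->
  Ck_on k U f -> Ck_on k U' g -> Ck_on k U (g \o f).
Proof.
move=> oU fU; elim: k g => [|k IH] g.
  move=> cf cg x Ux; apply: (@continuous_comp _ _ _ f g); first exact: cf.
  by apply: cg; exact: fU.
move=> /[dup] Hf; rewrite CkSE => -[df dkf].
move=> /[dup] Hg; rewrite CkSE => -[dg dkg]; rewrite CkSE; split=> [x Ux|v].
  by apply: differentiable_comp; [exact: df | apply: dg; exact: fU].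
have H j : Ck_on k U (fun x => ('d f x v) 0 j *
    ((fun y => 'd g y (delta_mx 0 j)) \o f) x).
  apply: (CkM oU); last exact: (IH _ (CkS Hf) (dkg _)).
  by have /(Ck_coord _ _ oU) := dkf v.
apply: (Ck_ext oU _ (Ck_sum (index_enum 'I_m) (P := xpredT) oU (fun j _ => H j))).
move=> x Ux.
have E := congr1 (fun h : V -> R => h v) (diff_comp (df x Ux) (dg _ (fU x Ux))).
apply: etrans (esym E).
exact: esym (diff_delta ('d g (f x)) ('d f x v)).
Qed.

Lemma Ck_comp1 V k (U : set V) (U' : set R) (f : V -> R)
    (g : R -> R) : open U -> (forall x, U x -> U' (f x)) ->
  Ck_on k U f -> Ck_on k U' g -> Ck_on k U (g \o f).
Proof.
move=> oU fU; elim: k g => [|k IH] g.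
  move=> cf cg x Ux; apply: (@continuous_comp _ _ _ f g); first exact: cf.
  by apply: cg; exact: fU.
move=> /[dup] Hf; rewrite CkSE => -[df dkf].
move=> /[dup] Hg; rewrite CkSE => -[dg dkg]; rewrite CkSE; split=> [x Ux|v].
  by apply: differentiable_comp; [exact: df | apply: dg; exact: fU].
apply: (Ck_ext oU _ (CkM oU (dkf v) (IH _ (CkS Hf) (dkg 1)))) => x Ux.
have E := congr1 (fun h : V -> R => h v) (diff_comp (df x Ux) (dg _ (fU x Ux))).
apply: etrans (esym E); rewrite /=.
have -> : 'd f x v = 'd f x v *: (1 : R) by rewrite /GRing.scale /= mulr1.
by rewrite linearZ /GRing.scale /= mulr1.
Qed.

(** Every clause of [Ck_on] is a condition at the single points of U on functions defined on the
    whole space, so it makes sense even on a singleton. *)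
Lemma Ck_local V W k (U : set V) (f : V -> W) :
  (forall x, U x -> Ck_on k [set x] f) -> Ck_on k U f.
Proof.
elim: k f => [|k IH] f H.
  by move=> x Ux; exact: (H x Ux x erefl).
rewrite CkSE; split=> [x Ux|v].
  by have := H x Ux; rewrite CkSE => -[/(_ x erefl)].
by apply: IH => x Ux; have := H x Ux; rewrite CkSE => -[_ /(_ v)].
Qed.

Lemma CkS_derive k (U : set R) (f df : R -> R) : open U ->
  (forall x, U x -> is_derive x 1 f (df x)) ->
  Ck_on k U df -> Ck_on k.+1 U f.
Proof.
move=> oU H Hdf; rewrite CkSE; split=> [x Ux|v].
  by apply/derivable1_diffP; have [] := H x Ux.
apply: (Ck_ext oU _ (CkM oU (Ck_cst k U v) Hdf)) => x Ux.
have [dfx <-] := H x Ux.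
have := congr1 (fun h : R -> R => h v) (deriv1E dfx).
by rewrite derive1E => ->.
Qed.

Lemma Ck_expR k (U : set R) : open U -> Ck_on k U (@expR R).
Proof.
move=> oU; elim: k => [|k IH]; first by move=> x _; exact: continuous_expR.
exact: (CkS_derive oU (fun x _ => is_derive_expR x) IH).
Qed.

(** * A flat function and the smooth step made from it *)

Definition exp_inv (j : nat) (x : R) : R :=
  if 0 < x then x^-1 ^+ j * expR (- x^-1) else 0.

Lemma exp_inv_eq0 j x : x <= 0 -> exp_inv j x = 0.
Proof. by move=> x0; rewrite /exp_inv ltNge x0. Qed.

(** From e^y >= 1 + y^(j+1) / (j+1)! at y = 1/x. At the next index this linear bound controls the
    difference quotient at 0. *)
Lemma exp_inv_le j x : 0 <= x -> exp_inv j x <= j.+1`!%:R * x.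
Proof.
rewrite le_eqVlt => /predU1P[<-|x0]; rewrite /exp_inv ?ltxx ?mulr0 // x0.
have xV0 : 0 <= x^-1 by rewrite invr_ge0 ltW.
have H : x^-1 ^+ j.+1 <= j.+1`!%:R * expR (x^-1).
  rewrite -ler_pdivrMl ?ltr0n ?fact_gt0 // mulrC.
  by apply: le_trans (expR_ge1Dxn j xV0); rewrite lerDr.
rewrite expRN ler_pdivrMr ?expR_gt0 // -mulrA [x * _]mulrC mulrA.
by rewrite -ler_pdivrMr // mulrC -exprS.
Qed.

Lemma exp_inv_ge0 j x : 0 <= exp_inv j x.
Proof.
rewrite /exp_inv; case: ifP => // x0.
by rewrite mulr_ge0 ?expR_ge0 // exprn_ge0 // invr_ge0 ltW.
Qed.

(** The exponent j closes the family under differentiation, so that the smoothness of all members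
    follows by one induction, although only j = 0 is used afterwards. *)
Lemma exp_inv_derive j (x : R) :
  is_derive x 1 (exp_inv j) (- j%:R * exp_inv j.+1 x + exp_inv j.+2 x).
Proof.
have [x0|x0|x0] := ltgtP x 0.
- have E : \forall y \near x, cst 0 y = exp_inv j y.
    near=> y; rewrite /exp_inv ifF //; apply/negbTE; rewrite -leNgt ltW //.
    by near: y; exact: lt_nbhsl.
  rewrite !(exp_inv_eq0 _ (ltW x0)) mulr0 addr0.
  by apply: (near_eq_is_derive E (is_derive_cst (0 : R) x 1)).
- have E : \forall y \near x, (fun y => y^-1 ^+ j * expR (- y^-1)) y = exp_inv j y.
    near=> y; rewrite /exp_inv ifT //.
    by near: y; exact: lt_nbhsr.
  apply: (near_eq_is_derive E).
  have xn0 : x != 0 by rewrite gt_eqF.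
  have dV : is_derive x 1 (fun y : R => y^-1) (- x ^- 2).
    apply: DeriveDef; first exact: derivableV.
    by rewrite deriveV // derive_id /GRing.scale /= mulr1.
  have dN : is_derive x 1 (fun y : R => - y^-1) (x ^- 2).
    by rewrite -[x ^- 2]opprK; exact: is_deriveN.
  have dE : is_derive x 1 (fun y : R => expR (- y^-1)) (x ^- 2 * expR (- x^-1)).
    by rewrite mulrC; apply: (@is_derive1_comp _ (@expR R) (fun y : R => - y^-1)).
  have dX : is_derive x 1 (fun y : R => y^-1 ^+ j) (- j%:R * x^-1 ^+ j.+1).
    have -> : (fun y : R => y^-1 ^+ j) = (fun y : R => y^-1) ^+ j.
      by apply/funext => y; rewrite exprfctE.
    have := is_deriveX j dV; set a := (X in is_derive _ _ _ X -> _) => H.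
    suff <- : a = - j%:R * x^-1 ^+ j.+1 by exact: H.
    rewrite /a /GRing.scale /= mulrN mulNr -mulrA -exprVn -exprD.
    by case: j {E H a} => [|j]; rewrite ?mul0r //= addn2.
  have := is_deriveM dX dE; rewrite -[_ * _]/(fun y : R => y^-1 ^+ j * expR (- y^-1)).
  set a := (X in is_derive _ _ _ X -> _); set b := (X in _ -> is_derive _ _ _ X).
  suff -> : a = b by [].
  rewrite /a /b /exp_inv x0 /GRing.scale /= mulrA -exprVn -exprD addn2 addrC.
  by congr (_ + _); rewrite mulrC mulrA.
- rewrite x0 /exp_inv !ltxx mulr0 addr0.
  (* For h > 0 the difference quotient at 0 is [exp_inv j.+1 h], at most a multiple of h; for h < 0
     it is 0. *)
  have H : (fun h => h^-1 *: ((exp_inv j \o shift 0) (h *: 1) - exp_inv j 0)) @ 0^' --> (0:R).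
    have E0 : exp_inv j 0 = 0 by rewrite /exp_inv ltxx.
    apply/cvgrPdist_le => e e0; near=> h.
    rewrite sub0r normrN /= E0 subr0 addr0 /GRing.scale /= mulr1.
    have hn0 : h != 0 by near: h; exact: nbhs_dnbhs_neq.
    rewrite {1}/exp_inv; case: ifP => h0; last by rewrite mulr0 normr0 ltW.
    rewrite mulrA -exprS -[X in `|X|]/(if true then _ else 0) -h0 -/(exp_inv j.+1 h).
    rewrite ger0_norm ?exp_inv_ge0 //.
    apply: le_trans (exp_inv_le _ (ltW h0)) _.
    rewrite mulrC -ler_pdivlMr ?ltr0n ?fact_gt0 //.
    apply: le_trans (ler_norm _) _; near: h; apply: dnbhs0_le.
    by rewrite divr_gt0 // ltr0n fact_gt0.
  apply: DeriveDef; first by apply/cvg_ex; exists 0.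
  exact: cvg_lim H.
Unshelve. all: by end_near. Qed.

Lemma Ck_exp_inv k (U : set R) j : open U -> Ck_on k U (exp_inv j).
Proof.
move=> oU; elim: k j => [|k IH] j.
  move=> x _; apply: differentiable_continuous; apply/derivable1_diffP.
  by have [] := exp_inv_derive j x.
apply: (CkS_derive oU (fun x _ => exp_inv_derive j x)).
exact: (CkD oU (CkM oU (Ck_cst _ _ _) (IH _)) (IH _)).
Qed.

Definition step (x : R) : R :=
  exp_inv 0 (2 - x) / (exp_inv 0 (2 - x) + exp_inv 0 (x - 1)).

Lemma exp_inv0_gt0 x : (0 < exp_inv 0 x) = (0 < x).
Proof.
rewrite /exp_inv; case: (ltP 0 x) => _; last by rewrite ltxx.
by rewrite expr0 mul1r expR_gt0.
Qed.

Lemma step_denom_gt0 x : 0 < exp_inv 0 (2 - x) + exp_inv 0 (x - 1).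
Proof.
have [x2|x2] := ltP x 2.
  by rewrite ltr_pwDl ?exp_inv_ge0 // exp_inv0_gt0 subr_gt0.
rewrite ltr_pwDr ?exp_inv_ge0 // exp_inv0_gt0 subr_gt0.
by apply: lt_le_trans x2; rewrite ltr1n.
Qed.

Lemma step1 x : x <= 1 -> step x = 1.
Proof.
move=> x1; have := step_denom_gt0 x; rewrite /step.
by rewrite (@exp_inv_eq0 0 (x - 1)) ?subr_le0 // addr0 => /gt_eqF/negbT/divff.
Qed.

Lemma step0 x : 2 <= x -> step x = 0.
Proof. by move=> x2; rewrite /step exp_inv_eq0 ?mul0r // subr_le0. Qed.

Lemma Ck_step k : Ck_on k setT step.
Proof.
have C1 : Ck_on k setT (fun x : R => exp_inv 0 (2 - x)).
  apply: (@Ck_comp1 _ k setT setT (fun x : R => 2 - x)) => //; [exact: openT| |exact: Ck_exp_inv openT].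
  have -> : (fun x : R => 2 - x) = (fun x => 2 + (-1) * x).
    by apply/funext => x; rewrite mulN1r.
  apply: (CkD openT (Ck_cst _ _ _)); apply: (CkM openT (Ck_cst _ _ _)).
  exact: Ck_id.
have C2 : Ck_on k setT (fun x : R => exp_inv 0 (x - 1)).
  apply: (@Ck_comp1 _ k setT setT (fun x : R => x - 1)) => //; [exact: openT| |exact: Ck_exp_inv openT].
  apply: (CkD openT _ (Ck_cst _ _ _)).
  exact: Ck_id.
apply: (CkM openT C1); apply: (CkV openT) => [x _|]; last exact: CkD openT C1 C2.
by rewrite gt_eqF // step_denom_gt0.
Qed.

(** * Smoothness near a point, without tracking domains *)

Definition smooth_near V W (x : V) (f : V -> W) :=
  exists U : set V, [/\ open U, U x & smooth_on U f].

Lemma smooth_on_near V W (U : set V) (f : V -> W) :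
  (forall x, U x -> smooth_near x f) -> smooth_on U f.
Proof.
move=> H k; apply: Ck_local => x /H[G [oG Gx sf]].
by apply: (Ck_sub _ (sf k)) => _ ->.
Qed.

Lemma smooth_nearP V W (U : set V) (f : V -> W) : open U ->
  smooth_on U f -> forall x, U x -> smooth_near x f.
Proof. by move=> oU sf x Ux; exists U. Qed.

Lemma smooth_near_near V W (x : V) (f : V -> W) :
  smooth_near x f -> \forall y \near x, smooth_near y f.
Proof.
move=> [U [oU Ux sf]]; near=> y; exists U; split => //.
by near: y; exact: open_nbhs_nbhs.
Unshelve. all: by end_near. Qed.

Lemma smooth_near_ext V W (x : V) (f g : V -> W) :
  (\forall y \near x, f y = g y) -> smooth_near x f -> smooth_near x g.
Proof.
move=> /near_open[G [oG Gx fg]] [U [oU Ux sf]].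
exists (G `&` U); split=> //; first exact: openI.
move=> k; apply: (Ck_ext (openI oG oU) (f := f)); first by move=> y [/fg].
by apply: (Ck_sub _ (sf k)) => y [].
Qed.

Lemma smooth_near_eq V W (x : V) (f g : V -> W) :
  f =1 g -> smooth_near x f -> smooth_near x g.
Proof. by move=> /funext ->. Qed.

Lemma smooth_near2 V W W' (x : V) (f : V -> W) (g : V -> W') :
  smooth_near x f -> smooth_near x g ->
  exists U, [/\ open U, U x, smooth_on U f & smooth_on U g].
Proof.
move=> [G [oG Gx sf]] [U [oU Ux sg]]; exists (G `&` U).
split=> //; first exact: openI.
- by move=> k; apply: (Ck_sub _ (sf k)) => y [].
- by move=> k; apply: (Ck_sub _ (sg k)) => y [].
Qed.

Lemma smooth_near_diff V W (x : V) (f : V -> W) :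
  smooth_near x f -> differentiable f x.
Proof. by move=> [U [oU Ux /(_ 1%N)]]; rewrite CkSE => -[/(_ x Ux)]. Qed.

Lemma smooth_near_continuous V W (x : V) (f : V -> W) :
  smooth_near x f -> {for x, continuous f}.
Proof. by move=> /smooth_near_diff; exact: differentiable_continuous. Qed.

Lemma smooth_near_d V W (x : V) (f : V -> W) v :
  smooth_near x f -> smooth_near x (fun y => 'd f y v).
Proof.
move=> [U [oU Ux sf]]; exists U; split=> // k.
by have := sf k.+1; rewrite CkSE => -[_ /(_ v)].
Qed.

Lemma smooth_near_cst V W (x : V) (a : W) : smooth_near x (fun=> a).
Proof. by exists setT; split=> // [|k]; [exact: openT | exact: Ck_cst]. Qed.

Lemma smooth_near_id V (x : V) : smooth_near x (fun y => y).
Proof. by exists setT; split=> // [|k]; [exact: openT | exact: Ck_id]. Qed.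

Lemma smooth_nearD V (x : V) (f g : V -> R) : smooth_near x f ->
  smooth_near x g -> smooth_near x (fun y => f y + g y).
Proof.
move=> sf sg; have [U [oU Ux Uf Ug]] := smooth_near2 sf sg.
by exists U; split=> // k; apply: CkD.
Qed.

Lemma smooth_nearM V (x : V) (f g : V -> R) : smooth_near x f ->
  smooth_near x g -> smooth_near x (fun y => f y * g y).
Proof.
move=> sf sg; have [U [oU Ux Uf Ug]] := smooth_near2 sf sg.
by exists U; split=> // k; apply: CkM.
Qed.

Lemma smooth_nearV V (x : V) (f : V -> R) : smooth_near x f -> f x != 0 ->
  smooth_near x (fun y => (f y)^-1).
Proof.
move=> sf fx0; have := smooth_near_continuous sf.
move=> /cvgr_neq0 - /(_ fx0); move=> /near_open[G [oG Gx f0]].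
have [U [oU Ux Uf]] := sf; exists (G `&` U); split=> //; first exact: openI.
move=> k; apply: CkV; first exact: openI; first by move=> y [/f0].
by apply: (Ck_sub _ (Uf k)) => y [].
Qed.

Lemma smooth_near_sum V I (r : seq I) (P : pred I) (x : V) (f : I -> V -> R) :
  (forall i, P i -> smooth_near x (f i)) ->
  smooth_near x (fun y => \sum_(i <- r | P i) f i y).
Proof.
move=> H; elim: r => [|i r IH].
  apply: (smooth_near_ext _ (smooth_near_cst x (0 : R))).
  by near=> y; rewrite big_nil.
have [Pi|/negPf Pi] := boolP (P i).
  apply: (smooth_near_ext _ (smooth_nearD (H i Pi) IH)).
  by near=> y; rewrite big_cons Pi.
by apply: (smooth_near_ext _ IH); near=> y; rewrite big_cons Pi.
Unshelve. all: by end_near. Qed.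

Lemma diff_sumv V I (r : seq I) (x v : V) (f : I -> V -> R) :
  (forall i, smooth_near x (f i)) ->
  'd (fun y => \sum_(i <- r) f i y) x v = \sum_(i <- r) 'd (f i) x v.
Proof.
move=> sf; elim: r => [|i r IH].
  have -> : (fun y => \sum_(i <- [::]) f i y) = cst 0 by apply/funext => y; rewrite big_nil.
  by rewrite big_nil; exact: (congr1 (fun k : V -> R => k v) (diff_cst (0 : R) x)).
have -> : (fun y => \sum_(j <- i :: r) f j y) = (fun y => f i y + \sum_(j <- r) f j y).
  by apply/funext => y; rewrite big_cons.
rewrite big_cons -IH diffDv //; first exact: smooth_near_diff.
exact/smooth_near_diff/smooth_near_sum.
Qed.

Lemma smooth_near_prod V I (r : seq I) (x : V) (f : I -> V -> R) :
  (forall i, smooth_near x (f i)) ->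
  smooth_near x (fun y => \prod_(i <- r) f i y).
Proof.
move=> H; elim: r => [|i r IH].
  apply: (smooth_near_ext _ (smooth_near_cst x (1 : R))).
  by near=> y; rewrite big_nil.
apply: (smooth_near_ext _ (smooth_nearM (H i) IH)).
by near=> y; rewrite big_cons.
Unshelve. all: by end_near. Qed.

Lemma smooth_near_coord V m (x : V) (f : V -> 'rV[R]_m) :
  smooth_near x f <-> forall i, smooth_near x (fun y => f y 0 i : R).
Proof.
split=> [[U [oU Ux sf]] i|H].
  by exists U; split=> // k; have /(Ck_coord _ _ oU) := sf k.
have HE : forall i, exists U : set V,
  [/\ open U, U x & smooth_on U (fun y => f y 0 i : R)] by [].
have [U HU] := choice HE.
have : \forall y \near x, forall i, U i y.
  by apply: filter_forall => i; have [oU Ux _] := HU i; exact: open_nbhs_nbhs.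
move=> /near_open[G [oG Gx GU]]; exists G; split=> // k.
apply/(Ck_coord _ _ oG) => i; have [_ _ sU] := HU i.
by apply: (Ck_sub _ (sU k)) => y /GU.
Qed.

Lemma smooth_near_comp_real V m (x : V) (f : V -> 'rV[R]_m)
    (g : 'rV[R]_m -> R) : smooth_near x f -> smooth_near (f x) g ->
  smooth_near x (g \o f).
Proof.
move=> sf [U' [oU' U'x sg]]; have [U [oU Ux Uf]] := sf.
have : \forall y \near x, U' (f y).
  by apply: (smooth_near_continuous sf); exact: open_nbhs_nbhs.
move=> /near_open[G [oG Gx GU]]; exists (G `&` U); split=> // [|k].
  exact: openI.
apply: (@Ck_comp _ _ _ _ U' f g (openI oG oU)); last exact: sg.
  by move=> y [/GU].
by apply: (Ck_sub _ (Uf k)) => y [].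
Qed.

Lemma smooth_near_comp V m k (x : V) (f : V -> 'rV[R]_m)
    (g : 'rV[R]_m -> 'rV[R]_k) : smooth_near x f -> smooth_near (f x) g ->
  smooth_near x (g \o f).
Proof.
move=> sf /smooth_near_coord sg; apply/smooth_near_coord => i.
exact: smooth_near_comp_real sf (sg i).
Qed.

Lemma smooth_near_comp1 V (x : V) (f : V -> R)
    (g : R -> R) : smooth_near x f -> smooth_near (f x) g ->
  smooth_near x (g \o f).
Proof.
move=> sf [U' [oU' U'x sg]]; have [U [oU Ux Uf]] := sf.
have : \forall y \near x, U' (f y).
  by apply: (smooth_near_continuous sf); exact: open_nbhs_nbhs.
move=> /near_open[G [oG Gx GU]]; exists (G `&` U); split=> // [|k].
  exact: openI.
apply: (@Ck_comp1 _ _ _ U' f g (openI oG oU)); last exact: sg.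
  by move=> y [/GU].
by apply: (Ck_sub _ (Uf k)) => y [].
Qed.

(** Point and direction both move; linearity in the direction reduces this to derivatives in fixed
    directions. *)
Lemma smooth_near_dvar_real V m (x : V) (a w : V -> 'rV[R]_m)
    (f : 'rV[R]_m -> R) : smooth_near x a -> smooth_near (a x) f ->
  smooth_near x w -> smooth_near x (fun y => 'd f (a y) (w y)).
Proof.
move=> sa sf sw.
apply: (@smooth_near_ext _ _ _
    (fun y => \sum_j w y 0 j * 'd f (a y) (delta_mx 0 j))).
  by near=> y; rewrite [in RHS]diff_delta.
apply: smooth_near_sum => j _; apply: smooth_nearM.
  by have /smooth_near_coord := sw.
exact: smooth_near_comp_real sa (smooth_near_d (delta_mx 0 j) sf).
Unshelve. all: by end_near. Qed.

Lemma smooth_near_det V m (x : V) (A : V -> 'M[R]_m) :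
  (forall i j, smooth_near x (fun y => A y i j)) ->
  smooth_near x (fun y => \det (A y)).
Proof.
move=> sA; apply: smooth_near_sum => s _; apply: smooth_nearM.
  exact: smooth_near_cst.
by apply: smooth_near_prod => i.
Qed.

(** Cramer's formula. It describes [invmx] only where the determinant is nonzero, which holds near x
    by continuity. *)
Lemma smooth_near_invmx V m (x : V) (A : V -> 'M[R]_m) i j :
  (forall i j, smooth_near x (fun y => A y i j)) -> A x \in unitmx ->
  smooth_near x (fun y => invmx (A y) i j).
Proof.
move=> sA uA; have sdet := smooth_near_det sA.
have det0 : \det (A x) != 0 by move: uA; rewrite unitmxE unitfE.
apply: (@smooth_near_ext _ _ _
    (fun y => (\det (A y))^-1 * ((-1) ^+ (j + i) * \det (row' j (col' i (A y)))))).
  have : \forall y \near x, \det (A y) != 0.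
    by have /cvgr_neq0/(_ det0) := smooth_near_continuous sdet.
  apply: filterS => y dy.
  by rewrite /invmx unitmxE unitfE dy !mxE.
apply: smooth_nearM; first exact: smooth_nearV.
apply: smooth_nearM; first exact: smooth_near_cst.
apply: smooth_near_det => k l.
by under [X in smooth_near _ X]funext => y do rewrite !mxE.
Qed.

(** The norm of row vectors is the maximum norm, so cutting off each coordinate separately cuts off
    a ball. Squares replace absolute values, which are not smooth. *)
Definition bump n (c : 'rV[R]_n) (r : R) (y : 'rV[R]_n) : R :=
  \prod_(i < n) step ((y 0 i - c 0 i) ^+ 2 / r ^+ 2).

Lemma smooth_near_bump n (c : 'rV[R]_n) r x : smooth_near x (bump c r).
Proof.
apply: smooth_near_prod => i.
apply: (@smooth_near_comp1 _ _ (fun y : 'rV[R]_n => (y 0 i - c 0 i) ^+ 2 / r ^+ 2)).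
  have si : smooth_near x (fun y : 'rV[R]_n => y 0 i - c 0 i).
    apply: smooth_nearD (smooth_near_cst _ _).
    by have /smooth_near_coord := smooth_near_id x.
  exact: smooth_nearM (smooth_nearM si si) (smooth_near_cst _ _).
by exists setT; split=> // [|k]; [exact: openT | exact: Ck_step].
Qed.

Lemma bump1 n (c : 'rV[R]_n) r y : 0 < r -> `|y - c| <= r -> bump c r y = 1.
Proof.
move=> r0; rewrite [X in X <= _]/Num.norm /= mx_normrE => /bigmax_leP[_ H].
rewrite /bump big1 // => i _; apply: step1.
have /= := H (0, i) isT; rewrite !mxE => h.
by rewrite ler_pdivrMr ?exprn_gt0 // mul1r -real_normK ?num_real // lerXn2r ?nnegrE // ltW.
Qed.

Lemma bump0 n (c : 'rV[R]_n) r y : 0 < r -> 2 * r < `|y - c| -> bump c r y = 0.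
Proof.
move=> r0 H.
have : mx_norm (y - c) != 0.
  by rewrite gt_eqF //; apply: lt_trans H; rewrite mulr_gt0.
move=> /mx_norm_neq0[[k i]] /= E.
move: H; rewrite /Num.norm /= E !mxE (ord1 k) => H.
rewrite /bump (bigD1 i) //= step0 ?mul0r //.
rewrite ler_pdivlMr ?exprn_gt0 // -[leRHS]real_normK ?num_real //.
apply: le_trans (_ : (2 * r) ^+ 2 <= _); last first.
  by rewrite lerXn2r ?nnegrE ?normr_ge0 ?(ltW H) // mulr_ge0 // ltW.
by rewrite exprMn ler_wpM2r ?exprn_ge0 ?ltW // expr2 ltr_pMr // ltr1n.
Qed.

End SmoothCalculus.

(** * Smooth functions and fields on manifolds *)

Section Charts.
Context {R : realType} {n : nat} {M : manifold R n}.
Implicit Types p q x y : M.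

Lemma dom_near q x : dom q x -> \forall y \near x, dom q y.
Proof. by move=> qx; apply: open_nbhs_nbhs; split=> //; exact: dom_open. Qed.

Lemma chart_near q x : dom q x ->
  \forall z \near chart q x, (chart q @` dom q) z.
Proof.
by move=> qx; apply: open_nbhs_nbhs; split; [exact: chart_open|exists x].
Qed.

Lemma chart_invK q z : (chart q @` dom q) z ->
  chart q (chart_inv q z) = z /\ dom q (chart_inv q z).
Proof. by move=> [x qx <-]; rewrite chartK. Qed.

Lemma near_chart_inv q x (P : set M) : dom q x ->
  (\forall y \near x, P y) -> \forall z \near chart q x, P (chart_inv q z).
Proof.
move=> qx H.
have : chart_inv q z @[z --> chart q x] --> chart_inv q (chart q x).
  by apply: chart_inv_continuous; exists x.
by rewrite chartK // => /(_ _ H).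
Qed.

Lemma near_chart q x (P : set 'rV[R]_n) : dom q x ->
  (\forall z \near chart q x, P z) -> \forall y \near x, P (chart q y).
Proof. by move=> qx; exact: chart_continuous. Qed.

Lemma open_chart q (A : set M) : open A -> open (chart q @` (dom q `&` A)).
Proof.
move=> oA; rewrite openE => _ [x [qx Ax] <-].
have := near_chart_inv qx (open_nbhs_nbhs (conj oA Ax)).
apply: filterS2 (chart_near qx) => z /chart_invK[E qz] Az.
by exists (chart_inv q z).
Qed.

Lemma chart_trans_smooth p q x : dom p x -> dom q x ->
  smooth_near (chart p x) (chart q \o chart_inv p).
Proof.
move=> px qx; apply: smooth_nearP (@chart_smooth _ _ M p q) _ _.
  by apply: open_chart; exact: dom_open.
by exists x.
Qed.

Definition smooth_at p (h : M -> R) := smooth_near (chart p p) (h \o chart_inv p).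

Lemma smooth_at_chart q p h : dom q p ->
  smooth_at p h <-> smooth_near (chart q p) (h \o chart_inv q).
Proof.
move=> qp; rewrite /smooth_at; have pp := dom_center p.
have key (a b : M) : dom a p -> dom b p -> smooth_near (chart a p) (h \o chart_inv a) ->
    smooth_near (chart b p) (h \o chart_inv b).
  move=> ap bp sh.
  apply: (@smooth_near_ext _ _ _ _ ((h \o chart_inv a) \o (chart a \o chart_inv b))).
    have := near_chart_inv bp (dom_near ap).
    by apply: filterS => z az /=; rewrite chartK.
  apply: smooth_near_comp_real; first exact: chart_trans_smooth.
  by rewrite /= chartK.
by split; apply: key.
Qed.

Lemma smooth_at_ext p h k : (\forall y \near p, h y = k y) ->
  smooth_at p h -> smooth_at p k.
Proof.
by move=> hk; apply: smooth_near_ext; exact: (near_chart_inv (dom_center p) hk).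
Qed.

Lemma smooth_funP (h : M -> R) : smooth_fun h <-> forall p, smooth_at p h.
Proof.
split=> [sh p|sh p].
  rewrite /smooth_at; apply: (smooth_nearP _ (sh p)); first exact: chart_open.
  by exists p => //; exact: dom_center.
by apply: smooth_on_near => _ [x px <-]; apply/smooth_at_chart.
Qed.

Lemma smooth_fun_at p h : smooth_fun h -> smooth_at p h.
Proof. by move=> /smooth_funP. Qed.

Lemma smooth_at_cst p (a : R) : smooth_at p (fun=> a).
Proof. exact: smooth_near_cst. Qed.

Lemma smooth_atD p h k : smooth_at p h -> smooth_at p k ->
  smooth_at p (fun y => h y + k y).
Proof. exact: smooth_nearD. Qed.

Lemma smooth_atM p h k : smooth_at p h -> smooth_at p k ->
  smooth_at p (fun y => h y * k y).
Proof. exact: smooth_nearM. Qed.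

Lemma smooth_at_sum I (r : seq I) (P : pred I) p (h : I -> M -> R) :
  (forall i, P i -> smooth_at p (h i)) ->
  smooth_at p (fun y => \sum_(i <- r | P i) h i y).
Proof. exact: smooth_near_sum. Qed.

Lemma smooth_at_invmx k p (A : M -> 'M[R]_k) i j :
  (forall i j, smooth_at p (fun y => A y i j)) -> A p \in unitmx ->
  smooth_at p (fun y => invmx (A y) i j).
Proof.
move=> sA uA; apply: (@smooth_near_invmx _ _ _ _ (A \o chart_inv p)) => //.
by rewrite /= chartK //; exact: dom_center.
Qed.

Lemma smooth_at_diff q p h : dom q p -> smooth_at p h ->
  differentiable (h \o chart_inv q) (chart q p).
Proof. by move=> qp /(smooth_at_chart h qp) /smooth_near_diff. Qed.

Lemma smooth_at_coord q p i : dom q p -> smooth_at p (fun y => chart q y 0 i).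
Proof.
move=> qp; apply/(smooth_at_chart _ qp).
apply: (@smooth_near_ext _ _ _ _ (fun z : 'rV[R]_n => z 0 i)).
  by apply: filterS (chart_near qp) => z /chart_invK[/= ->].
by have /smooth_near_coord := smooth_near_id (chart q p).
Qed.

(** Extension by zero from a chart is smooth once the support lies in a closed subset of the
    manifold inside the chart domain. Here this set is the image of a closed coordinate ball, which
    is compact, hence closed because the manifold is Hausdorff. *)
Lemma cutoff q (U : set M) : (\forall y \near q, U y) ->
  exists (chi : M -> R) (K : set M), [/\ smooth_fun chi,
    \forall y \near q, chi y = 1, closed K, K `<=` U &
    forall y, ~ K y -> chi y = 0].
Proof.
move=> Uq; have qq := dom_center q; set c := chart q q.
have : \forall z \near c, (chart q @` dom q) z /\ U (chart_inv q z).
  by apply: filterI; [exact: chart_near | exact: near_chart_inv].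
move=> /nbhs_ballP[r /= r0]; rewrite -ball_normE /= => Hr.
(* [bump c s] vanishes only beyond distance 2 s, and this must stay below r. *)
pose s := r / 4.
have s0 : 0 < s by rewrite divr_gt0.
have sr : 2 * s < r.
  by rewrite /s mulrA ltr_pdivrMr // mulrC ltr_pM2l // ltr_nat.
pose B := [set z : 'rV[R]_n | `|z - c| <= 2 * s].
have BH z : B z -> (chart q @` dom q) z /\ U (chart_inv q z).
  by move=> Bz; apply: Hr; rewrite /= distrC; exact: le_lt_trans sr.
have cB : compact B.
  apply: bounded_closed_compact.
    exists (`|c| + 2 * s); split; first exact: num_real.
    move=> t Ht z Bz; rewrite -(subrK c z); apply: le_trans (ler_normD _ _) _.
    by apply: le_trans (ltW Ht); rewrite addrC lerD2l.
  have -> : B = (fun z : 'rV[R]_n => `|z - c|) @^-1` [set t | t <= 2 * s] by [].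
  apply: closed_comp; last exact: closed_le.
  move=> z _; apply: (@continuous_comp _ _ _ (fun z : 'rV[R]_n => z - c) (fun z => `|z|)).
    by apply: continuousB; [exact: cvg_id | exact: cst_continuous].
  exact: norm_continuous.
pose K := chart_inv q @` B.
have clK : closed K.
  apply: compact_closed; first exact: carrier_hausdorff.
  apply: continuous_compact => //; apply: continuous_in_subspaceT => z.
  by rewrite inE => /BH[+ _]; exact: chart_inv_continuous.
have Kq y : K y -> dom q y /\ U y.
  by move=> [z /BH[/chart_invK[_ ?] ?] <-].
pose chi y := if pselect (dom q y) then bump c s (chart q y) else 0.
have chiK y : ~ K y -> chi y = 0.
  move=> nK; rewrite /chi; case: pselect => // qy; apply: bump0 => //.
  rewrite ltNge; apply/negP => By; apply: nK; exists (chart q y) => //.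
  exact: chartK.
exists chi, K; split=> //.
- apply/smooth_funP => y; case: (pselect (dom q y)) => [qy|nqy].
    apply/(smooth_at_chart _ qy); apply: smooth_near_ext (smooth_near_bump c s _).
    apply: filterS (chart_near qy) => z /chart_invK[E qz] /=.
    by rewrite /chi; case: pselect => [?|]; rewrite ?E.
  apply: (smooth_at_ext _ (smooth_at_cst y 0)).
  have : \forall x \near y, (~` K) x.
    apply: open_nbhs_nbhs; split; first exact: closed_openC.
    by move=> /Kq[].
  by apply: filterS => x /chiK.
- have : \forall z \near c, bump c s z = 1.
    apply/nbhs_ballP; exists s => //= z; rewrite -ball_normE /= distrC => /ltW.
    exact: bump1.
  move=> /(near_chart qq); apply: filterS2 (dom_near qq) => y qy.
  by rewrite /chi; case: pselect.
- by move=> y /Kq[].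
Qed.

Implicit Types v u : 'rV[R]_n.

Lemma dfunE (h : M -> R) p v : dfun h p v = 'd (h \o chart_inv p) (chart p p) v.
Proof. by []. Qed.

Lemma dfunDr (h : M -> R) p u v : dfun h p (u + v) = dfun h p u + dfun h p v.
Proof. by rewrite /dfun linearD. Qed.

Lemma dfunZr (h : M -> R) p a u : dfun h p (a *: u) = a * dfun h p u.
Proof. by rewrite /dfun linearZ. Qed.

Lemma dfun0r (h : M -> R) p : dfun h p 0 = 0.
Proof. by rewrite /dfun linear0. Qed.

Lemma dfunNr (h : M -> R) p u : dfun h p (- u) = - dfun h p u.
Proof. by rewrite /dfun linearN. Qed.

Lemma dfun_sumr (h : M -> R) p I (r : seq I) (P : pred I) (u : I -> 'rV[R]_n) :
  dfun h p (\sum_(i <- r | P i) u i) = \sum_(i <- r | P i) dfun h p (u i).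
Proof. by rewrite /dfun linear_sum. Qed.

Lemma dfun_ext p h k u : smooth_at p h -> (\forall y \near p, h y = k y) ->
  dfun k p u = dfun h p u.
Proof.
move=> sh hk; rewrite /dfun.
have [_] := near_eq_diff (near_chart_inv (dom_center p) hk)
  (smooth_at_diff (dom_center p) sh).
by move=> /(congr1 (fun g => g u)).
Qed.

Lemma dfun_cst p (a : R) u : dfun (fun _ : M => a) p u = 0.
Proof.
have := @diff_cst R _ _ a (chart p p).
by move=> /(congr1 (fun g : 'rV[R]_n -> R => g u)).
Qed.

Lemma dfun_near_cst p h (a : R) u : (\forall y \near p, h y = a) -> dfun h p u = 0.
Proof.
move=> H; rewrite (@dfun_ext p (fun=> a)) ?dfun_cst //; first exact: smooth_at_cst.
by apply: filterS H.
Qed.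

Lemma dfunD p h k u : smooth_at p h -> smooth_at p k ->
  dfun (fun y => h y + k y) p u = dfun h p u + dfun k p u.
Proof.
move=> /(smooth_at_diff (dom_center p)) dh /(smooth_at_diff (dom_center p)) dk.
exact: (congr1 (fun g : 'rV[R]_n -> R => g u) (diffD dh dk)).
Qed.

Lemma dfunM p h k u : smooth_at p h -> smooth_at p k ->
  dfun (fun y => h y * k y) p u = dfun h p u * k p + h p * dfun k p u.
Proof.
move=> /(smooth_at_diff (dom_center p)) dh /(smooth_at_diff (dom_center p)) dk.
have := congr1 (fun g : 'rV[R]_n -> R => g u) (diffM dh dk).
rewrite /= chartK; last exact: dom_center.
move=> E; have E' : dfun (fun y => h y * k y) p u
  = h p * dfun k p u + k p * dfun h p u by exact: E.
rewrite E'; move: (dfun h p u) (dfun k p u) => a b.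
by rewrite addrC (mulrC (k p)).
Qed.

Lemma dfun_sum p I (r : seq I) (P : pred I) (h : I -> M -> R) u :
  (forall i, P i -> smooth_at p (h i)) ->
  dfun (fun y => \sum_(i <- r | P i) h i y) p u
  = \sum_(i <- r | P i) dfun (h i) p u.
Proof.
move=> sh; elim: r => [|i r IH].
  by rewrite big_nil; apply: (@dfun_near_cst _ _ 0); apply: nearW => y; rewrite big_nil.
rewrite big_cons; have [Pi|/negPf Pi] := boolP (P i).
  rewrite -IH -(dfunD u (sh i Pi) (smooth_at_sum r sh)); apply: dfun_ext.
    exact: smooth_atD (sh i Pi) (smooth_at_sum r sh).
  by apply: nearW => y; rewrite big_cons Pi.
rewrite -IH; apply: dfun_ext; first exact: smooth_at_sum.
by apply: nearW => y; rewrite big_cons Pi.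
Qed.

Lemma dfun_chart q p h u : dom q p -> smooth_at p h ->
  dfun h p u = 'd (h \o chart_inv q) (chart q p) (tangent_coord q p u).
Proof.
move=> qp sh; rewrite /dfun /tangent_coord; have pp := dom_center p.
apply: diff_comp_near; first exact: smooth_near_diff (chart_trans_smooth pp qp).
- by rewrite /= chartK.
- exact: smooth_at_diff.
- have := near_chart_inv pp (dom_near qp).
  by apply: filterS => z az /=; rewrite chartK.
Qed.

(* d/dx_i of the chart q: tangent vectors at y are read in the chart of y. *)
Definition chart_field q (i : 'I_n) y : 'rV[R]_n :=
  'd (chart y \o chart_inv q) (chart q y) (delta_mx 0 i).

Lemma tangent_coord_chart_field q p y i : dom q y -> dom p y ->
  tangent_coord p y (chart_field q i y)
  = 'd (chart p \o chart_inv q) (chart q y) (delta_mx 0 i).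
Proof.
move=> qy py; rewrite /tangent_coord /chart_field; have yy := dom_center y.
apply: esym; apply: diff_comp_near.
- exact: smooth_near_diff (chart_trans_smooth qy yy).
- by rewrite /= chartK.
- exact: smooth_near_diff (chart_trans_smooth yy py).
- have := near_chart_inv qy (dom_near yy).
  by apply: filterS => z az /=; rewrite chartK.
Qed.

Lemma tangent_coord_self q y i : dom q y ->
  tangent_coord q y (chart_field q i y) = delta_mx 0 i.
Proof.
move=> qy; rewrite tangent_coord_chart_field //.
rewrite -[RHS](diff_idv (chart q y)).
have E : \forall z \near chart q y, z = (chart q \o chart_inv q) z.
  by apply: filterS (chart_near qy) => z /chart_invK[/= ->].
have [_] := near_eq_diff E (smooth_near_diff (smooth_near_id _)).
by move=> /(congr1 (fun g : 'rV[R]_n -> 'rV[R]_n => g (delta_mx 0 i))).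
Qed.

Lemma dfun_chart_field q y h i : dom q y -> smooth_at y h ->
  dfun h y (chart_field q i y) = 'd (h \o chart_inv q) (chart q y) (delta_mx 0 i).
Proof. by move=> qy sh; rewrite (dfun_chart _ qy) // tangent_coord_self. Qed.

Lemma tangent_coord_inj q y u v : dom q y ->
  tangent_coord q y u = tangent_coord q y v -> u = v.
Proof.
move=> qy; rewrite /tangent_coord; have yy := dom_center y.
have E w : w = 'd (chart y \o chart_inv q) (chart q y)
    ('d (chart q \o chart_inv y) (chart y y) w).
  rewrite -[LHS](diff_idv (chart y y)); apply: diff_comp_near.
  - exact: smooth_near_diff (chart_trans_smooth yy qy).
  - by rewrite /= chartK.
  - exact: smooth_near_diff (chart_trans_smooth qy yy).
  - have := near_chart_inv yy (dom_near qy).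
    apply: filterS2 (chart_near yy) => z /chart_invK[Ez yz] az /=.
    by rewrite chartK.
by move=> uv; rewrite (E u) (E v); congr ('d _ _ _).
Qed.

Lemma tangent_coord_expand q y v : dom q y ->
  v = \sum_i tangent_coord q y v 0 i *: chart_field q i y.
Proof.
move=> qy; apply: (tangent_coord_inj qy).
rewrite [X in _ = X]/tangent_coord linear_sum [LHS]row_sum_delta.
apply: eq_bigr => i _; rewrite linearZ; congr (_ *: _).
by rewrite -[RHS]/(tangent_coord q y (chart_field q i y)) tangent_coord_self.
Qed.

Lemma dfun_coord q y u i : dom q y ->
  dfun (fun z => chart q z 0 i) y u = tangent_coord q y u 0 i.
Proof.
move=> qy; rewrite /dfun /tangent_coord.
have [_ E] := diff_coord i (smooth_near_diff (chart_trans_smooth (dom_center y) qy)).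
exact: E.
Qed.

(** The axioms of connections and metrics speak of global functions; this makes local ones, such as
    chart coordinates, eligible. *)
Lemma smooth_extend q h : (\forall y \near q, smooth_at y h) ->
  exists2 k, smooth_fun k & \forall y \near q, k y = h y.
Proof.
move=> /near_open[G [oG Gq sh]].
have [chi [K [schi chi1 cK KG chi0]]] := cutoff (open_nbhs_nbhs (conj oG Gq)).
exists (fun y => chi y * h y); last by apply: filterS chi1 => y ->; rewrite mul1r.
apply/smooth_funP => y; have [Gy|nGy] := pselect (G y).
  by apply: smooth_atM; [exact: smooth_fun_at | exact: sh].
apply: (smooth_at_ext _ (smooth_at_cst y 0)).
have : \forall x \near y, (~` K) x.
  by apply: open_nbhs_nbhs; split; [exact: closed_openC | move/KG].
by apply: filterS => x /chi0 ->; rewrite mul0r.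
Qed.

End Charts.

Local Opaque dfun tangent_coord.

(** * Smooth maps and fields along them *)

Section SmoothMaps.
Context {R : realType} {m n : nat} {M : manifold R m} {N : manifold R n}.
Variable F : M -> N.
Hypothesis sF : smooth_map F.
Implicit Types (p : M) (q : N).

Lemma map_near p (P : set N) :
  (\forall y \near F p, P y) -> \forall x \near p, P (F x).
Proof. by have [cF _] := sF; exact: cF. Qed.

Lemma smooth_map_near p q x : dom p x -> dom q (F x) ->
  smooth_near (chart p x) (chart q \o F \o chart_inv p).
Proof.
move=> px qx; have [cF sm] := sF; apply: smooth_nearP (sm p q) _ _.
  apply: open_chart; apply: open_comp; last exact: dom_open.
  by move=> y _; exact: cF.
by exists x.
Qed.

Lemma smooth_at_comp p h : smooth_at (F p) h -> smooth_at p (h \o F).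
Proof.
move=> sh; have pp := dom_center p; have Fp := dom_center (F p).
apply: (@smooth_near_ext _ _ _ _
  ((h \o chart_inv (F p)) \o (chart (F p) \o F \o chart_inv p))).
  have := near_chart_inv pp (map_near (dom_near Fp)).
  by apply: filterS => z az /=; rewrite chartK.
apply: smooth_near_comp_real; first exact: smooth_map_near.
by rewrite /= chartK.
Qed.

Lemma smooth_fun_comp h : smooth_fun h -> smooth_fun (h \o F).
Proof. by move=> /smooth_funP sh; apply/smooth_funP => p; exact: smooth_at_comp. Qed.

Lemma tmapE p u :
  tmap F p u = 'd (chart (F p) \o F \o chart_inv p) (chart p p) u.
Proof. by rewrite /tmap lfunE. Qed.

Lemma dfun_tmap p h u : smooth_at (F p) h ->
  dfun (h \o F) p u = dfun h (F p) (tmap F p u).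
Proof.
move=> sh; rewrite tmapE; have pp := dom_center p; have Fp := dom_center (F p).
apply: diff_comp_near.
- exact: smooth_near_diff (smooth_map_near pp Fp).
- by rewrite /= chartK.
- exact: smooth_at_diff.
- have := near_chart_inv pp (map_near (dom_near Fp)).
  by apply: filterS => z az /=; rewrite chartK.
Qed.

Definition along_smooth_at p (W : M -> 'rV[R]_n) :=
  forall h, smooth_fun h -> smooth_at p (fun x => dfun h (F x) (W x)).

(** Testing W on functions instead of charts makes sums, multiples and images under [tmap]
    immediate. For the converse, the test functions are chart coordinates extended to all of N. *)
Lemma smooth_alongP (W : M -> 'rV[R]_n) :
  smooth_along F W <-> forall p, along_smooth_at p W.
Proof.
split=> [sW p h sh|sW p q].
  have pp := dom_center p; have Fp := dom_center (F p).
  pose a := chart (F p) \o F \o chart_inv p.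
  pose w := (fun x => tangent_coord (F p) (F x) (W x)) \o chart_inv p.
  apply: (@smooth_near_ext _ _ _ _ (fun z => 'd (h \o chart_inv (F p)) (a z) (w z))).
    have := near_chart_inv pp (map_near (dom_near Fp)).
    apply: filterS => z az /=; rewrite [RHS](dfun_chart _ az) //.
    exact: smooth_fun_at.
  apply: smooth_near_dvar_real.
  - exact: smooth_map_near.
  - by rewrite /a /= chartK //; exact: smooth_fun_at.
  - have [cF _] := sF; apply: smooth_nearP (sW p (F p)) _ _; last by exists p.
    apply: open_chart; apply: open_comp; last exact: dom_open.
    by move=> y _; exact: cF.
apply: smooth_on_near => _ [x [px qx] <-]; apply/smooth_near_coord => i.
have [k sk kE] : exists2 k, smooth_fun k &
    \forall y \near F x, k y = chart q y 0 i.
  by apply: smooth_extend; apply: filterS (dom_near qx) => y; exact: smooth_at_coord.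
apply/(smooth_at_chart (fun y => tangent_coord q (F y) (W y) 0 i) px).
(* [dfun] sees only germs, so agreement of k with a coordinate on an open set gives agreement of
   derivatives at each of its points. *)
have H : \forall y \near F x, forall v, dfun k y v = tangent_coord q y v 0 i.
  have [G [oG Gx kG]] := near_open kE.
  have : \forall y \near F x, G y by apply: open_nbhs_nbhs.
  apply: filterS2 (dom_near qx) => y qy Gy v.
  rewrite -(dfun_coord v i qy); apply: dfun_ext (smooth_at_coord i qy) _.
  by apply: filterS (open_nbhs_nbhs (conj oG Gy)) => z /kG ->.
by apply: (smooth_at_ext _ (sW x k sk)); apply: filterS (map_near H) => z ->.
Qed.

End SmoothMaps.

Lemma smooth_map_id {R : realType} {n : nat} (M : manifold R n) :
  smooth_map (@idfun M).
Proof.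
split=> [x|p q]; first exact: cvg_id.
exact: (@chart_smooth _ _ M p q).
Qed.

Local Opaque tmap.

(** * Global functions and fields that are coordinates near a point *)

Section Coordinates.
Context {R : realType} {n : nat} {N : manifold R n}.
Implicit Types (q y : N) (x : 'I_n -> N -> R) (e : 'I_n -> N -> 'rV[R]_n).

Lemma vector_fieldP (X : N -> 'rV[R]_n) : vector_field X <->
  forall h, smooth_fun h -> smooth_fun (fun y => dfun h y (X y)).
Proof.
have P := smooth_alongP (smooth_map_id N) X.
split=> [/P H h sh|H]; first by apply/smooth_funP => p; exact: H.
by apply/P => p h sh; exact/smooth_fun_at/H.
Qed.

(* Smooth functions and vector fields defined on all of N, with the duality of
   coordinates and coordinate fields near q only. *)
Definition coordinate_system q x e :=
  [/\ forall i, smooth_fun (x i), forall i, vector_field (e i) &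
    \forall y \near q, (forall v, v = \sum_i dfun (x i) y v *: e i y) /\
      (forall i j, dfun (x i) y (e j y) = (i == j)%:R)].

Lemma coordinate_system_near q x e : coordinate_system q x e ->
  \forall y \near q, coordinate_system y x e.
Proof.
move=> [sx se /near_open[G [oG Gq GE]]].
apply: filterS (open_nbhs_nbhs (conj oG Gq)) => y Gy; split=> //.
by apply: filterS (open_nbhs_nbhs (conj oG Gy)) => z /GE.
Qed.

Lemma chart_coordinate_system q : exists x e, coordinate_system q x e /\
  \forall y \near q, dom q y /\ forall i v, dfun (x i) y v = tangent_coord q y v 0 i.
Proof.
have qq := dom_center q.
have H i : exists k, smooth_fun k /\ \forall y \near q, k y = chart q y 0 i.
  have [k sk kE] : exists2 k, smooth_fun k &
      \forall y \near q, k y = chart q y 0 i.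
    by apply: smooth_extend; apply: filterS (dom_near qq) => y; exact: smooth_at_coord.
  by exists k.
have [x Hx] := choice H.
have [chi [K [schi chi1 cK KD chi0]]] := cutoff (dom_near qq).
(* The cutoff makes the chart fields global; duality with the [x i] survives where it is 1. *)
pose e i y := chi y *: chart_field q i y.
suff H2 : \forall y \near q, [/\ dom q y,
      forall i v, dfun (x i) y v = tangent_coord q y v 0 i,
      forall v, v = \sum_i dfun (x i) y v *: e i y &
      forall i j, dfun (x i) y (e j y) = (i == j)%:R].
  exists x, e; split; last by apply: filterS H2 => y [].
  split=> [i|i|]; [by case: (Hx i) | | by apply: filterS H2 => y []].
  apply/vector_fieldP => h sh; apply/smooth_funP => y.
  have [qy|nqy] := pselect (dom q y).
    apply: (@smooth_at_ext _ _ _ _ (fun z => chi z *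
        'd (h \o chart_inv q) (chart q z) (delta_mx 0 i))).
      apply: filterS (dom_near qy) => z qz.
      by rewrite dfunZr dfun_chart_field //; exact: smooth_fun_at.
    apply: smooth_atM; first exact: smooth_fun_at.
    apply/(smooth_at_chart _ qy).
    apply: (@smooth_near_ext _ _ _ _ (fun z => 'd (h \o chart_inv q) z (delta_mx 0 i))).
      by apply: filterS (chart_near qy) => z /chart_invK[/= ->].
    apply: smooth_near_d; apply/(smooth_at_chart _ qy); exact: smooth_fun_at.
  apply: (smooth_at_ext _ (smooth_at_cst y 0)).
  have : \forall z \near y, (~` K) z.
    by apply: open_nbhs_nbhs; split; [exact: closed_openC | move/KD].
  by apply: filterS => z /chi0; rewrite /e => ->; rewrite dfunZr mul0r.
have xE : \forall y \near q, forall i, x i y = chart q y 0 i.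
  by apply: filter_forall => i; case: (Hx i).
have [G [oG Gq GE]] := near_open xE.
have nG : \forall y \near q, G y by apply: open_nbhs_nbhs.
apply: filterS3 nG (dom_near qq) chi1 => y Gy qy chiy.
have dx i v : dfun (x i) y v = tangent_coord q y v 0 i.
  rewrite -(dfun_coord v i qy); apply: dfun_ext (smooth_at_coord i qy) _.
  by apply: filterS (open_nbhs_nbhs (conj oG Gy)) => z /GE ->.
have eE i : e i y = chart_field q i y by rewrite /e chiy scale1r.
split=> // [v|i j].
- rewrite [LHS](tangent_coord_expand v qy).
  by apply: eq_bigr => i _; rewrite dx eE.
- by rewrite dx eE tangent_coord_self // !mxE eqxx.
Qed.

Lemma coordinate_system_exists q : exists x e, coordinate_system q x e.
Proof. by have [x [e [H _]]] := chart_coordinate_system q; exists x, e. Qed.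

End Coordinates.

(** * Pullback connections and metrics *)

Section AlongSmooth.
Context {R : realType} {m n : nat} {M : manifold R m} {N : manifold R n}.
Variable F : M -> N.
Hypothesis sF : smooth_map F.
Implicit Types (p : M) (W : M -> 'rV[R]_n).

Let sA W := smooth_alongP sF W.

Lemma smooth_along_dfun W h : smooth_along F W -> smooth_fun h ->
  smooth_fun (fun x => dfun h (F x) (W x)).
Proof. by move=> /sA sW sh; apply/smooth_funP => p; exact: sW. Qed.

Lemma smooth_alongD W W' : smooth_along F W -> smooth_along F W' ->
  smooth_along F (fun x => W x + W' x).
Proof.
move=> /sA sW /sA sW'; apply/sA => p h sh.
apply: (smooth_at_ext _ (smooth_atD (sW p h sh) (sW' p h sh))).
by apply: nearW => y; rewrite dfunDr.
Qed.

Lemma smooth_alongZ (k : M -> R) W : smooth_fun k -> smooth_along F W ->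
  smooth_along F (fun x => k x *: W x).
Proof.
move=> sk /sA sW; apply/sA => p h sh.
apply: (smooth_at_ext _ (smooth_atM (smooth_fun_at p sk) (sW p h sh))).
by apply: nearW => y; rewrite dfunZr.
Qed.

Lemma smooth_along0 : smooth_along F (fun=> 0).
Proof.
apply/sA => p h sh; apply: (smooth_at_ext _ (smooth_at_cst p 0)).
by apply: nearW => y; rewrite dfun0r.
Qed.

Lemma smooth_alongN W : smooth_along F W -> smooth_along F (fun x => - W x).
Proof.
move=> sW; have := smooth_alongZ (k := fun=> -1) _ sW.
have -> : (fun x => -1 *: W x) = (fun x => - W x).
  by apply/funext => x; rewrite scaleN1r.
by apply; apply/smooth_funP => p; exact: smooth_at_cst.
Qed.

Lemma smooth_along_sum I (r : seq I) (W : I -> M -> 'rV[R]_n) :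
  (forall i, smooth_along F (W i)) ->
  smooth_along F (fun x => \sum_(i <- r) W i x).
Proof.
move=> sW; elim: r => [|i r IH].
  by under eq_fun do rewrite big_nil; exact: smooth_along0.
by under eq_fun do rewrite big_cons; exact: smooth_alongD.
Qed.

Lemma smooth_along_compose E : vector_field E -> smooth_along F (E \o F).
Proof.
move=> /vector_fieldP sE; apply/sA => p h sh.
apply: (@smooth_at_comp _ _ _ _ _ _ sF p (fun y => dfun h y (E y))).
exact/smooth_fun_at/sE.
Qed.

Lemma smooth_along_tmap Y : vector_field Y -> smooth_along F (fun x => tmap F x (Y x)).
Proof.
move=> /vector_fieldP sY; apply/sA => p h sh.
have := smooth_fun_at p (sY _ (smooth_fun_comp sF sh)); apply: smooth_at_ext.
by apply: nearW => y; rewrite (dfun_tmap sF) //; exact: smooth_fun_at.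
Qed.

Lemma along_smooth_at_ext p W W' : (\forall x \near p, W x = W' x) ->
  along_smooth_at F p W -> along_smooth_at F p W'.
Proof.
move=> WW sW h sh; apply: (smooth_at_ext _ (sW h sh)).
by apply: filterS WW => x ->.
Qed.

Variable D : M -> 'rV[R]_m -> (M -> 'rV[R]_n) -> 'rV[R]_n.
Hypothesis cD : connection_along F D.

Lemma connection0 p u : D p u (fun=> 0) = 0.
Proof.
have := connection_additive cD p u smooth_along0 smooth_along0.
under eq_fun do rewrite addr0.
by move=> /(congr1 (fun v => v - D p u (fun=> 0))); rewrite subrr addrK.
Qed.

Lemma connection_sum p u I (r : seq I) (W : I -> M -> 'rV[R]_n) :
  (forall i, smooth_along F (W i)) ->
  D p u (fun x => \sum_(i <- r) W i x) = \sum_(i <- r) D p u (W i).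
Proof.
move=> sW; elim: r => [|i r IH].
  by rewrite big_nil -[RHS](connection0 p u); congr (D p u _); apply/funext => x; rewrite big_nil.
rewrite big_cons -IH -(connection_additive cD p u (sW i) (smooth_along_sum r sW)).
by congr (D p u _); apply/funext => x; rewrite big_cons.
Qed.

Lemma connection0u p W : smooth_along F W -> D p 0 W = 0.
Proof.
move=> sW; have := connection_linear cD p 1 0 0 sW; rewrite !scale1r addr0.
by move=> /(congr1 (fun v => v - D p 0 W)); rewrite subrr addrK.
Qed.

Lemma connectionZu p a u W : smooth_along F W -> D p (a *: u) W = a *: D p u W.
Proof.
move=> sW; have := connection_linear cD p a u 0 sW.
by rewrite !addr0 connection0u // addr0.
Qed.

Lemma connectionDu p u v W : smooth_along F W -> D p (u + v) W = D p u W + D p v W.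
Proof. by move=> sW; have := connection_linear cD p 1 u v sW; rewrite !scale1r. Qed.

Lemma connection_sumu p I (r : seq I) (u : I -> 'rV[R]_m) W : smooth_along F W ->
  D p (\sum_(i <- r) u i) W = \sum_(i <- r) D p (u i) W.
Proof.
move=> sW; elim: r => [|i r IH]; first by rewrite !big_nil connection0u.
by rewrite !big_cons connectionDu // IH.
Qed.

(** Take a cutoff equal to 1 near p and vanishing off the set where W = W'. By the Leibniz rule,
    cutting off a field does not change its derivative at p, and the two fields cut off coincide
    everywhere. *)
Lemma connection_local p u W W' : smooth_along F W -> smooth_along F W' ->
  (\forall x \near p, W x = W' x) -> D p u W = D p u W'.
Proof.
move=> sW sW' WW.
have [chi [K [schi chi1 cK KG chi0]]] := cutoff WW.
have E V : smooth_along F V -> D p u V = D p u (fun x => chi x *: V x).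
  move=> sV; rewrite (connection_leibniz cD) // (dfun_near_cst _ chi1) scale0r add0r.
  by rewrite (nbhs_singleton chi1) scale1r.
rewrite (E W) // (E W') //; congr (D p u _); apply/funext => x.
by have [/KG ->|/chi0 ->] := pselect (K x); rewrite ?scale0r.
Qed.

(** A connection along F is thus determined by its values on coordinate fields composed with F; for
    a pullback connection these are given by [pullback_compose]. *)
Lemma connection_coord p u W x e : coordinate_system (F p) x e ->
  smooth_along F W ->
  D p u W = \sum_i (dfun (fun y => dfun (x i) (F y) (W y)) p u *: e i (F p)
                    + dfun (x i) (F p) (W p) *: D p u (e i \o F)).
Proof.
move=> [sx se cxe] sW.
have sT i : smooth_along F (fun y => dfun (x i) (F y) (W y) *: e i (F y)).
  by apply: smooth_alongZ; [exact: smooth_along_dfun | exact: smooth_along_compose].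
rewrite (@connection_local p u W (fun y => \sum_i dfun (x i) (F y) (W y) *: e i (F y))) //.
- rewrite connection_sum //; apply: eq_bigr => i _.
  by rewrite (connection_leibniz cD) //; [exact: smooth_along_dfun | exact: smooth_along_compose].
- exact: smooth_along_sum.
- by apply: filterS (map_near sF cxe) => y [E _]; exact: E.
Qed.

End AlongSmooth.

(** * Algebra of a Riemannian metric *)

Section Metric.
Context {R : realType} {n : nat} {N : manifold R n}.
Variable g : N -> 'rV[R]_n -> 'rV[R]_n -> R.
Hypothesis mg : riemannian_metric g.
Implicit Types (q : N) (u v w : 'rV[R]_n).

Lemma metricDl q u v w : g q (u + v) w = g q u w + g q v w.
Proof. by have := metric_linear mg q 1 u v w; rewrite scale1r mul1r. Qed.

Lemma metric0l q w : g q 0 w = 0.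
Proof.
have := metricDl q 0 0 w; rewrite addr0.
by move=> /(congr1 (fun z => z - g q 0 w)); rewrite subrr addrK.
Qed.

Lemma metricZl q a u w : g q (a *: u) w = a * g q u w.
Proof. by have := metric_linear mg q a u 0 w; rewrite addr0 metric0l addr0. Qed.

Lemma metricC q u v : g q u v = g q v u.
Proof. exact: (Defs.metric_sym mg). Qed.

Lemma metricDr q u v w : g q w (u + v) = g q w u + g q w v.
Proof. by rewrite !(metricC q w) metricDl. Qed.

Lemma metricZr q a u w : g q w (a *: u) = a * g q w u.
Proof. by rewrite !(metricC q w) metricZl. Qed.

Lemma metric0r q w : g q w 0 = 0.
Proof. by rewrite metricC metric0l. Qed.

Lemma metricNl q u w : g q (- u) w = - g q u w.
Proof. by rewrite -scaleN1r metricZl mulN1r. Qed.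

Lemma metricNr q u w : g q w (- u) = - g q w u.
Proof. by rewrite -scaleN1r metricZr mulN1r. Qed.

Lemma metric_suml q I (r : seq I) (u : I -> 'rV[R]_n) w :
  g q (\sum_(i <- r) u i) w = \sum_(i <- r) g q (u i) w.
Proof.
elim: r => [|i r IH]; first by rewrite !big_nil metric0l.
by rewrite !big_cons metricDl IH.
Qed.

Lemma metric_sumr q I (r : seq I) (u : I -> 'rV[R]_n) w :
  g q w (\sum_(i <- r) u i) = \sum_(i <- r) g q w (u i).
Proof. by rewrite metricC metric_suml; apply: eq_bigr => i _; rewrite metricC. Qed.

Lemma metric_ge0 q u : 0 <= g q u u.
Proof. by have [->|u0] := eqVneq u 0; [rewrite metric0l | rewrite ltW // (metric_pos mg)]. Qed.

Lemma metric_eq0 q u : g q u u = 0 -> u = 0.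
Proof. by have [//|u0] := eqVneq u 0; have := metric_pos mg q u0; move=> /gt_eqF/eqP. Qed.

Lemma metric_inj q u v : (forall w, g q u w = g q v w) -> u = v.
Proof.
move=> H; apply/eqP; rewrite -subr_eq0; apply/eqP/(metric_eq0 (q := q)).
by rewrite metricDl metricNl H subrr.
Qed.

End Metric.

(** * Metric, torsion and complex structure under the pullback connection *)

Section Pullback.
Context {R : realType} {m n : nat} {M : manifold R m} {N : manifold R n}.
Variable F : M -> N.
Hypothesis sF : smooth_map F.
Variable g : N -> 'rV[R]_n -> 'rV[R]_n -> R.
Hypothesis mg : riemannian_metric g.
Variable nabla : N -> 'rV[R]_n -> (N -> 'rV[R]_n) -> 'rV[R]_n.
Hypothesis lc : levi_civita g nabla.
Variable D : M -> 'rV[R]_m -> (M -> 'rV[R]_n) -> 'rV[R]_n.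
Hypothesis pc : pullback_connection F nabla D.
Implicit Types (p : M) (W : M -> 'rV[R]_n).

Let cD := pullback_is_connection pc.
Let sA W := smooth_alongP sF W.

Lemma pullback_coord p u W x e : coordinate_system (F p) x e ->
  smooth_along F W ->
  D p u W = \sum_i (dfun (fun y => dfun (x i) (F y) (W y)) p u *: e i (F p)
              + dfun (x i) (F p) (W p) *: nabla (F p) (tmap F p u) (e i)).
Proof.
move=> cxe sW; rewrite (connection_coord sF cD _ cxe sW).
apply: eq_bigr => i _; rewrite (pullback_compose pc) //.
by case: cxe.
Qed.

Lemma metric_along_expand p W W' x e : coordinate_system (F p) x e ->
  \forall y \near p, \sum_i \sum_j dfun (x i) (F y) (W y) * dfun (x j) (F y) (W' y)
     * g (F y) (e i (F y)) (e j (F y)) = g (F y) (W y) (W' y).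
Proof.
move=> [_ _ cxe]; apply: filterS (map_near sF cxe) => y [E _].
rewrite [in RHS](E (W y)) [X in _ = g _ _ X](E (W' y)) (metric_suml mg).
apply: eq_bigr => i _; rewrite (metric_sumr mg); apply: eq_bigr => j _.
by rewrite (metricZl mg) (metricZr mg) mulrA.
Qed.

Lemma smooth_metric_along W W' : smooth_along F W -> smooth_along F W' ->
  smooth_fun (fun x => g (F x) (W x) (W' x)).
Proof.
move=> sW sW'; apply/smooth_funP => p.
have [x [e cxe]] := coordinate_system_exists (F p).
apply: (smooth_at_ext (metric_along_expand W W' cxe)).
have [sx se _] := cxe.
apply: smooth_at_sum => i _; apply: smooth_at_sum => j _.
apply: smooth_atM; first by apply: smooth_atM; exact/smooth_fun_at/smooth_along_dfun.
apply: (@smooth_at_comp _ _ _ _ _ _ sF p (fun y => g y (e i y) (e j y))).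
exact/smooth_fun_at/metric_smooth.
Qed.

(** Metric compatibility is given for fields on N only. W and W' are expanded in a coordinate frame:
    the frame fields obey the rule on N, and the coefficients the product rule. *)
Lemma pullback_metric p u W W' : smooth_along F W -> smooth_along F W' ->
  dfun (fun x => g (F x) (W x) (W' x)) p u
  = g (F p) (D p u W) (W' p) + g (F p) (W p) (D p u W').
Proof.
move=> sW sW'.
have [x [e cxe]] := coordinate_system_exists (F p).
have [sx se nE] := cxe; have [E _] := nbhs_singleton nE.
have sG i j := metric_smooth mg (se i) (se j).
have sh i : smooth_at p (fun y => dfun (x i) (F y) (W y)).
  exact/smooth_fun_at/smooth_along_dfun.
have sh' i : smooth_at p (fun y => dfun (x i) (F y) (W' y)).
  exact/smooth_fun_at/smooth_along_dfun.
have sGF i j : smooth_at p ((fun y => g y (e i y) (e j y)) \o F).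
  exact/smooth_at_comp/smooth_fun_at.
have sT i j : smooth_at p (fun y => dfun (x i) (F y) (W y) * dfun (x j) (F y) (W' y)
     * g (F y) (e i (F y)) (e j (F y))).
  exact: smooth_atM (smooth_atM (sh i) (sh' j)) (sGF i j).
rewrite (dfun_ext u _ (metric_along_expand W W' cxe)); last first.
  by apply: smooth_at_sum => i _; apply: smooth_at_sum => j _.
rewrite (pullback_coord _ cxe sW) (pullback_coord _ cxe sW').
rewrite [X in g _ _ X + _](E (W' p)) [X in _ + g _ X _](E (W p)).
rewrite !(metric_suml mg) -big_split dfun_sum /=; last first.
  by move=> i _; apply: smooth_at_sum => j _.
apply: eq_bigr => i _; rewrite dfun_sum // !(metric_sumr mg) -big_split.
apply: eq_bigr => j _ /=.
rewrite (dfunM u (smooth_atM (sh i) (sh' j)) (sGF i j)) (dfunM u (sh i) (sh' j)).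
rewrite (dfun_tmap sF u (smooth_fun_at _ (sG i j))) (levi_civita_metric lc) //=.
rewrite !(metricDl mg, metricDr mg, metricZl mg, metricZr mg).
set a := dfun _ p u; set b := dfun _ p u; set c := g _ _ _; set d := g _ _ _; set f := g _ _ _.
move: a b c d f (dfun _ (F p) (W p)) (dfun _ (F p) (W' p)) => a b c d f h k.
by rewrite !mulrDl !mulrDr !mulrA; ring.
Qed.

(** Tested on a coordinate [x k] of N, the second order terms form the torsion identity on M for the
    function [x k \o F], and the remaining Christoffel terms cancel by symmetry. *)
Lemma pullback_torsion (gM : M -> 'rV[R]_m -> 'rV[R]_m -> R) nablaM p X Y :
  levi_civita gM nablaM -> vector_field X -> vector_field Y ->
  D p (X p) (fun y => tmap F y (Y y)) - D p (Y p) (fun y => tmap F y (X y))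
  = tmap F p (nablaM p (X p) Y - nablaM p (Y p) X).
Proof.
move=> lcM sX sY.
have [x [e cxe]] := coordinate_system_exists (F p).
have [sx se nE] := cxe; have [E dE] := nbhs_singleton nE.
have cN := levi_civita_connection lc.
have sXa := smooth_along_tmap sF sX; have sYa := smooth_along_tmap sF sY.
have inj u v : (forall k, dfun (x k) (F p) u = dfun (x k) (F p) v) -> u = v.
  by move=> H; rewrite (E u) (E v); apply: eq_bigr => k _; rewrite H.
apply: inj => k.
have sk := smooth_fun_at (F p) (sx k).
rewrite -(dfun_tmap sF _ sk) (levi_civita_torsion lcM) //; last exact: smooth_fun_comp.
have funE (V : M -> 'rV[R]_m) i : (fun y => dfun (x i) (F y) (tmap F y (V y)))
    = (fun y => dfun (x i \o F) y (V y)).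
  by apply/funext => y; rewrite (dfun_tmap sF) //; exact: smooth_fun_at.
pose G i j := dfun (x k) (F p) (nabla (F p) (e j (F p)) (e i)).
pose c (V : M -> 'rV[R]_m) i := dfun (x i) (F p) (tmap F p (V p)).
(* The derivatives of [x k] along coordinate fields are constant near F p, so torsion-freeness on N
   makes the Christoffel symbols symmetric. *)
have GC i j : G i j = G j i.
  apply/eqP; rewrite -subr_eq0 /G -dfunNr -dfunDr; apply/eqP.
  rewrite (levi_civita_torsion lc) //.
  rewrite (@dfun_near_cst _ _ _ _ _ (k == i)%:R) ?(@dfun_near_cst _ _ _ _ _ (k == j)%:R) ?subrr //.
    by apply: filterS nE => y [_ ->].
  by apply: filterS nE => y [_ ->].
have key (U V : M -> 'rV[R]_m) : vector_field U -> vector_field V ->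
    dfun (x k) (F p) (D p (U p) (fun y => tmap F y (V y)))
    = dfun (fun y => dfun (x k \o F) y (V y)) p (U p)
      + \sum_i \sum_j c V i * c U j * G i j.
  move=> sU sV; rewrite (pullback_coord _ cxe (smooth_along_tmap sF sV)).
  rewrite dfun_sumr.
  under eq_bigr => i _ do rewrite dfunDr !dfunZr dE funE.
  rewrite big_split /=; congr (_ + _).
    exact: sum_delta.
  apply: eq_bigr => i _.
  have -> : nabla (F p) (tmap F p (U p)) (e i)
      = \sum_j c U j *: nabla (F p) (e j (F p)) (e i).
    rewrite [in LHS](E (tmap F p (U p))) (connection_sumu cN); last exact: se.
    by apply: eq_bigr => j _; apply: (connectionZu cN); exact: se.
  rewrite dfun_sumr mulr_sumr; apply: eq_bigr => j _.
  by rewrite dfunZr mulrA.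
rewrite dfunDr dfunNr !key //.
have -> : \sum_i \sum_j c Y i * c X j * G i j = \sum_i \sum_j c X i * c Y j * G i j.
  rewrite exchange_big; apply: eq_bigr => i _; apply: eq_bigr => j _.
  by rewrite GC [c Y j * _]mulrC.
by rewrite opprD addrACA subrr addr0.
Qed.

Variable P : N -> 'End('rV[R]_n).
Hypothesis kP : kahler g nabla P.

Lemma kahler_expand p W x e : coordinate_system (F p) x e ->
  \forall y \near p, \sum_i dfun (x i) (F y) (W y) *: P (F y) (e i (F y))
    = P (F y) (W y).
Proof.
move=> [_ _ cxe]; apply: filterS (map_near sF cxe) => y [E _].
by rewrite [in RHS](E (W y)) linear_sum; apply: eq_bigr => i _; rewrite linearZ.
Qed.

Let smooth_kahler_sum p W x e : coordinate_system (F p) x e -> smooth_along F W ->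
  forall i, smooth_along F (fun y => dfun (x i) (F y) (W y) *: P (F y) (e i (F y))).
Proof.
move=> [sx se cxe] sW i.
apply: (smooth_alongZ sF); first exact: smooth_along_dfun.
exact: (smooth_along_compose sF (E := fun q => P q (e i q)) (kahler_smooth kP (se i))).
Qed.

Lemma smooth_along_kahler W : smooth_along F W ->
  smooth_along F (fun x => P (F x) (W x)).
Proof.
move=> sW; apply/sA => p.
have [x [e cxe]] := coordinate_system_exists (F p).
apply: (along_smooth_at_ext (kahler_expand W cxe)).
have /sA : smooth_along F (fun y => \sum_i dfun (x i) (F y) (W y) *: P (F y) (e i (F y))).
  by apply: (smooth_along_sum sF) => i; exact: smooth_kahler_sum cxe sW i.
exact.
Qed.

Lemma pullback_kahler p u W : smooth_along F W ->
  D p u (fun x => P (F x) (W x)) = P (F p) (D p u W).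
Proof.
move=> sW; have [x [e cxe]] := coordinate_system_exists (F p).
have [sx se _] := cxe; have sS := smooth_kahler_sum cxe sW.
rewrite -(connection_local cD u (smooth_along_sum sF _ sS) (smooth_along_kahler sW)
  (kahler_expand W cxe)).
rewrite (connection_sum sF cD) // (pullback_coord _ cxe sW) linear_sum.
apply: eq_bigr => i _.
rewrite (connection_leibniz cD); last 2 first.
- exact: smooth_along_dfun.
- exact: (smooth_along_compose sF (E := fun q => P q (e i q)) (kahler_smooth kP (se i))).
rewrite linearD !linearZ; congr (_ + _ *: _).
apply: (etrans (pullback_compose pc p u (kahler_smooth kP (se i)))).
exact: (kahler_parallel kP).
Qed.

End Pullback.

(** * Frames and orthogonal projections *)

Section Frames.
Context {R : realType} {n : nat} {N : manifold R n}.
Variable g : N -> 'rV[R]_n -> 'rV[R]_n -> R.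
Hypothesis mg : riemannian_metric g.
Implicit Types (q : N).

Definition independent k (b : 'I_k -> 'rV[R]_n) :=
  forall a : 'I_k -> R, \sum_i a i *: b i = 0 -> forall i, a i = 0.

(** A row v killed by the Gram matrix makes the sum of the v_i b_i orthogonal to itself. *)
Lemma gram_unit q k (b : 'I_k -> 'rV[R]_n) : independent b ->
  (\matrix_(i, j) g q (b i) (b j)) \in unitmx.
Proof.
move=> ib; rewrite -row_free_unit; apply: inj_row_free => v vG.
apply/rowP => i; rewrite mxE; apply: (ib (fun i => v 0 i)).
apply: (metric_eq0 mg (q := q)); rewrite (metric_sumr mg) big1 // => j _.
rewrite (metricZr mg) (metric_suml mg).
have /rowP/(_ j) := vG; rewrite !mxE => vGj.
rewrite (eq_bigr (fun i => v 0 i * (\matrix_(i, j) g q (b i) (b j)) i j)) ?vGj ?mulr0 //.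
by move=> l _; rewrite (metricZl mg) mxE.
Qed.

(** The coefficients are written through the inverse Gram matrix because in this form they visibly
    depend smoothly on the point. *)
Lemma gram_expand q k (b : 'I_k -> 'rV[R]_n) a : independent b ->
  let w := \sum_i a i *: b i in
  w = \sum_i (\sum_j g q w (b j)
        * invmx (\matrix_(i, j) g q (b i) (b j)) j i) *: b i.
Proof.
move=> ib w; set G := \matrix_(i, j) _; have uG := gram_unit q ib.
pose c : 'rV[R]_k := \row_j g q w (b j).
have cE : c = (\row_i a i) *m G.
  apply/rowP => j; rewrite !mxE /w (metric_suml mg); apply: eq_bigr => i _.
  by rewrite (metricZl mg) !mxE.
apply: eq_bigr => i _; congr (_ *: _).
have : (\row_i a i) 0 i = (c *m invmx G) 0 i by rewrite cE mulmxK.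
by rewrite !mxE => ->; apply: eq_bigr => j _; rewrite mxE.
Qed.

Lemma gram_solve q k (b : 'I_k -> 'rV[R]_n) (c : 'I_k -> R) : independent b ->
  exists a, forall j, g q (\sum_i a i *: b i) (b j) = c j.
Proof.
move=> ib; set G := \matrix_(i, j) g q (b i) (b j); have uG := gram_unit q ib.
exists (fun i => ((\row_j c j) *m invmx G) 0 i) => j.
rewrite (metric_suml mg).
have : ((\row_j c j) *m invmx G *m G) 0 j = c j by rewrite mulmxKV // mxE.
move=> <-; rewrite [in RHS]mxE; apply: eq_bigr => i _.
by rewrite (metricZl mg) [X in _ = _ * X]mxE.
Qed.

Lemma vector_fieldP_at (X : N -> 'rV[R]_n) : vector_field X <->
  forall q h, smooth_fun h -> smooth_at q (fun y => dfun h y (X y)).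
Proof.
split=> [/vector_fieldP sX q h sh|sX]; first exact/smooth_fun_at/sX.
by apply/vector_fieldP => h sh; apply/smooth_funP => q; exact: sX.
Qed.

(** Serves for [proj] and [adjoint], which are specified by inner products alone: the inverse Gram
    matrix of a smooth frame turns these into smooth coefficients. *)
Lemma frame_smooth q k (b : 'I_k -> N -> 'rV[R]_n) (X : N -> 'rV[R]_n) :
  (forall i, vector_field (b i)) ->
  (\forall y \near q, independent (b ^~ y) /\
     exists a, X y = \sum_i a i *: b i y) ->
  (forall j, smooth_at q (fun y => g y (X y) (b j y))) ->
  forall h, smooth_fun h -> smooth_at q (fun y => dfun h y (X y)).
Proof.
move=> sb Xb sX h sh.
apply: (@smooth_at_ext _ _ _ _ (fun y => \sum_i (\sum_j g y (X y) (b j y)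
   * invmx (\matrix_(i, j) g y (b i y) (b j y)) j i) * dfun h y (b i y))).
  apply: filterS Xb => y [ib [a Xa]].
  rewrite [in RHS]Xa (gram_expand y a ib) -Xa dfun_sumr.
  by apply: eq_bigr => i _; rewrite dfunZr.
have [ib _] := nbhs_singleton Xb.
apply: smooth_at_sum => i _; apply: smooth_atM; last first.
  by have /vector_fieldP_at := sb i; apply.
apply: smooth_at_sum => j _; apply: smooth_atM => //.
apply: smooth_at_invmx; last exact: gram_unit.
move=> i' j'; apply: (smooth_at_ext (h := fun y => g y (b i' y) (b j' y))).
  by apply: nearW => y; rewrite mxE.
exact/smooth_fun_at/metric_smooth.
Qed.

Lemma vector_extend q w : exists2 E : N -> 'rV[R]_n, vector_field E & E q = w.
Proof.
have [x [e [sx se nE]]] := coordinate_system_exists q.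
have [E _] := nbhs_singleton nE.
exists (fun y => \sum_i dfun (x i) q w *: e i y); last by rewrite -E.
apply: (smooth_along_sum (smooth_map_id N)) => i.
apply: (smooth_alongZ (smooth_map_id N)); last exact: se.
by apply/smooth_funP => p; exact: smooth_at_cst.
Qed.

Lemma coordinate_independent q x e : coordinate_system q x e ->
  \forall y \near q, independent (e ^~ y).
Proof.
move=> [_ _ nE]; apply: filterS nE => y [_ E] a a0 i.
have := congr1 (dfun (x i) y) a0; rewrite dfun0r dfun_sumr (bigD1 i) //= dfunZr E eqxx mulr1.
rewrite big1 ?addr0 // => j ji.
by rewrite dfunZr E eq_sym (negPf ji) mulr0.
Qed.

Lemma basis_independent (U : {vspace 'rV[R]_n}) k (b : 'I_k -> 'rV[R]_n) :
  basis_of U [tuple b i | i < k] -> independent b.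
Proof.
move=> /basis_free/freeP H a a0 i; apply: H; rewrite -[RHS]a0.
by apply: eq_bigr => j _; rewrite -tnth_nth tnth_mktuple.
Qed.

Lemma basis_expand (U : {vspace 'rV[R]_n}) k (b : 'I_k -> 'rV[R]_n) v :
  basis_of U [tuple b i | i < k] -> v \in U -> exists a, v = \sum_i a i *: b i.
Proof.
move=> bU vU; exists (fun i => coord [tuple b i | i < k] i v).
rewrite [LHS](coord_basis bU vU); apply: eq_bigr => j _.
by rewrite -tnth_nth tnth_mktuple.
Qed.

Lemma basis_in (U : {vspace 'rV[R]_n}) k (b : 'I_k -> 'rV[R]_n) i :
  basis_of U [tuple b i | i < k] -> b i \in U.
Proof.
move=> bU; apply: (basis_mem bU); apply/tnthP; exists i.
by rewrite tnth_mktuple.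
Qed.

Lemma vspace_basis (U : {vspace 'rV[R]_n}) :
  exists k (b : 'I_k -> 'rV[R]_n), basis_of U [tuple b i | i < k].
Proof.
exists (\dim U), (tnth (vbasis U)).
have -> : [tuple tnth (vbasis U) i | i < \dim U] = vbasis U.
  by apply/eq_from_tnth => i; rewrite tnth_mktuple.
exact: vbasisP.
Qed.

(** Specified by its inner products and not through a basis, so that existence can use any basis of
    U and smoothness any local frame. *)
Definition proj (U : {vspace 'rV[R]_n}) q w : 'rV[R]_n :=
  get [set t | t \in U /\ forall u, u \in U -> g q t u = g q w u].

Lemma projP U q w :
  proj U q w \in U /\ forall u, u \in U -> g q (proj U q w) u = g q w u.
Proof.
have [k [b bU]] := vspace_basis U.
have [a Ha] := gram_solve q (fun j => g q w (b j)) (basis_independent bU).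
apply: (@getPex _ [set t | t \in U /\ forall u, u \in U -> g q t u = g q w u]).
exists (\sum_i a i *: b i); split.
  by apply: memv_suml => i _; apply: memvZ; exact: basis_in bU.
move=> u /(basis_expand bU)[c ->]; rewrite !(metric_sumr mg).
by apply: eq_bigr => j _; rewrite !(metricZr mg) Ha.
Qed.

Lemma proj_unique (U : {vspace 'rV[R]_n}) q w t : t \in U ->
  (forall u, u \in U -> g q t u = g q w u) -> proj U q w = t.
Proof.
move=> tU H; have [pU Hp] := projP U q w.
apply/eqP; rewrite -subr_eq0; apply/eqP/(metric_eq0 mg (q := q)).
have dU : proj U q w - t \in U by rewrite rpredB.
by rewrite (metricDl mg) (metricNl mg) H // Hp // subrr.
Qed.

Lemma proj_orth (U : {vspace 'rV[R]_n}) q w u : u \in U -> g q (w - proj U q w) u = 0.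
Proof.
move=> uU; have [_ H] := projP U q w.
by rewrite (metricDl mg) (metricNl mg) H // subrr.
Qed.

Lemma proj_smooth (D : N -> {vspace 'rV[R]_n}) W : tangent_distribution D ->
  vector_field W -> vector_field (fun q => proj (D q) q (W q)).
Proof.
move=> tD sW; apply/vector_fieldP_at => q.
have [k [b [sb nb]]] := tD q.
apply: (@frame_smooth q k b) => [//||j].
  apply: filterS nb => y bD; split; first exact: basis_independent bD.
  by apply: basis_expand bD _; have [] := projP (D y) y (W y).
apply: (@smooth_at_ext _ _ _ _ (fun y => g y (W y) (b j y))).
  by apply: filterS nb => y bD; have [_ ->] := projP (D y) y (W y); rewrite ?(basis_in _ bD).
by apply: smooth_fun_at; apply: (metric_smooth mg); [exact: sW | exact: sb].
Qed.

Lemma tangent_extend (D : N -> {vspace 'rV[R]_n}) q w : tangent_distribution D ->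
  w \in D q -> exists E, [/\ vector_field E, E q = w & forall y, E y \in D y].
Proof.
move=> tD wD; have [E sE Eq] := vector_extend q w.
exists (fun y => proj (D y) y (E y)); split.
- exact: proj_smooth.
- by rewrite Eq; exact: proj_unique.
- by move=> y; have [] := projP (D y) y (E y).
Qed.

Lemma normal_extend (D : N -> {vspace 'rV[R]_n}) q w : tangent_distribution D ->
  orth (g q) [set` D q] w ->
  exists2 E, section (fun y => orth (g y) [set` D y]) E & E q = w.
Proof.
move=> tD wD; have [E sE Eq] := vector_extend q w.
exists (fun y => E y - proj (D y) y (E y)).
  split; last by move=> y u /= uD; exact: proj_orth.
  apply: (smooth_alongD (smooth_map_id N)); first exact: sE.
  by apply: (smooth_alongN (smooth_map_id N)); exact: proj_smooth.
rewrite Eq (@proj_unique (D q) q w 0) ?subr0 ?mem0v // => u uD.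
by rewrite (metric0l mg) wD.
Qed.

End Frames.

(** * The adjoint of the differential of a Riemannian map *)

Section RiemannianMap.
Context {R : realType} {m n : nat} {M : manifold R m} {N : manifold R n}.
Variables (gM : M -> 'rV[R]_m -> 'rV[R]_m -> R) (gN : N -> 'rV[R]_n -> 'rV[R]_n -> R).
Variable F : M -> N.
Hypotheses (mM : riemannian_metric gM) (mN : riemannian_metric gN).
Hypothesis sF : smooth_map F.
Implicit Types (p : M).

(* The adjoint of F_*, which for a Riemannian map is the horizontal lift on the
   range of F_*; unlike the latter it is defined on all of T_(F p) N. *)
Definition adjoint p w : 'rV[R]_m :=
  get [set u | forall v, gM p u v = gN (F p) w (tmap F p v)].

Lemma adjointP p w v : gM p (adjoint p w) v = gN (F p) w (tmap F p v).
Proof.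
have [x [e cxe]] := coordinate_system_exists p.
have ie := nbhs_singleton (coordinate_independent cxe).
have [_ _ /nbhs_singleton[E _]] := cxe.
have [a Ha] := gram_solve mM p (fun j => gN (F p) w (tmap F p (e j p))) ie.
suff : forall v, gM p (adjoint p w) v = gN (F p) w (tmap F p v) by [].
apply: (@getPex _ [set u | forall v, gM p u v = gN (F p) w (tmap F p v)]).
exists (\sum_i a i *: e i p) => u; rewrite (E u) linear_sum !(metric_sumr mM) !(metric_sumr mN).
by apply: eq_bigr => j _; rewrite linearZ (metricZr mM) (metricZr mN) Ha.
Qed.

Lemma adjoint_smooth W : smooth_along F W -> vector_field (fun p => adjoint p (W p)).
Proof.
move=> sW; apply/vector_fieldP_at => p.
have [x [e cxe]] := coordinate_system_exists p; have [sx se nE] := cxe.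
apply: (frame_smooth mM se).
  apply: filterS2 (coordinate_independent cxe) nE => y ie [E _]; split => //.
  by exists (fun i => dfun (x i) y (adjoint y (W y))).
move=> j; apply: (@smooth_at_ext _ _ _ _ (fun y => gN (F y) (W y) (tmap F y (e j y)))).
  by apply: nearW => y; rewrite adjointP.
by apply/smooth_fun_at/(smooth_metric_along sF mN) => //; exact: smooth_along_tmap.
Qed.

Lemma adjoint_kerF_perp p w : kerF_perp gM F p (adjoint p w).
Proof. by move=> u; rewrite /kerF /= memv_ker => /eqP u0; rewrite adjointP u0 (metric0r mN). Qed.

Lemma adjoint_section W : smooth_along F W ->
  section (kerF_perp gM F) (fun p => adjoint p (W p)).
Proof. by move=> sW; split; [exact: adjoint_smooth | move=> p; exact: adjoint_kerF_perp]. Qed.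

Hypothesis rF : riemannian_map gM gN F.

(** Let T be [tmap F p] and A its adjoint, whose values are horizontal. Isometry gives g(T A w, T A
    w') = g(A w, A w') = g(w, T A w'). So for z = A T u - u the vector T z is orthogonal to the
    image of T A; hence A T z = 0 and g(T z, T z) = g(A T z, z) = 0. *)
Lemma tmap_adjoint p u : tmap F p (adjoint p (tmap F p u)) = tmap F p u.
Proof.
have [_ _ iso] := rF.
(* The isometry hypothesis speaks of sections, so both vectors are first extended to fields. *)
have isow w w' : gN (F p) (tmap F p (adjoint p w)) (tmap F p (adjoint p w'))
    = gM p (adjoint p w) (adjoint p w').
  have [E sE <-] := vector_extend (F p) w; have [E' sE' <-] := vector_extend (F p) w'.
  exact: (iso _ _ (adjoint_section (smooth_along_compose sF sE))
    (adjoint_section (smooth_along_compose sF sE'))).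
pose z := adjoint p (tmap F p u) - u.
suff : tmap F p z = 0 by rewrite linearB => /eqP; rewrite subr_eq0 => /eqP.
have H w' : gN (F p) (tmap F p z) (tmap F p (adjoint p w')) = 0.
  rewrite linearB (metricDl mN) (metricNl mN) isow adjointP.
  by rewrite -(adjointP p (tmap F p u)) adjointP subrr.
have a0 : adjoint p (tmap F p z) = 0 by apply: (metric_eq0 mM (q := p)); rewrite adjointP H.
by apply: (metric_eq0 mN (q := F p)); rewrite -adjointP a0 (metric0l mM).
Qed.

Lemma tmap_adjoint_range p w : ranF F p w -> tmap F p (adjoint p w) = w.
Proof. by move=> /= /memv_imgP[u _ ->]; exact: tmap_adjoint. Qed.

Lemma adjoint_tmap p u : kerF_perp gM F p u -> adjoint p (tmap F p u) = u.
Proof.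
move=> hu; apply/eqP; rewrite -subr_eq0; apply/eqP/(metric_eq0 mM (q := p)).
have zk : kerF F p (adjoint p (tmap F p u) - u).
  by rewrite /kerF /= memv_ker linearB /= tmap_adjoint subrr.
by rewrite (metricDl mM) (metricNl mM) (adjoint_kerF_perp _ zk) (hu _ zk) subrr.
Qed.

Lemma metric_tmap p u v : kerF_perp gM F p u ->
  gN (F p) (tmap F p u) (tmap F p v) = gM p u v.
Proof. by move=> hu; rewrite -adjointP adjoint_tmap. Qed.

End RiemannianMap.

(** * Picard's theorem *)

Section ODE.
Context {R : realType}.
Local Notation mu := (@lebesgue_measure R).

Lemma antiderivative (h : R -> R) : continuous h -> exists H : R -> R,
  H 0 = 0 /\ forall t : R, `|t| < 2 -> is_derive t 1 H (h t).
Proof.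
(* Integrating from -2 keeps the times in [-1, 1], where the equation will be solved, away from the
   end points. *)
move=> ch; pose H x := (\int[mu]_(t in [set` `[-2, x]]) (h t))%R.
have H2 (x : R) : -2 < x -> x < 2 -> is_derive x 1 H (h x).
  move=> x1 x2.
  have ih : mu.-integrable `[-2, 2] (EFin \o h).
    apply: continuous_compact_integrable; first exact: segment_compact.
    exact: continuous_subspaceT.
  have [dH dE] := continuous_FTC1_closed x2 ih x1 (ch x).
  exact: DeriveDef dH (etrans (esym (derive1E H x)) dE).
exists (fun x => H x - H 0); split; first by rewrite subrr.
move=> t; rewrite ltr_norml => /andP[t1 t2].
have := is_deriveB (H2 t t1 t2) (is_derive_cst (H 0) t 1).
by rewrite subr0.
Qed.

(** The mean value theorem on either side of 0. Differentiability is asked only inside the interval,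
    because the Picard iterates are frozen outside it. *)
Lemma derive_bound (f df : R -> R) (e K t : R) :
  (forall s, `|s| <= e -> {for s, continuous f}) ->
  (forall s : R, `|s| < e -> is_derive s 1 f (df s)) ->
  (forall s, `|s| < e -> `|df s| <= K) -> `|t| <= e ->
  `|f t - f 0| <= K * `|t|.
Proof.
move=> cf ddf dfK te.
have [t0|t0|->] := ltgtP t 0; last by rewrite subrr !normr0 mulr0.
- have te' : - t <= e by move: te; rewrite ltr0_norm.
  have [c] : exists2 c, c \in `]t, 0[%R & f 0 - f t = df c * (0 - t).
    apply: MVT => // [s|].
      rewrite in_itv /= => /andP[ts s0]; apply: ddf; rewrite ltr0_norm //.
      by apply: lt_le_trans te'; rewrite ltrN2.
    apply: continuous_in_subspaceT => s; rewrite inE /= in_itv /= => /andP[ts s0].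
    by apply: cf; rewrite ler0_norm //; apply: le_trans te'; rewrite lerN2.
  rewrite in_itv /= => /andP[tc c0] E.
  rewrite distrC E normrM sub0r normrN ler_wpM2r //; apply: dfK.
  by rewrite ltr0_norm //; apply: lt_le_trans te'; rewrite ltrN2.
- have te' : t <= e by move: te; rewrite gtr0_norm.
  have [c] : exists2 c, c \in `]0, t[%R & f t - f 0 = df c * (t - 0).
    apply: MVT => // [s|].
      rewrite in_itv /= => /andP[s0 ts]; apply: ddf; rewrite gtr0_norm //.
      exact: lt_le_trans te'.
    apply: continuous_in_subspaceT => s; rewrite inE /= in_itv /= => /andP[s0 ts].
    by apply: cf; rewrite ger0_norm //; apply: le_trans te'.
  rewrite in_itv /= => /andP[c0 tc] E.
  rewrite E normrM subr0 ler_wpM2r //; apply: dfK.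
  by rewrite gtr0_norm //; exact: lt_le_trans te'.
Qed.

(** Used on time, to extend iterates from [-e, e] to R, and on each coordinate of the state, to make
    a locally Lipschitz field globally Lipschitz. *)
Definition clamp (a b x : R) : R := Num.max a (Num.min b x).

Lemma clamp_in a b x : a <= b -> a <= clamp a b x <= b.
Proof. by move=> ab; rewrite /clamp le_max lexx /= ge_max ab ge_min lexx. Qed.

Lemma clamp_id a b x : a <= x <= b -> clamp a b x = x.
Proof. by move=> /andP[ax xb]; rewrite /clamp (min_idPr xb) (max_idPr ax). Qed.

Lemma clamp_lip a b x y : `|clamp a b x - clamp a b y| <= `|x - y|.
Proof.
wlog xy : x y / x <= y.
  move=> H; have [xy|/ltW yx] := leP x y; first exact: H.
  by rewrite distrC [leRHS]distrC; exact: H.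
have cxy : clamp a b x <= clamp a b y.
  rewrite /clamp ge_max le_max lexx /=.
  by rewrite le_max; apply/orP; right; rewrite le_min !ge_min lexx xy orbT.
rewrite ler0_norm ?subr_le0 // ler0_norm ?subr_le0 // !opprB /clamp.
by rewrite /Num.max /Num.min; repeat case: ifPn; rewrite -?leNgt; lra.
Qed.

Lemma clamp_continuous a b : continuous (clamp a b).
Proof.
move=> x; apply/cvgrPdist_lt => e e0; near=> y.
apply: le_lt_trans (clamp_lip _ _ _ _) _.
by near: y; apply: cvgr_dist_lt => //; exact: cvg_id.
Unshelve. all: by end_near. Qed.

Lemma norm_rV_le d (x : 'rV[R]_d) e : 0 <= e ->
  (`|x| <= e <-> forall i, `|x 0 i| <= e).
Proof.
have -> : `|x| = \big[Num.max/0]_ij `|x ij.1 ij.2| by exact: mx_normrE.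
move=> e0; split.
  by move=> /bigmax_leP[_ H] i; exact: (H (0, i)).
by move=> H; apply/bigmax_leP; split=> // -[k i] _; rewrite (ord1 k).
Qed.

Lemma coord_norm d (x : 'rV[R]_d) i : `|x 0 i| <= `|x|.
Proof. exact: (norm_rV_le x (normr_ge0 x)).1. Qed.

Lemma pow2_large (c e : R) : 0 < e -> exists k : nat, c / 2 ^+ k < e.
Proof.
move=> e0; have H : 0 <= `|c| / e by rewrite divr_ge0 // ltW.
exists (Num.bound (`|c| / e)); have := archi_boundP H; set k := Num.bound _ => Hk.
have k0 : 0 < 2 ^+ k :> R by rewrite exprn_gt0.
rewrite ltr_pdivrMr //; apply: le_lt_trans (ler_norm c) _.
rewrite mulrC -ltr_pdivrMr //; apply: lt_trans Hk _.
by rewrite -natrX ltr_nat ltn_expl.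
Qed.

(** The radius 2 c / 2^k is the tail of the geometric series from k on, which makes the intervals of
    this radius around [u k] nested; the limit is the supremum of their left ends. *)
Lemma nested_limit (u : nat -> R) c :
  (forall k, `|u k.+1 - u k| <= c / 2 ^+ k) ->
  exists l, forall k, `|l - u k| <= 2 * c / 2 ^+ k.
Proof.
move=> H; pose a k := u k - 2 * c / 2 ^+ k; pose b k := u k + 2 * c / 2 ^+ k.
have c0 : 0 <= c by have := le_trans (normr_ge0 _) (H 0%N); rewrite expr0 divr1.
have half k : c / 2 ^+ k.+1 = c / 2 ^+ k / 2 by rewrite exprSr invfM mulrA.
have aS k : a k <= a k.+1.
  have := H k; rewrite ler_norml /a -!mulrA half => /andP[+ _]; lra.
have bS k : b k.+1 <= b k.
  have := H k; rewrite ler_norml /b -!mulrA half => /andP[_ +]; lra.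
have ab k : a k <= b k.
  have : 0 <= c / 2 ^+ k by rewrite divr_ge0 // exprn_ge0.
  rewrite /a /b -!mulrA; lra.
have am i j : (i <= j)%N -> a i <= a j.
  by elim: j => [|j IH]; [rewrite leqn0 => /eqP->|rewrite leq_eqVlt => /predU1P[->//|/IH/le_trans->]].
have bm i j : (i <= j)%N -> b j <= b i.
  by elim: j => [|j IH]; [rewrite leqn0 => /eqP->|rewrite leq_eqVlt => /predU1P[->//|/IH/(le_trans (bS j))]].
have abij i j : a i <= b j.
  apply: le_trans (am i (maxn i j) (leq_maxl _ _)) _.
  exact: le_trans (ab _) (bm j (maxn i j) (leq_maxr _ _)).
pose S := [set a k | k in [set: nat]].
have S0 : S !=set0 by exists (a 0%N), 0%N.
exists (sup S) => k.
have h1 : a k <= sup S.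
  by apply: ub_le_sup; [exists (b 0%N) => _ [j _ <-] | exists k].
have h2 : sup S <= b k by apply: ge_sup => // _ [j _ <-].
by move: h1 h2; rewrite /a /b ler_norml -!mulrA; lra.
Qed.

Lemma nested_limit_rV d (u : nat -> 'rV[R]_d) c :
  (forall k, `|u k.+1 - u k| <= c / 2 ^+ k) ->
  exists l, forall k, `|l - u k| <= 2 * c / 2 ^+ k.
Proof.
move=> H.
have c0 : 0 <= c by have := le_trans (normr_ge0 _) (H 0%N); rewrite expr0 divr1.
have /choice[l Hl] : forall i, exists l, forall k, `|l - u k 0 i| <= 2 * c / 2 ^+ k.
  move=> i; apply: nested_limit => k; apply: le_trans (H k).
  by have := coord_norm (u k.+1 - u k) i; rewrite !mxE.
exists (\row_i l i) => k; apply/norm_rV_le; last by move=> i; rewrite !mxE.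
by rewrite divr_ge0 ?mulr_ge0 // exprn_ge0.
Qed.

Lemma continuous_rV (d : nat) (T : topologicalType) (z : T -> 'rV[R]_d) :
  (forall i, continuous (fun t => z t 0 i)) -> continuous z.
Proof.
move=> cz t; apply/cvgrPdist_le => e e0.
have H i : \forall s \near t, `|z t 0 i - z s 0 i| <= e.
  by have /cvgrPdist_le/(_ e e0) := cz i t.
have : \forall s \near t, forall i, `|z t 0 i - z s 0 i| <= e by apply: filter_forall.
by apply: filterS => s Hs; apply/norm_rV_le; [exact: ltW | move=> i; rewrite !mxE].
Qed.

Lemma lipschitz_continuous (V W : normedModType R) (f : V -> W) (L : R) : 0 < L ->
  (forall x y, `|f x - f y| <= L * `|x - y|) -> continuous f.
Proof.
move=> L0 fL x; apply/cvgrPdist_lt => r r0; apply/nbhs_ballP.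
exists (r / L) => [|y]; first exact: divr_gt0.
rewrite -ball_normE /= => xy.
by apply: le_lt_trans (fL _ _) _; rewrite mulrC -ltr_pdivlMr.
Qed.

Lemma near_norm2 (V : normedModType R) (x : V) (P Q : V -> Prop) :
  (\forall y \near x, P y) -> (\forall y \near x, Q y) ->
  exists2 r : R, 0 < r & forall y, `|x - y| < r -> P y /\ Q y.
Proof.
move=> nP nQ; have : nbhs x (fun y => P y /\ Q y) by exact: filterI.
move=> /nbhs_ballP[r /= r0].
by rewrite -ball_normE /= => Hr; exists r.
Qed.

Section Picard.
Variables (d : nat) (G : 'rV[R]_d -> 'rV[R]_d) (L e : R) (z0 : 'rV[R]_d).
Hypotheses (L0 : 0 < L) (GL : forall x y, `|G x - G y| <= L * `|x - y|).
Hypotheses (e0 : 0 < e) (e1 : e <= 1) (eL : L * e <= 1 / 2).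

Let cl := clamp (- e) e.

Let oppe_le : - e <= e. Proof. by rewrite ge0_cp // ltW. Qed.

Let cl_le t : `|cl t| <= e.
Proof. by rewrite ler_norml clamp_in. Qed.

Let cl_id t : `|t| <= e -> cl t = t.
Proof. by rewrite ler_norml => /clamp_id. Qed.

Let cG : continuous G.
Proof. exact: lipschitz_continuous L0 GL. Qed.

(* The iterates are made constant outside [-e, e], so that they are continuous
   on R. *)
Let picard_step (z w : R -> 'rV[R]_d) :=
  [/\ continuous w, w 0 = z0, forall t, w t = w (cl t) &
    forall (t : R) i, `|t| < e -> is_derive t 1 (fun s => w s 0 i) (G (z t) 0 i)].

Let picard_step_exists z : continuous z -> exists w, picard_step z w.
Proof.
move=> cz.
have /choice[H HP] : forall i, exists H : R -> R,
    H 0 = 0 /\ forall t : R, `|t| < 2 -> is_derive t 1 H (G (z t) 0 i).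
  move=> i; apply: antiderivative => t.
  apply: (@continuous_comp _ _ _ (G \o z) (fun v : 'rV[R]_d => v 0 i)).
    by apply: continuous_comp; [exact: cz | exact: cG].
  exact: coord_continuous.
have e2 : e < 2 by apply: le_lt_trans e1 _; rewrite ltr1n.
have HcE t i : `|t| <= e -> H i (cl t) = H i t by move=> te; rewrite cl_id.
exists (fun t => z0 + \row_i H i (cl t)); split.
- apply: continuous_rV => i t.
  have -> : (fun t => (z0 + \row_i H i (cl t)) 0 i) = (fun t => z0 0 i + (H i \o cl) t).
    by apply/funext => s; rewrite !mxE.
  apply: continuousD; first exact: cst_continuous.
  apply: continuous_comp; first exact: clamp_continuous.
  apply: differentiable_continuous; apply/derivable1_diffP.
  by have [_ /(_ (cl t) (le_lt_trans (cl_le t) e2))[]] := HP i.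
- apply/rowP => i; rewrite !mxE cl_id ?normr0 ?ltW //.
  by have [-> _] := HP i; rewrite addr0.
- by move=> t; rewrite (cl_id (cl_le t)).
- move=> t i te.
  have [_ /(_ t (lt_trans te e2)) dH] := HP i.
  have := is_deriveD (is_derive_cst (z0 0 i) t 1) dH; rewrite add0r.
  apply: near_eq_is_derive; near=> s; rewrite !mxE cl_id //.
  apply/ltW; near: s; apply: (cvgr_lt `|t|) => //.
  exact: norm_continuous.
Unshelve. all: by end_near. Qed.

(** The factor 1/2 is the bound on L e: the derivatives differ by at most L c, over a time at most
    e. *)
Let picard_contract z z' w w' c : 0 <= c -> picard_step z w -> picard_step z' w' ->
  (forall t, `|z t - z' t| <= c) -> forall t, `|w t - w' t| <= c / 2.
Proof.
move=> c0 [cw w0 wc dw] [cw' w0' wc' dw'] zz t.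
rewrite wc wc'; apply/norm_rV_le => [|i]; first by rewrite divr_ge0.
pose f s := w s 0 i - w' s 0 i.
have f0 : f 0 = 0 by rewrite /f w0 w0' subrr.
have cwi (v : R -> 'rV[R]_d) : continuous v -> continuous (fun s => v s 0 i).
  move=> cv s; apply: (@continuous_comp _ _ _ v (fun x : 'rV[R]_d => x 0 i)).
    exact: cv.
  exact: coord_continuous.
have := @derive_bound f (fun s => G (z s) 0 i - G (z' s) 0 i) e (L * c) (cl t).
rewrite f0 subr0 !mxE => H; apply: le_trans (H _ _ _ (cl_le t)) _.
- by move=> s _; apply: continuousB; [exact: cwi | exact: cwi].
- by move=> s se; apply: is_deriveB; [exact: dw | exact: dw'].
- move=> s se; have := coord_norm (G (z s) - G (z' s)) i; rewrite !mxE.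
  move=> /le_trans; apply; apply: le_trans (GL _ _) _.
  by rewrite ler_wpM2l // ltW.
- have : L * c * `|cl t| <= L * c * e by rewrite ler_wpM2l ?mulr_ge0 // ltW.
  move=> /le_trans; apply; rewrite mulrAC mulrC.
  by apply: ler_wpM2l => //; rewrite -[2^-1]mul1r.
Qed.

(** No limit is exchanged with a derivative: the uniform limit z of the iterates is continuous, its
    own Picard step w is again close to the iterates, so w = z, and w has the required derivative by
    construction. *)
Lemma picard : exists z : R -> 'rV[R]_d, [/\ continuous z, z 0 = z0 &
  forall (t : R) i, `|t| < e -> is_derive t 1 (fun s => z s 0 i) (G (z t) 0 i)].
Proof.
(* The iteration needs a total map; its value on discontinuous functions is arbitrary. *)
have /choice[Phi HPhi] : forall z, exists w, continuous z -> picard_step z w.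
  move=> z; have [cz|ncz] := pselect (continuous z).
    by have [w Hw] := picard_step_exists cz; exists w.
  by exists z.
pose u k := iter k Phi (fun=> z0).
have cu k : continuous (u k).
  by elim: k => [|k IH] /=; [move=> x; exact: cst_continuous | have [] := HPhi _ IH].
have pu k : picard_step (u k) (u k.+1) by exact/HPhi/cu.
pose c := `|G z0|.
have bu k t : `|u k.+1 t - u k t| <= c / 2 ^+ k.
  elim: k t => [|k IH] t; last first.
    rewrite exprSr invfM mulrA; apply: picard_contract (pu _) (pu _) IH t.
    by rewrite divr_ge0 ?exprn_ge0 ?normr_ge0.
  have [cw w0 wc dw] := pu 0%N; rewrite expr0 divr1 wc.
  apply/norm_rV_le => [|i]; first exact: normr_ge0.
  have := @derive_bound (fun s => u 1%N s 0 i) (fun=> G z0 0 i) e c (cl t).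
  rewrite w0 !mxE => H; apply: le_trans (H _ _ _ (cl_le t)) _.
  - move=> s _; apply: (@continuous_comp _ _ _ (u 1%N) (fun x : 'rV[R]_d => x 0 i)).
      exact: cw.
    exact: coord_continuous.
  - by move=> s _; exact: coord_norm.
  - by apply: ler_piMr; [exact: normr_ge0 | exact: le_trans (cl_le t) e1].
have /choice[z Hz] : forall t, exists l, forall k, `|l - u k t| <= 2 * c / 2 ^+ k.
  by move=> t; apply: nested_limit_rV => k; exact: bu.
have c0 : 0 <= c by exact: normr_ge0.
have cz : continuous z.
  move=> t; apply/cvgrPdist_lt => r r0.
  have [k Hk] := pow2_large (2 * c) (divr_gt0 r0 (ltr0Sn R 3)).
  have /cvgrPdist_lt/(_ (r / 4) (divr_gt0 r0 (ltr0Sn R 3))) := cu k t.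
  apply: filterS => s Hs.
  have -> : z t - z s = (z t - u k t) + (u k t - u k s) - (z s - u k s).
    by rewrite opprB !subrKA.
  have h1 := le_lt_trans (Hz t k) Hk; have h2 := le_lt_trans (Hz s k) Hk.
  have h3 := ler_normB (z t - u k t + (u k t - u k s)) (z s - u k s).
  have h4 := ler_normD (z t - u k t) (u k t - u k s).
  by move: (`|_|) (`|_|) (`|_|) (`|_|) (`|_|) h1 h2 h3 h4 Hs => *; lra.
have [w Hw] := picard_step_exists cz.
have E t : w t = z t.
  apply/eqP; rewrite -subr_eq0 -normr_le0 leNgt; apply/negP => wz.
  (* Both w and z lie within c / 2^k of [u k.+1] at t, hence within half of their supposed distance
     from each other. *)
  have [k Hk] := pow2_large (2 * c) (divr_gt0 wz (ltr0Sn R 1)).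
  have ck : 0 <= 2 * c / 2 ^+ k by rewrite divr_ge0 ?mulr_ge0 // exprn_ge0.
  have h1 := picard_contract ck Hw (pu k) (fun s => Hz s k) t.
  have h2 := Hz t k.+1.
  have h3 := ler_normB (w t - u k.+1 t) (z t - u k.+1 t).
  move: h3 h2; rewrite opprB addrA subrK exprSr invfM mulrA => h3 h2.
  by move: h1 h2 h3 Hk wz; move: (`|w t - z t|) (2 * c / _) (`|_|) (`|_|) => *; lra.
have Ez : w = z by apply/funext.
by exists z; move: Hw; rewrite Ez => -[cw w0 wc dw]; split.
Qed.

End Picard.

Lemma smooth_near_lipschitz d (G : 'rV[R]_d -> 'rV[R]_d) z0 : smooth_near z0 G ->
  exists r L, [/\ 0 < r, 0 < L & forall x y, `|x - z0| <= r -> `|y - z0| <= r ->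
    `|G x - G y| <= L * `|x - y|].
Proof.
move=> sG.
have cpart i j : {for z0, continuous (fun x => 'd G x (delta_mx 0 j) 0 i : R)}.
  have /smooth_near_coord/(_ i) := smooth_near_d (delta_mx 0 j) sG.
  exact: smooth_near_continuous.
(* Bounds all first partial derivatives near z0: each is at most K - 1 in absolute value at z0, and
   by continuity moves by at most 1. *)
pose K := 1 + \sum_i \sum_j `|'d G z0 (delta_mx 0 j) 0 i|.
have nK1 (ij : 'I_d * 'I_d) :
    \forall x \near z0, `|'d G x (delta_mx 0 ij.2) 0 ij.1| <= K.
  case: ij => i j; have /cvgrPdist_le/(_ 1 ltr01) := cpart i j.
  apply: filterS => x Hx /=.
  have Hle : `|'d G z0 (delta_mx 0 j) 0 i| <= \sum_i \sum_j `|'d G z0 (delta_mx 0 j) 0 i|.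
    rewrite (bigD1 i) //= (bigD1 j) //= -addrA lerDl addr_ge0 ?sumr_ge0 // => k _.
    by rewrite sumr_ge0.
  have := ler_normB ('d G z0 (delta_mx 0 j) 0 i)
    ('d G z0 (delta_mx 0 j) 0 i - 'd G x (delta_mx 0 j) 0 i).
  rewrite subKr /K addrC => /le_trans; apply; exact: lerD.
have nK : \forall x \near z0, forall (ij : 'I_d * 'I_d), `|'d G x (delta_mx 0 ij.2) 0 ij.1| <= K.
  exact: near_forall nK1.
have K0 : 0 < K by rewrite /K ltr_pwDl // sumr_ge0 // => i _; rewrite sumr_ge0.
have [r r0 Hr] := near_norm2 nK (smooth_near_near sG).
have dr0 : 0 < d%:R * K + 1 by rewrite ltr_wpDl // mulr_ge0 // ltW.
(* The summand 1 keeps the Lipschitz constant positive even in dimension 0. *)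
exists (r / 2), (d%:R * K + 1); split=> //; first by rewrite divr_gt0.
move=> x y xr yr; apply/norm_rV_le => [|i]; first by rewrite mulr_ge0 // ltW.
(* The segment is parametrized from its midpoint, with y at -1 and x at 1, since [derive_bound]
   compares with the value at 0 in both directions. *)
pose w := 2^-1 *: (x - y); pose a (s : R) := 2^-1 *: (x + y) + s *: w.
have aball s : `|s| <= 1 -> `|z0 - a s| < r.
  rewrite ler_norml => /andP[s1 s2]; rewrite distrC.
  have -> : a s - z0 = ((1 + s) / 2) *: (x - z0) + ((1 - s) / 2) *: (y - z0).
    by rewrite /a /w; apply/rowP => k; rewrite !mxE; field.
  apply: le_lt_trans (ler_normD _ _) _.
  rewrite (normrZ ((1 + s) / 2) (x - z0)) (normrZ ((1 - s) / 2) (y - z0)).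
  have h1 : `|(1 + s) / 2| = (1 + s) / 2 by rewrite ger0_norm //; lra.
  have h2 : `|(1 - s) / 2| = (1 - s) / 2 by rewrite ger0_norm //; lra.
  rewrite h1 h2; apply: (@le_lt_trans _ _ (r / 2)); last by lra.
  have h3 : 0 <= (1 + s) / 2 by lra.
  have h4 : 0 <= (1 - s) / 2 by lra.
  have := lerD (ler_wpM2l h3 xr) (ler_wpM2l h4 yr).
  by move=> /le_trans; apply; lra.
pose f (s : R) := G (a s) 0 i; pose df (s : R) := 'd G (a s) w 0 i.
have da (s : R) : is_diff s a (fun h => h *: w).
  rewrite /a; have -> : (fun h : R => h *: w) = (fun h : R => 0 + h *: w).
    by apply/funext => h; rewrite add0r.
  exact: is_diffD.
have ddf (s : R) : `|s| <= 1 -> differentiable f s /\ 'd f s 1 = df s.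
  move=> /aball/Hr[_ /smooth_near_diff dG].
  have [dGi dGE] := diff_coord i dG.
  have das : differentiable a s by case: (da s).
  split; first exact: (differentiable_comp das dGi).
  have := congr1 (fun h : R -> R => h 1) (diff_comp das dGi).
  move=> /= E; apply: (etrans E); rewrite dGE.
  have -> : 'd a s 1 = w by have [_ ->] := da s; rewrite scale1r.
  by [].
pose c : R := K * `|w|.
have dfK (s : R) : `|s| < 1 -> `|df s| <= d%:R * c.
  move=> /ltW/aball/Hr[HK _]; rewrite /df diff_delta summxE.
  apply: le_trans (ler_norm_sum _ _ _) _.
  apply: (@le_trans _ _ (\sum_(j < d) c)).
    apply: ler_sum => j _; rewrite mxE normrM mulrC; apply: ler_pM => //.
      exact: (HK (i, j)).
    exact: coord_norm.
  by rewrite sumr_const card_ord mulr_natl.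
have B (t : R) : `|t| = 1 -> `|f t - f 0| <= d%:R * c.
  move=> t1; have := @derive_bound f df 1 (d%:R * c) t.
  rewrite t1 mulr1; apply=> // s s1.
    by apply: differentiable_continuous; have [] := ddf s s1.
  have [dfs <-] := ddf s (ltW s1).
  have := derivableP ((derivable1_diffP f s).2 dfs).
  by rewrite -deriveE.
have B1 := B 1 (normr1 _); have Bm := B (-1) (normrN1 _).
have Ex : a 1 = x by rewrite /a /w; apply/rowP => k; rewrite !mxE; field.
have Ey : a (-1) = y by rewrite /a /w; apply/rowP => k; rewrite !mxE; field.
have wE : d%:R * c = d%:R * K * `|x - y| / 2.
  rewrite /c /w normrZ ger0_norm ?invr_ge0 //.
  by move: (`|x - y|) => b; field.
have xy0 := normr_ge0 (x - y).
move: B1 Bm; rewrite /f Ex Ey wE !mxE.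
have := ler_distD (G (a 0) 0 i) (G x 0 i) (G y 0 i).
rewrite [`|G (a 0) 0 i - _|]distrC mulrDl mul1r.
move: (`|_|) (`|_|) (`|_|) (`|x - y|) xy0 => p q u b; move: (d%:R * K * b) => *; lra.
Qed.

(** Bootstrapping: if z is C^k, so is its derivative G o z, and z is C^(k+1). *)
Lemma ode_smooth d (G : 'rV[R]_d -> 'rV[R]_d) (U : set R) (U' : set 'rV[R]_d)
    (z : R -> 'rV[R]_d) : open U -> open U' -> smooth_on U' G ->
  (forall t, U t -> U' (z t)) ->
  (forall t, U t -> differentiable z t /\ 'd z t 1 = G (z t)) -> smooth_on U z.
Proof.
move=> oU oU' sG zU dz; elim=> [|k IH].
  by move=> t /dz[+ _]; exact: differentiable_continuous.
rewrite CkSE; split=> [t /dz[]//|v].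
apply/(Ck_coord _ _ oU) => i.
have CG : Ck_on k U ((fun x => G x 0 i : R) \o z).
  apply: (Ck_comp oU zU IH).
  by have /(Ck_coord _ _ oU') := sG k.
apply: (Ck_ext oU _ (CkM oU (Ck_cst k U v) CG)) => t Ut /=.
have [_ <-] := dz t Ut.
have -> : 'd z t v = v *: 'd z t 1.
  by rewrite -linearZ /=; congr ('d z t _); rewrite /GRing.scale /= mulr1.
by rewrite mxE.
Qed.

Lemma ode d (G : 'rV[R]_d -> 'rV[R]_d) z0 : smooth_near z0 G ->
  exists e (z : R -> 'rV[R]_d), [/\ 0 < e, z 0 = z0,
    smooth_on [set t | `|t| < e] z & forall t : R, `|t| < e -> 'd z t 1 = G (z t)].
Proof.
move=> sG; have [r [L [r0 L0 GL]]] := smooth_near_lipschitz sG.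
have [U' [oU' U'z0 sGU]] := sG.
(* The retraction onto the closed box of radius r around z0 makes G globally Lipschitz. For short
   times the solution stays in the box, where the retraction is the identity. *)
pose cl (x : 'rV[R]_d) : 'rV[R]_d := \row_i clamp (z0 0 i - r) (z0 0 i + r) (x 0 i).
have clr x : `|cl x - z0| <= r.
  apply/norm_rV_le => [|i]; first exact: ltW.
  have h : z0 0 i - r <= z0 0 i + r by rewrite lerD2l ge0_cp // ltW.
  have /andP[h1 h2] := clamp_in (x 0 i) h.
  by rewrite !mxE ler_norml; apply/andP; split; lra.
have clL x y : `|cl x - cl y| <= `|x - y|.
  apply/norm_rV_le => // i; rewrite !mxE; apply: le_trans (clamp_lip _ _ _ _) _.
  by have := coord_norm (x - y) i; rewrite !mxE.
(* The two bounds are the conditions e <= 1 and L e <= 1 / 2 of [picard]. *)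
pose e1 := Num.min 1 (1 / (2 * L)).
have e10 : 0 < e1 by rewrite /e1 lt_min ltr01 divr_gt0 // mulr_gt0.
have e1L : L * e1 <= 1 / 2.
  have : L * e1 <= L * (1 / (2 * L)) by rewrite ler_wpM2l ?(ltW L0) // /e1 ge_min lexx orbT.
  suff -> : L * (1 / (2 * L)) = 1 / 2 by [].
  by field; rewrite gt_eqF.
have GL' x y : `|G (cl x) - G (cl y)| <= L * `|x - y|.
  by apply: le_trans (GL _ _ (clr x) (clr y)) _; rewrite ler_wpM2l // ltW.
have e11 : e1 <= 1 by rewrite /e1 ge_min lexx.
have [z [cz z00 dz]] := picard z0 L0 GL' e10 e11 e1L.
have nr : \forall t \near (0 : R), `|z0 - z t| <= r.
  by have /cvgrPdist_le/(_ r r0) := cz 0; rewrite z00.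
have nU : \forall t \near (0 : R), U' (z t).
  by apply: (cz 0); rewrite z00; exact: open_nbhs_nbhs.
have [e2 e20 He2] := near_norm2 nr nU.
pose e := Num.min e1 e2.
have dzt (t : R) : `|t| < e -> differentiable z t /\ 'd z t 1 = G (z t).
  rewrite /e lt_min => /andP[te1 te2].
  have clz : cl (z t) = z t.
    have [zr _] : `|z0 - z t| <= r /\ U' (z t) by apply: He2; rewrite sub0r normrN.
    apply/rowP => i; rewrite mxE clamp_id //.
    have := le_trans (coord_norm (z0 - z t) i) zr; rewrite !mxE ler_norml.
    by move=> /andP[h1 h2]; apply/andP; split; lra.
  have dzi i : differentiable (fun s => z s 0 i : R) t.
    by apply/derivable1_diffP; have [] := dz t i te1.
  have dzz : differentiable z t by exact: diff_rV.
  split=> //; apply/rowP => i; have [_ <-] := diff_coord i dzz.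
  have [_ dE] := dz t i te1.
  by rewrite -deriveE // dE clz.
exists e, z; split=> //.
- by rewrite /e lt_min e10.
- apply: (@ode_smooth _ G _ U') => // [|t /=].
    have -> : [set t : R | `|t| < e] = (fun t : R => `|t|) @^-1` [set t | t < e] by [].
    by apply: open_comp; [move=> t _; exact: norm_continuous | exact: open_lt].
  rewrite /e lt_min => /andP[_ te2].
  by have [] : `|z0 - z t| <= r /\ U' (z t) by apply: He2; rewrite sub0r normrN.
- by move=> t /dzt[].
Qed.

End ODE.

(** * Geodesics *)

Section Curve.
Context {R : realType} {n : nat} {N : manifold R n}.
Variables (J : set R) (beta : R -> N).
Hypotheses (oJ : open J) (sb : smooth_curve J beta).
Implicit Types (q : N) (W : R -> 'rV[R]_n).

Lemma curve_near t (P : set N) : J t ->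
  (\forall y \near beta t, P y) -> \forall s \near t, P (beta s).
Proof. by move=> Jt; have [cb _] := sb; exact: cb. Qed.

Lemma open_curve q : open (J `&` beta @^-1` dom q).
Proof.
rewrite openE => t [Jt qt].
by apply: filterI; [exact: open_nbhs_nbhs | exact: (curve_near Jt (dom_near qt))].
Qed.

Lemma smooth_near_curve t q : J t -> dom q (beta t) -> smooth_near t (chart q \o beta).
Proof.
by move=> Jt qt; have [_ sm] := sb; apply: (smooth_nearP (@open_curve q) (sm q)).
Qed.

Lemma curve_comp t (h : N -> R) : J t -> smooth_at (beta t) h ->
  smooth_near t (h \o beta) /\ 'd (h \o beta) t 1 = dfun h (beta t) (velocity beta t).
Proof.
move=> Jt sh; have bb := dom_center (beta t).
have nE : \forall s \near t,
    ((h \o chart_inv (beta t)) \o (chart (beta t) \o beta)) s = (h \o beta) s.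
  by apply: filterS (curve_near Jt (dom_near bb)) => s bs /=; rewrite chartK.
have sc := smooth_near_curve Jt bb.
split; first exact: (smooth_near_ext nE (smooth_near_comp_real sc sh)).
rewrite dfunE /velocity; apply: (diff_comp_near (f := chart (beta t) \o beta)
  (g := h \o chart_inv (beta t)) (1 : R) _ _ _ nE).
- exact: smooth_near_diff.
- by [].
- exact: smooth_near_diff.
Qed.

Lemma smooth_along_curveP W : smooth_along_curve J beta W <->
  forall t, J t -> forall h, smooth_fun h ->
    smooth_near t (fun s => dfun h (beta s) (W s)).
Proof.
split=> [sW t Jt h sh|sW q].
  have bb := dom_center (beta t).
  apply: (@smooth_near_ext _ _ _ _ (fun s => 'd (h \o chart_inv (beta t))
    ((chart (beta t) \o beta) s) (tangent_coord (beta t) (beta s) (W s)))).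
    apply: filterS (curve_near Jt (dom_near bb)) => s bs.
    by rewrite [RHS](dfun_chart _ bs) //; exact: smooth_fun_at.
  apply: smooth_near_dvar_real.
  - exact: smooth_near_curve.
  - exact: smooth_fun_at.
  - by apply: (smooth_nearP (@open_curve _) (sW (beta t))).
apply: smooth_on_near => t [Jt qt]; apply/smooth_near_coord => i.
have [k sk kE] : exists2 k, smooth_fun k &
    \forall y \near beta t, k y = chart q y 0 i.
  by apply: smooth_extend; apply: filterS (dom_near qt) => y; exact: smooth_at_coord.
have H : \forall y \near beta t, forall v, dfun k y v = tangent_coord q y v 0 i.
  have [G [oG Gx kG]] := near_open kE.
  have : \forall y \near beta t, G y by apply: open_nbhs_nbhs.
  apply: filterS2 (dom_near qt) => y qy Gy v.
  rewrite -(dfun_coord v i qy); apply: dfun_ext (smooth_at_coord i qy) _.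
  by apply: filterS (open_nbhs_nbhs (conj oG Gy)) => z /kG ->.
by apply: smooth_near_ext (sW t Jt k sk); apply: filterS (curve_near Jt H) => s ->.
Qed.

Lemma smooth_along_curve_field (h : R -> R) (E : N -> 'rV[R]_n) :
  (forall t, J t -> smooth_near t h) -> vector_field E ->
  smooth_along_curve J beta (fun t => h t *: E (beta t)).
Proof.
move=> sh /vector_fieldP sE; apply/smooth_along_curveP => t Jt k sk.
have [sk' _] := curve_comp Jt (smooth_fun_at _ (sE k sk)).
apply: smooth_near_eq (smooth_nearM (sh t Jt) sk').
by move=> s /=; rewrite dfunZr.
Qed.

Lemma smooth_along_curveD W W' : smooth_along_curve J beta W ->
  smooth_along_curve J beta W' -> smooth_along_curve J beta (fun t => W t + W' t).
Proof.
move=> /smooth_along_curveP sW /smooth_along_curveP sW'.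
apply/smooth_along_curveP => t Jt h sh.
apply: smooth_near_eq (smooth_nearD (sW t Jt h sh) (sW' t Jt h sh)).
by move=> s; rewrite dfunDr.
Qed.

Lemma smooth_along_curve_sum I (r : seq I) (W : I -> R -> 'rV[R]_n) :
  (forall i, smooth_along_curve J beta (W i)) ->
  smooth_along_curve J beta (fun t => \sum_(i <- r) W i t).
Proof.
move=> sW; apply/smooth_along_curveP => t Jt h sh.
apply: (@smooth_near_eq _ _ _ _ (fun s => \sum_(i <- r) dfun h (beta s) (W i s))).
  by move=> s; rewrite dfun_sumr.
by apply: smooth_near_sum => i _; have /smooth_along_curveP := sW i; apply.
Qed.

Lemma smooth_along_curve_ext W W' : (forall t, J t -> W t = W' t) ->
  smooth_along_curve J beta W -> smooth_along_curve J beta W'.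
Proof.
move=> WW /smooth_along_curveP sW; apply/smooth_along_curveP => t Jt h sh.
apply: smooth_near_ext (sW t Jt h sh).
by apply: filterS (open_nbhs_nbhs (conj oJ Jt)) => s /WW ->.
Qed.

Variable g : N -> 'rV[R]_n -> 'rV[R]_n -> R.
Hypothesis mg : riemannian_metric g.
Variable nabla : N -> 'rV[R]_n -> (N -> 'rV[R]_n) -> 'rV[R]_n.
Hypothesis lc : levi_civita g nabla.
Variables (x : 'I_n -> N -> R) (e : 'I_n -> N -> 'rV[R]_n).
Hypothesis cxe : forall t, J t -> coordinate_system (beta t) x e.

Let cN := levi_civita_connection lc.

Let se i t : J t -> vector_field (e i). Proof. by move=> /cxe[]. Qed.

Let sx i t : J t -> smooth_fun (x i). Proof. by move=> /cxe[]. Qed.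

Let expand t v : J t -> v = \sum_i dfun (x i) (beta t) v *: e i (beta t).
Proof. by move=> /cxe[_ _ /nbhs_singleton[+ _]]; exact. Qed.

Definition curve_coord W i t := dfun (x i) (beta t) (W t).

(** Meaningful only while the curve stays where the [x i] and [e i] are dual; the geodesics built
    below are short enough for a single such frame. *)
Definition covariant_derivative W t :=
  \sum_i ('d (curve_coord W i) t 1 *: e i (beta t)
          + curve_coord W i t *: nabla (beta t) (velocity beta t) (e i)).

Lemma curve_coord_smooth W i t : smooth_along_curve J beta W -> J t ->
  smooth_near t (curve_coord W i).
Proof. by move=> /smooth_along_curveP sW Jt; apply: sW Jt _ (sx i Jt). Qed.

Lemma velocity_smooth : smooth_along_curve J beta (velocity beta).
Proof.
apply/smooth_along_curveP => t Jt h sh.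
have [sk _] := curve_comp Jt (smooth_fun_at _ sh).
apply: (@smooth_near_ext _ _ _ _ (fun s => 'd (h \o beta) s 1) _ _ (smooth_near_d (1 : R) sk)).
apply: filterS (open_nbhs_nbhs (conj oJ Jt)) => s Js.
by have [_ ->] := curve_comp Js (smooth_fun_at _ sh).
Qed.

Lemma covariant_derivative_smooth W : smooth_along_curve J beta W ->
  smooth_along_curve J beta (covariant_derivative W).
Proof.
move=> sW; have [[t0 Jt0]|nJ] := pselect (exists t, J t); last first.
  by apply/smooth_along_curveP => t Jt; case: nJ; exists t.
apply: smooth_along_curve_sum => i; apply: smooth_along_curveD.
  apply: smooth_along_curve_field (se i Jt0) => t Jt.
  exact: (smooth_near_d (1 : R) (curve_coord_smooth i sW Jt)).
(* [connection_smooth] concerns fields and not velocities of curves; expanding the velocity in the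
   frame leaves only derivatives of frame fields along frame fields. *)
apply: (@smooth_along_curve_ext (fun t => \sum_j
    (curve_coord W i t * curve_coord (velocity beta) j t) *: nabla (beta t) (e j (beta t)) (e i))).
  move=> t Jt; rewrite [in RHS](expand (velocity beta t) Jt) (connection_sumu cN); last exact: se Jt.
  rewrite scaler_sumr; apply: eq_bigr => j _.
  by rewrite (connectionZu cN) ?scalerA //; exact: se Jt.
apply: smooth_along_curve_sum => j.
apply: (smooth_along_curve_field (E := fun y => nabla y (e j y) (e i))) => [t Jt|].
  by apply: smooth_nearM; apply: curve_coord_smooth => //; exact: velocity_smooth.
exact: (connection_smooth cN (se j Jt0) (se i Jt0)).
Qed.

Lemma covariant_derivative_compose Y t : J t -> vector_field Y ->
  covariant_derivative (Y \o beta) t = nabla (beta t) (velocity beta t) Y.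
Proof.
move=> Jt sY; rewrite (connection_coord (smooth_map_id N) cN _ (cxe Jt) sY).
apply: eq_bigr => i _; congr (_ *: _ + _).
have /vector_fieldP/(_ _ (sx i Jt)) sYi := sY.
by have [_ <-] := curve_comp Jt (smooth_fun_at _ sYi).
Qed.

Lemma covariant_derivativeP : curve_derivative nabla J beta covariant_derivative.
Proof.
split=> [W|W W' t Jt sW sW'|h W t Jt sh sW|Y t Jt sY].
- exact: covariant_derivative_smooth.
- rewrite /covariant_derivative -big_split /=; apply: eq_bigr => i _.
  have d1 := smooth_near_diff (curve_coord_smooth i sW Jt).
  have d2 := smooth_near_diff (curve_coord_smooth i sW' Jt).
  have E : curve_coord (fun s => W s + W' s) i = curve_coord W i + curve_coord W' i.
    by apply/funext => s; rewrite /curve_coord dfunDr.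
  have -> : 'd (curve_coord (fun s => W s + W' s) i) t 1
      = 'd (curve_coord W i) t 1 + 'd (curve_coord W' i) t 1.
    by rewrite E; exact: (congr1 (fun k : R -> R => k 1) (diffD d1 d2)).
  by rewrite E !scalerDl addrACA.
- rewrite /covariant_derivative [X in _ = _ *: X + _](expand (W t) Jt).
  rewrite !scaler_sumr -big_split /=; apply: eq_bigr => i _.
  have d1 := smooth_near_diff (smooth_nearP oJ sh Jt).
  have d2 := smooth_near_diff (curve_coord_smooth i sW Jt).
  have E : curve_coord (fun s => h s *: W s) i = h * curve_coord W i.
    by apply/funext => s; rewrite /curve_coord dfunZr.
  have -> : 'd (curve_coord (fun s => h s *: W s) i) t 1
      = h t * 'd (curve_coord W i) t 1 + curve_coord W i t * 'd h t 1.
    by rewrite E; exact: (congr1 (fun k : R -> R => k 1) (diffM d1 d2)).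
  have -> : curve_coord (fun s => h s *: W s) i t = h t * curve_coord W i t.
    by rewrite E.
  rewrite -/(curve_coord W i t); move: (curve_coord W i t) ('d _ t 1) ('d h t 1) => a b c.
  rewrite scalerDl scalerDr !scalerA [a * c]mulrC addrA; congr (_ + _).
  by rewrite addrC.
- exact: covariant_derivative_compose.
Qed.

(** Metric compatibility on the frame and the product rule for the coefficients. It yields the
    derivatives of the squared speed and of g(beta', E) along a geodesic. *)
Lemma metric_curve W W' t : J t -> smooth_along_curve J beta W ->
  smooth_along_curve J beta W' ->
  smooth_near t (fun s => g (beta s) (W s) (W' s)) /\
  'd (fun s => g (beta s) (W s) (W' s)) t 1
    = g (beta t) (covariant_derivative W t) (W' t)
    + g (beta t) (W t) (covariant_derivative W' t).
Proof.
move=> Jt sW sW'.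
pose G i j y := g y (e i y) (e j y).
have sG i j : smooth_fun (G i j) by exact: (metric_smooth mg (se i Jt) (se j Jt)).
have sh i := curve_coord_smooth i sW Jt; have sh' i := curve_coord_smooth i sW' Jt.
have sGb i j := curve_comp Jt (smooth_fun_at _ (sG i j)).
pose T i j s := curve_coord W i s * curve_coord W' j s * (G i j \o beta) s.
have sT i j : smooth_near t (T i j).
  by apply: smooth_nearM; [exact: smooth_nearM | case: (sGb i j)].
have TE : \forall s \near t, \sum_(ij : 'I_n * 'I_n) T ij.1 ij.2 s = g (beta s) (W s) (W' s).
  apply: filterS (open_nbhs_nbhs (conj oJ Jt)) => s Js.
  rewrite [in RHS](expand (W s) Js) [X in _ = g _ _ X](expand (W' s) Js) (metric_suml mg).
  rewrite -(pair_bigA _ (fun i j => T i j s)) /=; apply: eq_bigr => i _.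
  rewrite (metric_sumr mg); apply: eq_bigr => j _.
  by rewrite (metricZl mg) (metricZr mg) mulrA.
have sS : smooth_near t (fun s => \sum_(ij : 'I_n * 'I_n) T ij.1 ij.2 s).
  by apply: smooth_near_sum => ij _; exact: sT.
split; first exact: smooth_near_ext TE sS.
have [_ /(congr1 (fun k : R -> R => k 1)) E0] := near_eq_diff TE (smooth_near_diff sS).
apply: (etrans E0); rewrite diff_sumv => [|[i j]]; last exact: sT.
have dT i j : 'd (T i j) t 1
    = ('d (curve_coord W i) t 1 * curve_coord W' j t
       + curve_coord W i t * 'd (curve_coord W' j) t 1) * G i j (beta t)
    + curve_coord W i t * curve_coord W' j t
      * (g (beta t) (nabla (beta t) (velocity beta t) (e i)) (e j (beta t))
         + g (beta t) (e i (beta t)) (nabla (beta t) (velocity beta t) (e j))).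
  have [s1 E1] := sGb i j.
  rewrite /T diffMv; last 2 first.
  - by apply/smooth_near_diff/smooth_nearM; [exact: sh | exact: sh'].
  - exact: smooth_near_diff.
  rewrite diffMv; last 2 first.
  - exact/smooth_near_diff/sh.
  - exact/smooth_near_diff/sh'.
  rewrite E1 (levi_civita_metric lc) //; exact: se Jt.
rewrite -(pair_bigA _ (fun i j => 'd (T i j) t 1)) /=.
rewrite [X in g _ _ X + _](expand (W' t) Jt) [X in _ + g _ X _](expand (W t) Jt).
rewrite /covariant_derivative !(metric_suml mg) -big_split /=.
apply: eq_bigr => i _; rewrite !(metric_sumr mg) -big_split /=.
apply: eq_bigr => j _; rewrite dT /G.
rewrite !(metricDl mg, metricDr mg, metricZl mg, metricZr mg).
rewrite -/(curve_coord W i t) -/(curve_coord W' j t).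
move: (curve_coord W i t) (curve_coord W' j t) => a b.
move: ('d _ t 1) ('d _ t 1) (g _ _ _) (g _ _ _) (g _ _ _) => c d u v w.
ring.
Qed.

End Curve.

(** * Local existence of geodesics *)

Section Geodesics.
Context {R : realType} {n : nat} {N : manifold R n}.
Variable g : N -> 'rV[R]_n -> 'rV[R]_n -> R.
Hypothesis mg : riemannian_metric g.
Variable nabla : N -> 'rV[R]_n -> (N -> 'rV[R]_n) -> 'rV[R]_n.
Hypothesis lc : levi_civita g nabla.
Implicit Types (q : N).

Let cN := levi_civita_connection lc.

Definition christoffel (x : 'I_n -> N -> R) (e : 'I_n -> N -> 'rV[R]_n) i j k y :=
  dfun (x k) y (nabla y (e j y) (e i)).

Lemma christoffel_smooth x e q i j k : coordinate_system q x e ->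
  smooth_fun (christoffel x e i j k).
Proof.
move=> [sx se _].
have /vector_fieldP := connection_smooth cN (se j) (se i); apply; exact: sx.
Qed.

(* The geodesic equation in the chart of q, as a first order equation on pairs
   (position, velocity). *)
Definition geodesic_field q x e (w : 'rV[R]_(n + n)) : 'rV[R]_(n + n) :=
  row_mx (rsubmx w) (\row_k - \sum_i \sum_j rsubmx w 0 i * rsubmx w 0 j
    * christoffel x e i j k (chart_inv q (lsubmx w))).

Lemma smooth_near_lsubmx w : smooth_near w (lsubmx : 'rV[R]_(n + n) -> 'rV[R]_n).
Proof.
apply/smooth_near_coord => i.
apply: (@smooth_near_eq _ _ _ _ (fun w : 'rV[R]_(n + n) => w 0 (lshift n i))).
  by move=> u; rewrite mxE.
by have /smooth_near_coord := smooth_near_id w.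
Qed.

Lemma smooth_near_rsubmx w i :
  smooth_near w (fun w : 'rV[R]_(n + n) => rsubmx w 0 i : R).
Proof.
apply: (@smooth_near_eq _ _ _ _ (fun w : 'rV[R]_(n + n) => w 0 (rshift n i))).
  by move=> u; rewrite mxE.
by have /smooth_near_coord := smooth_near_id w.
Qed.

Lemma geodesic_field_smooth q x e v : coordinate_system q x e ->
  smooth_near (row_mx (chart q q) v) (geodesic_field q x e).
Proof.
move=> cxe; apply/smooth_near_coord => l; rewrite -(splitK l).
case: (fintype.split l) => k /=.
  apply: (@smooth_near_eq _ _ _ _ (fun w : 'rV[R]_(n + n) => rsubmx w 0 k)).
    by move=> w; rewrite /geodesic_field row_mxEl.
  exact: smooth_near_rsubmx.
apply: (@smooth_near_eq _ _ _ _ (fun w : 'rV[R]_(n + n) => (-1) * (\sum_i \sum_j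
    rsubmx w 0 i * rsubmx w 0 j
    * (christoffel x e i j k \o chart_inv q \o lsubmx) w))).
  by move=> w; rewrite /geodesic_field row_mxEr mxE mulN1r.
apply: smooth_nearM; first exact: smooth_near_cst.
apply: smooth_near_sum => i _; apply: smooth_near_sum => j _; apply: smooth_nearM.
  by apply: smooth_nearM; exact: smooth_near_rsubmx.
apply: (smooth_near_comp_real (g := christoffel x e i j k \o chart_inv q)).
  exact: smooth_near_lsubmx.
rewrite row_mxKl; apply/(smooth_at_chart _ (dom_center q)).
exact/smooth_fun_at/(christoffel_smooth _ _ _ cxe).
Qed.

(** The frame and the explicit covariant derivative are part of the conclusion because [geodesic]
    hides its operator behind an existential, while [metric_curve] is about this one. *)
Lemma geodesic_exists q v : exists (J : set R) (beta : R -> N) x e,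
  [/\ J 0, beta 0 = q, velocity beta 0 = v, geodesic nabla J beta &
    (forall t, J t -> coordinate_system (beta t) x e) /\
    (forall t, J t -> covariant_derivative beta nabla x e (velocity beta) t = 0)].
Proof.
have qq := dom_center q.
have [x [e [cxe nE]]] := chart_coordinate_system q.
have [e1 [z [e10 z0 sz dz]]] := ode (geodesic_field_smooth (tangent_coord q q v) cxe).
pose a t : 'rV[R]_n := lsubmx (z t); pose b t : 'rV[R]_n := rsubmx (z t).
have a0 : a 0 = chart q q by rewrite /a z0 row_mxKl.
have oe1 : open [set t : R | `|t| < e1].
  have -> : [set t : R | `|t| < e1] = (fun t : R => `|t|) @^-1` [set t | t < e1] by [].
  by apply: open_comp; [move=> t _; exact: norm_continuous | exact: open_lt].
have sz' (t : R) : `|t| < e1 -> smooth_near t z by exact: (smooth_nearP oe1 sz).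
have sa (t : R) : `|t| < e1 -> smooth_near t a.
  move=> te; apply: (smooth_near_comp (sz' t te)); exact: smooth_near_lsubmx.
have sbi i (t : R) : `|t| < e1 -> smooth_near t (fun s => b s 0 i).
  move=> te; apply: (smooth_near_comp_real (sz' t te) (g := fun w => rsubmx w 0 i)).
  exact: smooth_near_rsubmx.
have nG : \forall y \near q, [/\ dom q y,
    forall i v, dfun (x i) y v = tangent_coord q y v 0 i & coordinate_system y x e].
  by apply: filterS2 nE (coordinate_system_near cxe) => y [].
have ca0 : {for 0, continuous a}.
  by apply: smooth_near_continuous; apply: sa; rewrite normr0.
have n1 : \forall t \near (0 : R), (chart q @` dom q) (a t).
  by apply: ca0; rewrite a0; exact: chart_near.
have n2 : \forall t \near (0 : R), [/\ dom q (chart_inv q (a t)),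
    forall i v, dfun (x i) (chart_inv q (a t)) v = tangent_coord q (chart_inv q (a t)) v 0 i
    & coordinate_system (chart_inv q (a t)) x e].
  by have := near_chart_inv qq nG; rewrite -a0 => H; exact: (ca0 _ H).
(* e2 keeps the curve in the chart domain of q, with the [x i] and [e i] still dual along it. *)
have [e2 e20 He2] := near_norm2 n1 n2.
pose e3 := Num.min e1 e2.
have e30 : 0 < e3 by rewrite /e3 lt_min e10.
pose J := [set` `]- e3, e3[].
have J1 t : J t -> `|t| < e1.
  rewrite /J /= in_itv /= -ltr_norml => /lt_le_trans; apply.
  by rewrite /e3 ge_min lexx.
have J2 t : J t -> `|0 - t| < e2.
  rewrite /J /= in_itv /= -ltr_norml sub0r normrN => /lt_le_trans; apply.
  by rewrite /e3 ge_min lexx orbT.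
have J0 : J 0 by rewrite /J /= in_itv /= oppr_lt0 e30.
have oJ : open J by exact: interval_open.
pose beta t := chart_inv q (a t).
have im t : J t -> (chart q @` dom q) (a t) by move=> /J2/He2[].
have chb t : J t -> chart q (beta t) = a t by move=> /im/chart_invK[].
have qb t : J t -> dom q (beta t) by move=> /im/chart_invK[].
have cxb t : J t -> coordinate_system (beta t) x e by move=> /J2/He2[_ []].
have sb : smooth_curve J beta.
  split=> [t Jt|p].
    apply: (@continuous_comp _ _ _ a (chart_inv q)).
      exact/smooth_near_continuous/sa/J1.
    exact/chart_inv_continuous/im.
  apply: smooth_on_near => t [Jt pt].
  apply: (smooth_near_comp (f := a) (g := chart p \o chart_inv q)); first exact/sa/J1.
  by rewrite -(chb t Jt); apply: chart_trans_smooth => //; exact: qb.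
have nJ t : J t -> \forall s \near t, J s by move=> Jt; exact: open_nbhs_nbhs.
have dcoord t l : J t -> 'd (fun s => z s 0 l : R) t 1 = geodesic_field q x e (z t) 0 l.
  move=> Jt; have [_ ->] := diff_coord l (smooth_near_diff (sz' t (J1 t Jt))).
  by rewrite dz //; exact: J1.
have vb t i : J t -> tangent_coord q (beta t) (velocity beta t) 0 i = b t 0 i.
  move=> Jt; rewrite -(dfun_coord _ i (qb t Jt)).
  have [sc <-] := curve_comp oJ sb Jt (smooth_at_coord i (qb t Jt)).
  have E : \forall s \near t, ((fun y => chart q y 0 i) \o beta) s = z s 0 (lshift n i).
    by apply: filterS (nJ t Jt) => s Js /=; rewrite chb // mxE.
  have [_ /(congr1 (fun k : R -> R => k 1)) <-] := near_eq_diff E (smooth_near_diff sc).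
  by rewrite dcoord // /geodesic_field row_mxEl.
have cb t i : J t -> curve_coord beta x (velocity beta) i t = b t 0 i.
  by move=> Jt; rewrite -vb //; have [_ [_ E _]] := He2 t (J2 t Jt); exact: E.
have cd0 t : J t -> covariant_derivative beta nabla x e (velocity beta) t = 0.
  move=> Jt; have [sx se /nbhs_singleton[expand _]] := cxb t Jt.
  have dcb i : 'd (curve_coord beta x (velocity beta) i) t 1
      = - \sum_k \sum_j b t 0 k * b t 0 j * christoffel x e k j i (beta t).
    have E : \forall s \near t, z s 0 (rshift n i) = curve_coord beta x (velocity beta) i s.
      by apply: filterS (nJ t Jt) => s Js /=; rewrite cb // mxE.
    have dzi : differentiable (fun s => z s 0 (rshift n i) : R) t.
      by have [] := diff_coord (rshift n i) (smooth_near_diff (sz' t (J1 t Jt))).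
    have [_ /(congr1 (fun k : R -> R => k 1)) E1] := near_eq_diff E dzi.
    by apply: (etrans E1); rewrite dcoord // /geodesic_field row_mxEr mxE.
  have nab i : nabla (beta t) (velocity beta t) (e i)
      = \sum_j b t 0 j *: nabla (beta t) (e j (beta t)) (e i).
    rewrite [in LHS](expand (velocity beta t)) (connection_sumu cN); last exact: se.
    apply: eq_bigr => j _; rewrite -cb //.
    by apply: (connectionZu cN); exact: se.
  rewrite /covariant_derivative big_split /=.
  under eq_bigr => i _ do rewrite dcb.
  under [X in _ + X]eq_bigr => i _ do rewrite cb // nab scaler_sumr.
  (* After expansion over the frame, the velocity half of the geodesic system says that the
     coefficients of the two sums cancel. *)
  apply/eqP; rewrite addrC -[X in _ + X]opprK subr_eq0 -sumrN; apply/eqP.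
  under [RHS]eq_bigr => k _ do rewrite scaleNr opprK scaler_suml.
  rewrite [RHS]exchange_big /=; apply: eq_bigr => i _.
  under [RHS]eq_bigr => k _ do rewrite scaler_suml.
  rewrite [RHS]exchange_big /=; apply: eq_bigr => j _.
  rewrite scalerA [in LHS](expand (nabla (beta t) (e j (beta t)) (e i))) scaler_sumr.
  by apply: eq_bigr => k _; rewrite scalerA.
have b00 : beta 0 = q by rewrite /beta a0 chartK.
exists J, beta, x, e; split=> //.
- apply: (tangent_coord_inj (qb 0 J0)); apply/rowP => i.
  by rewrite vb // b00 /b z0 row_mxKr.
- split=> //; first exact: interval_is_interval.
  exists (covariant_derivative beta nabla x e) => //.
  exact: (covariant_derivativeP oJ sb lc cxb).
Qed.

End Geodesics.

(** * The Clairaut condition *)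

Section Clairaut.
Context {R : realType} {n : nat} {N : manifold R n}.
Variable g : N -> 'rV[R]_n -> 'rV[R]_n -> R.
Hypothesis mg : riemannian_metric g.
Variable nabla : N -> 'rV[R]_n -> (N -> 'rV[R]_n) -> 'rV[R]_n.
Hypothesis lc : levi_civita g nabla.
Implicit Types (q : N) (u v w T V : 'rV[R]_n).

Let cN := levi_civita_connection lc.

Lemma metric_cauchy q u w : g q u w ^+ 2 <= g q u u * g q w w.
Proof.
have [->|w0] := eqVneq w 0; first by rewrite !(metric0r mg) expr0n mulr0.
have ww : 0 < g q w w by exact: (metric_pos mg).
have := metric_ge0 mg q (u - (g q u w / g q w w) *: w).
rewrite !(metricDl mg, metricDr mg, metricNl mg, metricNr mg, metricZl mg, metricZr mg).
rewrite (metricC mg q w u); move: (g q u w) (g q u u) (g q w w) ww => a b c c0 H.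
have := mulr_ge0 H (ltW c0).
have -> : (b - a / c * a + (- (a / c * a) - a / c * - (a / c * c))) * c = b * c - a ^+ 2.
  by field; rewrite gt_eqF.
by rewrite subr_ge0.
Qed.

(** The hypothesis says that u - v is orthogonal to v, so the squared cosine is g(v, v) / g(u, u).
    This covers v = 0, where the quotient defining the cosine is 0 by convention. *)
Lemma sin_angle q u v : u != 0 -> g q u v = g q v v ->
  sin (angle (g q) u v) ^+ 2 * g q u u = g q u u - g q v v.
Proof.
move=> u0 uv; rewrite /angle uv.
have d0 : 0 < g q u u by exact: (metric_pos mg).
have pd : g q v v <= g q u u.
  have := metric_ge0 mg q (u - v).
  rewrite !(metricDl mg, metricDr mg, metricNl mg, metricNr mg) (metricC mg q v u) uv.
  by move: (g q u u) (g q v v) => a b; lra.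
have p0 := metric_ge0 mg q v.
move: (g q u u) (g q v v) d0 pd p0 => d p d0 pd p0.
pose x := p / (Num.sqrt d * Num.sqrt p).
have x2 : x ^+ 2 = p / d.
  rewrite /x expr_div_n exprMn !sqr_sqrtr // ?(ltW d0) //.
  have [->|pn0] := eqVneq p 0; first by rewrite expr0n /= !mul0r.
  by field; rewrite pn0 gt_eqF.
have x0 : 0 <= x by rewrite /x divr_ge0 // mulr_ge0 // sqrtr_ge0.
have x21 : x ^+ 2 <= 1 by rewrite x2 ler_pdivrMr // mul1r.
have x1 : x <= 1 by rewrite -(expr_le1 (n := 2)).
rewrite -/x sin_acos ?x1 ?andbT; last by apply: le_trans x0; rewrite lerN10.
rewrite sqr_sqrtr ?subr_ge0 // x2 mulrBl mul1r divfK //.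
by rewrite gt_eqF.
Qed.

Lemma diff_min (psi : R -> R) (J : set R) : open J -> J 0 ->
  (forall t, J t -> differentiable psi t) -> (forall t, J t -> psi 0 <= psi t) ->
  'd psi 0 1 = 0.
Proof.
move=> oJ J0 dpsi mpsi.
have nJ : \forall t \near (0 : R), J t by exact: open_nbhs_nbhs.
have [r r0 Hr] := near_norm2 nJ nJ.
have Jr t : t \in `]- r, r[ -> J t.
  by rewrite in_itv /= -ltr_norml => tr; have [] := Hr t; rewrite // sub0r normrN.
have rr : - r <= r by rewrite ge0_cp // ltW.
have z0 : (0 : R) \in `]- r, r[ by rewrite in_itv /= oppr_lt0 r0.
have := @derive1_at_min R psi (- r) r 0 rr _ z0 _.
move=> /(_ (fun t tr => (derivable1_diffP psi t).2 (dpsi t (Jr t tr)))).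
move=> /(_ (fun t tr => mpsi t (Jr t tr))) [dp E].
by rewrite -deriveE //; exact: dpsi.
Qed.

Lemma smooth_near_expR (h : R -> R) t : smooth_near t h ->
  smooth_near t (fun s => expR (h s)) /\
  'd (fun s => expR (h s)) t 1 = expR (h t) * 'd h t 1.
Proof.
move=> sh.
have sexp x : smooth_near x (@expR R).
  by exists setT; split=> // [|k]; [exact: openT | exact: Ck_expR openT].
split; first exact: (smooth_near_comp1 sh (sexp _)).
have dh := smooth_near_diff sh; have de := smooth_near_diff (sexp (h t)).
have Ee (w : R) : 'd (@expR R) (h t) w = w * expR (h t).
  have dx : derivable (@expR R) (h t) 1 by exact: derivable_expR.
  have E1 := congr1 (fun k : R -> R => k w) (deriv1E dx).
  apply: (etrans E1); rewrite derive1E.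
  by have -> := congr1 (fun k : R -> R => k (h t)) (derive_expR R).
have E := congr1 (fun k : R -> R => k 1) (diff_comp dh de).
apply: (etrans E); apply: (etrans (Ee _)).
by move: ('d h t 1) => a; rewrite mulrC.
Qed.

(* psi'(0) = 0 solved for r t + B, in the notation of [clairaut_identity]. *)
Lemma clairaut_algebra (c S d k r t Q B : R) : k != 0 -> t != 0 ->
  c * (2 * S * d + t * 0) + (-1) * ((k * r * t + k * Q) * (k * t)
    + k * t * (k * r * t + k * Q)) = 0 ->
  c * (t * d) = k ^+ 2 * (t * t) -> Q = S + B -> r * t + B = 0.
Proof.
move=> k0 t0 H1 H2 QE.
have H4 : c * d = k ^+ 2 * t by apply: (mulfI t0); rewrite mulrCA H2; ring.
have kt : k ^+ 2 * t != 0 by rewrite mulf_neq0 // expf_neq0.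
apply: (mulfI kt); rewrite mulr0.
have -> : k ^+ 2 * t * (r * t + B) = - (c * (2 * S * d + t * 0)
    + (-1) * ((k * r * t + k * Q) * (k * t) + k * t * (k * r * t + k * Q)))
    / 2 + S * (c * d - k ^+ 2 * t) by rewrite QE; field.
by rewrite H1 H4 subrr mulr0 oppr0 mul0r addr0.
Qed.

Lemma clairaut_derive (a b d k : R -> R) (c t a' b' d' k' : R) :
  smooth_near t a -> smooth_near t b -> smooth_near t d -> smooth_near t k ->
  'd a t 1 = a' -> 'd b t 1 = b' -> 'd d t 1 = d' -> 'd k t 1 = k' ->
  'd (fun s => c * (b s * d s) + (-1) * (k s * a s * (k s * a s))) t 1
  = c * (b' * d t + b t * d')
    + (-1) * ((k' * a t + k t * a') * (k t * a t) + k t * a t * (k' * a t + k t * a')).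
Proof.
move=> sa sb sd sk <- <- <- <-.
have ska := smooth_nearM sk sa; have sbd := smooth_nearM sb sd.
have skk := smooth_nearM ska ska.
have s1 := smooth_nearM (smooth_near_cst t c) sbd.
have s2 := smooth_nearM (smooth_near_cst t (-1 : R)) skk.
have dka := diffMv (1 : R) (smooth_near_diff sk) (smooth_near_diff sa).
apply: (etrans (diffDv (1 : R) (smooth_near_diff s1) (smooth_near_diff s2))).
congr (_ + _).
  apply: (etrans (diffZv c (1 : R) (smooth_near_diff sbd))); congr (_ * _).
  exact: diffMv (1 : R) (smooth_near_diff sb) (smooth_near_diff sd).
apply: (etrans (diffZv (-1) (1 : R) (smooth_near_diff skk))); congr (_ * _).
apply: (etrans (diffMv (1 : R) (smooth_near_diff ska) (smooth_near_diff ska))).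
by congr (_ * _ + _ * _).
Qed.

Variables (D : N -> {vspace 'rV[R]_n}) (f : N -> R).
Hypotheses (tD : tangent_distribution D) (sf : smooth_fun f).
Hypothesis cl : clairaut g nabla D (fun q => expR (f q)).

(* Along the geodesic issued from T + V, let psi be
   c^2 |E|^2 |b'|^2 - e^(2f) g(b', E)^2, where c is the Clairaut constant.  Since
   c^2 |b'|^2 = e^(2f) |p|^2 for the tangential part p of b', Cauchy-Schwarz gives
   psi >= 0, with equality at 0 where p = E = T; the identity is psi'(0) = 0. *)
Lemma clairaut_identity q T V E : vector_field E -> E q = T ->
  (forall y, E y \in D y) -> T != 0 -> orth (g q) [set` D q] V ->
  dfun f q (T + V) * g q T T + g q V (nabla q (T + V) E) = 0.
Proof.
move=> sE Eq ED T0 VD; set v := T + V.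
have TD : T \in D q by rewrite -Eq.
have [J [beta [x [e [J0 b0 v0 geo [cxb cd0]]]]]] := geodesic_exists lc q v.
have [oJ _ sb _] := geo.
pose vel := velocity beta.
have [_ clb] := cl.
have [|c Hc] := clb J beta (fun t => vel t - proj g (D (beta t)) (beta t) (vel t)) geo.
  move=> t Jt; split=> [u /= uD|/=]; first exact: proj_orth.
  by rewrite opprB addrC subrK; have [] := projP mg (D (beta t)) (beta t) (vel t).
have svel := velocity_smooth oJ sb.
have sEb : smooth_along_curve J beta (E \o beta).
  have := smooth_along_curve_field oJ sb (h := fun=> 1) _ sE.
  have -> : (fun t => 1 *: E (beta t)) = E \o beta.
    by apply/funext => t; rewrite scale1r.
  by apply=> t _; exact: smooth_near_cst.
pose a t := g (beta t) (vel t) (E (beta t)).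
pose b t := g (beta t) (E (beta t)) (E (beta t)).
pose d t := g (beta t) (vel t) (vel t).
pose k t := expR (f (beta t)).
have Ha t : J t -> smooth_near t a /\ 'd a t 1 = g (beta t) (vel t) (nabla (beta t) (vel t) E).
  move=> Jt; have [sa ->] := metric_curve oJ sb mg lc cxb Jt svel sEb.
  split=> //; rewrite cd0 // (metric0l mg) add0r; congr (g _ _ _).
  exact: (covariant_derivative_compose oJ sb lc cxb Jt sE).
have Hd t : J t -> smooth_near t d /\ 'd d t 1 = 0.
  move=> Jt; have [sd ->] := metric_curve oJ sb mg lc cxb Jt svel svel.
  by split=> //; rewrite cd0 // (metric0l mg) (metric0r mg) addr0.
have Hb t : J t -> smooth_near t b /\
    'd b t 1 = 2 * g (beta t) (nabla (beta t) (vel t) E) (E (beta t)).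
  move=> Jt; have sg := smooth_fun_at (beta t) (metric_smooth mg sE sE).
  have [sgb ->] := curve_comp oJ sb Jt sg.
  by split=> //; rewrite (levi_civita_metric lc) // (metricC mg _ (E _)) mulr_natl mulr2n.
have Hk t : J t -> smooth_near t k /\ 'd k t 1 = k t * dfun f (beta t) (vel t).
  move=> Jt; have [sfb <-] := curve_comp oJ sb Jt (smooth_fun_at (beta t) sf).
  exact: smooth_near_expR.
pose p t := proj g (D (beta t)) (beta t) (vel t).
have cE t : J t -> vel t != 0 ->
    c ^+ 2 * (b t * d t) = k t ^+ 2 * (g (beta t) (p t) (p t) * b t).
  move=> Jt un0; have [pD Hp] := projP mg (D (beta t)) (beta t) (vel t).
  rewrite -/(p t) in pD Hp.
  have uv : g (beta t) (vel t) (vel t - p t) = g (beta t) (vel t - p t) (vel t - p t).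
    have : g (beta t) (vel t - p t) (p t) = 0 by exact: proj_orth.
    rewrite !(metricDl mg, metricDr mg, metricNl mg, metricNr mg) (metricC mg _ (p t) (vel t)).
    by move: (g _ (vel t) (vel t)) (g _ (vel t) (p t)) (g _ (p t) (p t)) => ? ? ? H; lra.
  have pp : g (beta t) (vel t) (p t) = g (beta t) (p t) (p t) by rewrite Hp.
  have := sin_angle un0 uv; rewrite -/(d t) => Hs.
  have Hpp : d t - g (beta t) (vel t - p t) (vel t - p t) = g (beta t) (p t) (p t).
    by rewrite -uv (metricDr mg) (metricNr mg) -/(d t) pp; lra.
  rewrite -Hpp -Hs -(Hc t Jt) -/(k t) -/(p t).
  by move: (sin _) (d t) (b t) (k t) => ? ? ? ?; ring.
pose psi t := c ^+ 2 * (b t * d t) + (-1) * ((k t * a t) * (k t * a t)).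
have psi_ge0 t : J t -> 0 <= psi t.
  move=> Jt; rewrite /psi mulN1r subr_ge0.
  (* At a zero of the velocity the angle carries no information, but both terms of psi vanish. *)
  have [u0|un0] := eqVneq (vel t) 0.
    by rewrite /a /d u0 !(metric0l mg) !mulr0.
  rewrite (cE t Jt un0) mulrACA -!expr2 ler_wpM2l ?sqr_ge0 //.
  have [_ Hp] := projP mg (D (beta t)) (beta t) (vel t).
  have -> : a t = g (beta t) (p t) (E (beta t)) by rewrite /a Hp.
  exact: metric_cauchy.
have vTq : vel 0 = v by [].
have p0 : p 0 = T.
  rewrite /p vTq b0; apply: (proj_unique mg) => // u uD.
  by rewrite (metricDl mg) (VD u uD) addr0.
pose tau := g q T T.
have tau0 : 0 < tau by exact: (metric_pos mg).
have a0 : a 0 = tau by rewrite /a vTq b0 Eq (metricDl mg) (VD T TD) addr0.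
have bE : b 0 = tau by rewrite /b b0 Eq.
(* g(T + V, T) = g(T, T) > 0, so the squared Clairaut relation is available at time 0. *)
have v0' : vel 0 != 0.
  rewrite vTq; apply/eqP => v00.
  have : g q v T = 0 by rewrite v00 (metric0l mg).
  by rewrite (metricDl mg) (VD T TD) addr0 => H; move: tau0; rewrite /tau H ltxx.
have cE0 : c ^+ 2 * (tau * d 0) = k 0 ^+ 2 * (tau * tau).
  by have := cE 0 J0 v0'; rewrite bE p0 b0.
have psi0 : psi 0 = 0 by rewrite /psi bE cE0 a0; ring.
have [sa da] := Ha 0 J0; have [sd' dd] := Hd 0 J0.
have [sb' db] := Hb 0 J0; have [sk dk] := Hk 0 J0.
have spsi t : J t -> smooth_near t psi.
  move=> Jt; have [sat _] := Ha t Jt; have [sdt _] := Hd t Jt.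
  have [sbt _] := Hb t Jt; have [skt _] := Hk t Jt.
  apply: smooth_nearD; apply: smooth_nearM; try exact: smooth_near_cst.
    exact: smooth_nearM.
  by apply: smooth_nearM; exact: smooth_nearM.
have dpsi0 : 'd psi 0 1 = 0.
  apply: (diff_min oJ J0) => t Jt; first exact/smooth_near_diff/spsi.
  by rewrite psi0; exact: psi_ge0.
pose S := g q (nabla q v E) T; pose Q := g q v (nabla q v E); pose r := dfun f q v.
have db' : 'd b 0 1 = 2 * S by rewrite db vTq b0 Eq.
have da' : 'd a 0 1 = Q by rewrite da vTq b0.
have dk' : 'd k 0 1 = k 0 * r by rewrite dk vTq b0.
have dps : c ^+ 2 * (2 * S * d 0 + b 0 * 0)
    + (-1) * ((k 0 * r * a 0 + k 0 * Q) * (k 0 * a 0) + k 0 * a 0 * (k 0 * r * a 0 + k 0 * Q)) = 0.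
  apply: (etrans (esym _) dpsi0).
  exact: (clairaut_derive _ sa sb' sd' sk da' db' dd dk').
have QE : Q = S + g q V (nabla q v E).
  by rewrite /Q /S {1}/v (metricDl mg) (metricC mg q T).
rewrite -/r -/tau.
have K0 : 0 < k 0 by exact: expR_gt0.
move: dps; rewrite bE a0 => dps.
exact: (clairaut_algebra (lt0r_neq0 K0) (lt0r_neq0 tau0) dps cE0 QE).
Qed.

Lemma clairaut_gradient q T : T \in D q -> dfun f q T = 0.
Proof.
move=> TD; have [->|T0] := eqVneq T 0; first by rewrite dfun0r.
have [E [sE Eq ED]] := tangent_extend mg tD TD.
have oz : orth (g q) [set` D q] 0 by move=> u _; rewrite (metric0l mg).
have := clairaut_identity sE Eq ED T0 oz; rewrite (metric0l mg) !addr0 => /eqP.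
by rewrite mulf_eq0 (gt_eqF (metric_pos mg q T0)) orbF => /eqP.
Qed.

Hypothesis tg : totally_geodesic_distribution nabla (fun q => orth (g q) [set` D q]).

(** In [clairaut_identity] with V = W q the factor df(T + V) is df(W q), as df vanishes on T.
    Differentiating g(E, W) = 0 moves the derivative from E to W, and nabla_W W drops out because it
    is normal. *)
Lemma clairaut_second_form q T W : T \in D q ->
  section (fun q => orth (g q) [set` D q]) W ->
  g q T (nabla q T W) = dfun f q (W q) * g q T T.
Proof.
move=> TD [sW WD]; have [->|T0] := eqVneq T 0.
  by rewrite !(metric0l mg) mulr0.
have [E [sE Eq ED]] := tangent_extend mg tD TD.
have := clairaut_identity sE Eq ED T0 (WD q).
rewrite dfunDr clairaut_gradient // add0r => H.
have E0 : forall y, g y (E y) (W y) = 0.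
  by move=> y; rewrite (metricC mg); apply: WD; exact: ED.
have := levi_civita_metric lc q (T + W q) sE sW.
rewrite (@dfun_near_cst _ _ _ _ _ 0); last by apply: nearW.
rewrite Eq (metricC mg q (nabla q _ E)).
rewrite [X in g q T X](connectionDu cN) // (metricDr mg).
have WW : g q T (nabla q (W q) W) = 0.
  have WDq : orth (g q) [set` D q] (nabla q (W q) W) by apply: tg.
  by rewrite (metricC mg); exact: WDq.
rewrite WW addr0; move: (g q T _) (g q (W q) _) (dfun _ _ _ * _) H => *; lra.
Qed.

End Clairaut.

(** The linear algebra of [key_identity]: DY, DZ, DW stand for the derivatives along F of F_*Y, F_*Z
    and omega F_*Y, and G for grad f. The conclusion is J applied to the last hypothesis. *)
Lemma complex_structure_cancel (R : realType) n (J : 'End('rV[R]_n))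
    (a b nu DZ DY DW G X : 'rV[R]_n) (k1 k2 k3 : R) :
  (forall v, J (J v) = - v) -> DZ = a - k1 *: G -> DY = b - k2 *: G ->
  DW = nu + k3 *: X -> DZ + DW = J DY ->
  J a + J nu + b = k1 *: J G + k2 *: G - k3 *: J X.
Proof.
move=> JJ EZ EY EW ED.
have : J (DZ + DW) = - DY by rewrite ED JJ.
rewrite EZ EY EW !(linearD, linearN, linearZ) /=.
move: (J a) (J nu) (J G) (J X) => a' nu' G' X' /rowP H; apply/rowP => i.
by have := H i; rewrite !mxE; lra.
Qed.

Lemma swap_sub (V : zmodType) (a b c d : V) : a - b = c - d -> a - c = b - d.
Proof. by move=> H; rewrite -[a](subrK b) H addrAC (addrAC c) subrr add0r addrC. Qed.

(** * Clairaut semi-invariant Riemannian maps *)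

Section SemiInvariant.
Context {R : realType} {m n : nat} {M : manifold R m} {N : manifold R n}.
Variables (gM : M -> 'rV[R]_m -> 'rV[R]_m -> R) (gN : N -> 'rV[R]_n -> 'rV[R]_n -> R).
Variables (nablaM : M -> 'rV[R]_m -> (M -> 'rV[R]_m) -> 'rV[R]_m).
Variables (nablaN : N -> 'rV[R]_n -> (N -> 'rV[R]_n) -> 'rV[R]_n).
Variables (P : N -> 'End('rV[R]_n)) (F : M -> N).
Variables (nablaF nablaFperp : M -> 'rV[R]_m -> (M -> 'rV[R]_n) -> 'rV[R]_n).
Variable rangeF : N -> {vspace 'rV[R]_n}.
Variables (D1 D2 : M -> {vspace 'rV[R]_n}).
Variables (phi omega B C : M -> 'rV[R]_n -> 'rV[R]_n).
Variables (f : N -> R) (gradf : N -> 'rV[R]_n).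
Hypotheses (mM : riemannian_metric gM) (lcM : levi_civita gM nablaM).
Hypotheses (mN : riemannian_metric gN) (lcN : levi_civita gN nablaN).
Hypothesis kP : kahler gN nablaN P.
Hypothesis rF : riemannian_map gM gN F.
Hypothesis pc : pullback_connection F nablaN nablaF.
Hypothesis nc : normal_connection gN F nablaF nablaFperp.
Hypothesis rD : range_distribution F rangeF.
Hypothesis si : semi_invariant gN P F D1 D2.
Hypothesis po : phi_omega_decomposition P F D1 D2 phi omega.
Hypothesis bc : BC_decomposition gN P F D2 B C.
Hypotheses (sf : smooth_fun f) (gf : gradient gN f gradf).
Hypothesis cl : clairaut gN nablaN rangeF (fun q => expR (f q)).
Hypothesis tg : totally_geodesic_distribution nablaN
  (fun q => orth (gN q) [set` rangeF q]).
Hypothesis dD2 : forall p, (1 < \dim (D2 p))%N.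
Implicit Types (p : M) (X Y Z : M -> 'rV[R]_m) (u v : 'rV[R]_m) (w T V : 'rV[R]_n).

Let sF : smooth_map F. Proof. by case: rF. Qed.
Let tD : tangent_distribution rangeF. Proof. by case: rD. Qed.
Let rE p : rangeF (F p) = limg (tmap F p). Proof. by case: rD => _; exact. Qed.
Let cM := levi_civita_connection lcM.
Let cN := levi_civita_connection lcN.
Let cF := pullback_is_connection pc.
Let idM := smooth_map_id M.

Let ranFE p w : ranF F p w <-> w \in rangeF (F p).
Proof. by rewrite rE. Qed.

Let ran_tmap p u : ranF F p (tmap F p u).
Proof. by rewrite /ranF /= memv_img ?memvf. Qed.

Let perpE p V : ranF_perp gN F p V <-> orth (gN (F p)) [set` rangeF (F p)] V.
Proof.
by split=> H w /= wr; apply: H; [apply/ranFE | rewrite /= -ranFE].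
Qed.

Let perp0 p V u : ranF_perp gN F p V -> gN (F p) V (tmap F p u) = 0.
Proof. by move=> H; apply: H; exact: ran_tmap. Qed.

Let gradf_normal p : ranF_perp gN F p (gradf (F p)).
Proof.
move=> w /ranFE wr; rewrite gf.
exact: (clairaut_gradient mN lcN tD sf cl wr).
Qed.

Let range_extend p T : ranF F p T -> exists X,
  section (kerF_perp gM F) X /\ tmap F p (X p) = T.
Proof.
move=> Tr; have [E [sE Eq ED]] := tangent_extend mN tD ((ranFE p T).1 Tr).
exists (fun x => adjoint gM gN F x (E (F x))); split.
  exact: (adjoint_section mM mN sF (smooth_along_compose sF sE)).
by rewrite Eq (tmap_adjoint_range mM mN sF rF).
Qed.

Let tangent_normal_split p w : exists t V,
  [/\ ranF F p t, ranF_perp gN F p V & w = t + V].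
Proof.
have [pD _] := projP mN (rangeF (F p)) (F p) w.
exists (proj gN (rangeF (F p)) (F p) w), (w - proj gN (rangeF (F p)) (F p) w).
split; [exact/ranFE | apply/perpE => u /= uD; exact: proj_orth | by rewrite addrC subrK].
Qed.

(** Differentiating g(W, V o F) = 0 moves the derivative from a tangent field along F to a normal
    field on N. *)
Let pullback_normal p u (W : M -> 'rV[R]_n) (V : N -> 'rV[R]_n) : smooth_along F W -> (forall x, ranF F x (W x)) ->
  section (fun q => orth (gN q) [set` rangeF q]) V ->
  gN (F p) (nablaF p u W) (V (F p)) = - gN (F p) (W p) (nablaN (F p) (tmap F p u) V).
Proof.
move=> sW Wr [sV VD].
have := pullback_metric sF mN lcN pc p u sW (smooth_along_compose sF sV).
rewrite (@dfun_near_cst _ _ _ _ _ 0); last first.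
  by apply: nearW => x; rewrite (metricC mN) /=; apply: VD; apply/ranFE.
rewrite (pullback_compose pc) // => /esym/eqP; rewrite addr_eq0 => /eqP.
exact.
Qed.

(** [clairaut_second_form] gives the diagonal T = T'. For symmetry, T and T' are extended to images
    of horizontal fields: the torsion identity equates the difference of their derivatives with a
    tangent vector, which is orthogonal to V. Polarization concludes. *)
Let second_form p T T' (V : N -> 'rV[R]_n) : ranF F p T -> ranF F p T' ->
  section (fun q => orth (gN q) [set` rangeF q]) V ->
  gN (F p) T' (nablaN (F p) T V) = dfun f (F p) (V (F p)) * gN (F p) T T'.
Proof.
move=> Tr Tr' VD; have sV := VD.1.
have sym : gN (F p) T' (nablaN (F p) T V) = gN (F p) T (nablaN (F p) T' V).
  have [X [[sX _] XT]] := range_extend Tr; have [Y [[sY _] YT]] := range_extend Tr'.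
  have tX := smooth_along_tmap sF sX; have tY := smooth_along_tmap sF sY.
  have H1 := pullback_normal p (X p) tY (fun x => ran_tmap x (Y x)) VD.
  have H2 := pullback_normal p (Y p) tX (fun x => ran_tmap x (X x)) VD.
  have := pullback_torsion sF lcN pc p lcM sX sY.
  move=> /(congr1 (fun w => gN (F p) w (V (F p)))).
  rewrite (metricDl mN) (metricNl mN) H1 H2 XT YT (metricC mN _ (tmap _ _ _)).
  rewrite (perp0 _ ((perpE p _).2 (VD.2 (F p)))).
  by move: (gN _ _ _) (gN _ _ _) => a b; lra.
have TD := (ranFE p T).1 Tr; have TD' := (ranFE p T').1 Tr'.
have sfm U := clairaut_second_form mN lcN tD sf cl tg (q := F p) (T := U) (W := V) ^~ VD.
have H1 := sfm _ TD; have H2 := sfm _ TD'; have H3 := sfm _ (rpredD TD TD').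
move: H3; rewrite (connectionDu cN _ _ _ sV).
rewrite !(metricDl mN, metricDr mN) sym H1 H2 (metricC mN _ T' T).
move: (gN _ T (nablaN _ T' V)) (gN _ T T) (gN _ T' T') (gN _ T T') (dfun _ _ _).
by move=> a b c d e H; have : a = e * d by nra.
Qed.

Let pullback_second_form p u (W : M -> 'rV[R]_n) V : smooth_along F W -> (forall x, ranF F x (W x)) ->
  ranF_perp gN F p V ->
  gN (F p) (nablaF p u W) V = - (dfun f (F p) V * gN (F p) (tmap F p u) (W p)).
Proof.
move=> sW Wr /perpE Vn; have [E ED <-] := normal_extend mN tD Vn.
by rewrite (pullback_normal p u sW Wr ED) (second_form (ran_tmap p u) (Wr p) ED).
Qed.

(** W need not be induced by a normal field on N, so T is extended instead, and the derivative is
    moved onto that tangent field; there only the value of W at p matters. *)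
Let normal_derivative p u (W : M -> 'rV[R]_n) T : smooth_along F W ->
  (forall x, ranF_perp gN F x (W x)) -> ranF F p T ->
  gN (F p) (nablaF p u W) T = dfun f (F p) (W p) * gN (F p) (tmap F p u) T.
Proof.
move=> sW Wn Tr; have [X [[sX _] XT]] := range_extend Tr.
have tX := smooth_along_tmap sF sX.
have := pullback_metric sF mN lcN pc p u sW tX.
rewrite (@dfun_near_cst _ _ _ _ _ 0); last by apply: nearW => x; exact: perp0.
rewrite (metricC mN _ (W p)) (pullback_second_form u tX (fun x => ran_tmap x (X x)) (Wn p)) XT.
by move: (gN _ _ T) (_ * _) => a b; lra.
Qed.

Let horizontal X := section (kerF_perp gM F) X.

(* The difference of the two sides is symmetric in X, Y since both connections
   are torsion-free, and skew in Y, Z since F_* is isometric on horizontal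
   fields; hence it vanishes. *)
Let tangential_part p X Y Z : horizontal X -> horizontal Y -> horizontal Z ->
  gN (F p) (nablaF p (X p) (fun x => tmap F x (Y x))) (tmap F p (Z p))
  = gM p (nablaM p (X p) Y) (Z p).
Proof.
pose A X Y Z := gN (F p) (nablaF p (X p) (fun x => tmap F x (Y x))) (tmap F p (Z p))
  - gM p (nablaM p (X p) Y) (Z p).
have skew X' Y' Z' : horizontal X' -> horizontal Y' -> horizontal Z' ->
    A X' Y' Z' = - A X' Z' Y'.
  move=> [sX hX] [sY hY] [sZ hZ].
  have := pullback_metric sF mN lcN pc p (X' p) (smooth_along_tmap sF sY) (smooth_along_tmap sF sZ).
  have -> : (fun x => gN (F x) (tmap F x (Y' x)) (tmap F x (Z' x))) = (fun x => gM x (Y' x) (Z' x)).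
    by apply/funext => x; rewrite (metric_tmap mM mN sF rF).
  rewrite (levi_civita_metric lcM) // /A (metricC mM _ (Y' p)) (metricC mN _ (tmap F p (Y' p))).
  by move: (gM _ _ _) (gM _ _ _) (gN _ _ _) (gN _ _ _) => a b c d; lra.
have sym X' Y' Z' : horizontal X' -> horizontal Y' -> horizontal Z' ->
    A X' Y' Z' = A Y' X' Z'.
  move=> [sX hX] [sY hY] [sZ hZ].
  have := pullback_torsion sF lcN pc p lcM sX sY.
  move=> /(congr1 (fun w => gN (F p) w (tmap F p (Z' p)))).
  rewrite (metricC mN _ (tmap F p (_ - _))) (metric_tmap mM mN sF rF) //.
  rewrite !(metricDl mN, metricNl mN, metricDr mM, metricNr mM) !(metricC mM _ (Z' p)) /A.
  by move: (gM _ _ _) (gM _ _ _) (gN _ _ _) (gN _ _ _) => a b c d; lra.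
move=> hX hY hZ; apply/eqP; rewrite -subr_eq0 -/(A X Y Z); apply/eqP.
have h1 := skew _ _ _ hX hY hZ; have h2 := sym _ _ _ hX hZ hY.
have h3 := skew _ _ _ hZ hX hY; have h4 := sym _ _ _ hZ hY hX.
have h5 := skew _ _ _ hY hZ hX; have h6 := sym _ _ _ hY hX hZ.
lra.
Qed.

(** Tangent test vectors see only the isometry on horizontal fields, normal ones only the Clairaut
    condition. *)
Let pullback_horizontal p X Y : horizontal X -> horizontal Y ->
  nablaF p (X p) (fun x => tmap F x (Y x))
  = tmap F p (nablaM p (X p) Y) - gM p (X p) (Y p) *: gradf (F p).
Proof.
move=> hX hY; have [sX X0] := hX; have [sY Y0] := hY.
apply: (metric_inj mN (q := F p)) => w.
have [t [V [tr Vn ->]]] := tangent_normal_split p w.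
rewrite !(metricDr mN) !(metricDl mN) !(metricNl mN) !(metricZl mN).
rewrite (gradf_normal tr) mulr0 subr0; congr (_ + _).
  have [Z [hZ <-]] := range_extend tr.
  have H := metric_tmap mM mN sF rF (nablaM p (X p) Y) (hZ.2 p).
  apply: (etrans (tangential_part p hX hY hZ)); rewrite (metricC mM) -H.
  exact: metricC.
rewrite (pullback_second_form (X p) (smooth_along_tmap sF sY) (fun x => ran_tmap x (Y x)) Vn).
rewrite (metric_tmap mM mN sF rF) // gf (metricC mN _ (tmap _ _ _)) (perp0 _ Vn) sub0r.
by rewrite mulrC.
Qed.

Let adjoint_normal p V : ranF_perp gN F p V -> adjoint gM gN F p V = 0.
Proof.
move=> Vn; apply: (metric_inj mM (q := p)) => u.
by rewrite (adjointP F mM mN) (perp0 _ Vn) (metric0l mM).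
Qed.

Let adjointD p w w' :
  adjoint gM gN F p (w + w') = adjoint gM gN F p w + adjoint gM gN F p w'.
Proof.
apply: (metric_inj mM (q := p)) => u.
by rewrite (metricDl mM) !(adjointP F mM mN) (metricDl mN).
Qed.

Let omega_normal p w : ranF F p w -> ranF_perp gN F p (omega p w).
Proof.
move=> /po[_ /memv_imgP[v vD ->] _]; exact: (semi_invariant_PD2 si).
Qed.

Let phi_range p w : ranF F p w -> ranF F p (phi p w).
Proof.
move=> /po[wD _ _]; rewrite /ranF /= (semi_invariant_sum si).
exact: subvP (addvSl _ _) _ wD.
Qed.

(** The adjoint kills omega w, which is normal. Hence the horizontal lift of phi F_*Y is the adjoint
    of P F_*Y, a field whose smoothness does not rest on phi. *)
Let phi_lift p w : ranF F p w ->
  tmap F p (adjoint gM gN F p (P (F p) w)) = phi p w.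
Proof.
move=> wr; have [_ _ ->] := po wr.
rewrite adjointD (adjoint_normal (omega_normal wr)) addr0.
exact: (tmap_adjoint_range mM mN sF rF (phi_range wr)).
Qed.

(** grad f is orthogonal to the tangent vector phi T, so omega T may be replaced by P T, and the
    isometry P moves over to grad f. *)
Let gradf_range p T : ranF F p T -> gN (F p) (gradf (F p)) (omega p T) = - gN (F p) (P (F p) (gradf (F p))) T.
Proof.
move=> Tr; have [_ _ PT] := po Tr.
have -> : omega p T = P (F p) T - phi p T by rewrite PT addrC addKr.
rewrite (metricDr mN) (metricNr mN) (gradf_normal (phi_range Tr)) subr0.
rewrite -(kahler_isometry kP) (kahler_square kP) (metricNr mN).
by [].
Qed.

(* P (nabla^F_X F_*Y) = nabla^F_X F_*Z + nabla^F_X omega F_*Y, where the three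
   derivatives are given by [pullback_horizontal] and by the normal component of
   the last one, whose tangential part is [normal_derivative]. *)
Let key_identity p X Y Z : horizontal X -> horizontal Y -> horizontal Z ->
  (forall x, tmap F x (Z x) = phi x (tmap F x (Y x))) ->
  phi p (tmap F p (nablaM p (X p) Z))
  + omega p (tmap F p (nablaM p (X p) Z))
  + B p (nablaFperp p (X p) (fun x => omega x (tmap F x (Y x))))
  + C p (nablaFperp p (X p) (fun x => omega x (tmap F x (Y x))))
  + tmap F p (nablaM p (X p) Y)
  = gM p (X p) (Z p) *: P (F p) (gradf (F p)) + gM p (X p) (Y p) *: gradf (F p)
    - gN (F p) (gradf (F p)) (omega p (tmap F p (Y p))) *: P (F p) (tmap F p (X p)).
Proof.
move=> hX hY hZ ZY; have [sX X0] := hX; have [sY Y0] := hY; have [sZ Z0] := hZ.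
pose W x := omega x (tmap F x (Y x)).
have tY := smooth_along_tmap sF sY; have tZ := smooth_along_tmap sF sZ.
have tPY := smooth_along_kahler sF kP tY.
(* omega is only a pointwise decomposition; W inherits its smoothness from P and Z. *)
have WE x : W x = P (F x) (tmap F x (Y x)) - tmap F x (Z x).
  by have [_ _ ->] := po (ran_tmap x (Y x)); rewrite ZY addrC addKr.
have sW : smooth_along F W.
  have -> : W = (fun x => P (F x) (tmap F x (Y x)) + - tmap F x (Z x)) by apply/funext.
  exact: (smooth_alongD sF tPY (smooth_alongN sF tZ)).
have Wn x : ranF_perp gN F x (W x) by exact: omega_normal.
have [nun nur] := nc p (X p) (conj sW Wn).
set nu := nablaFperp p (X p) W in nun nur *.
have DW : nablaF p (X p) W = nu + gN (F p) (gradf (F p)) (W p) *: tmap F p (X p).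
  (* The difference of the two sides is tangent and orthogonal to every tangent vector. *)
  apply/eqP; rewrite -subr_eq0 opprD addrA; apply/eqP.
  have dr : ranF F p (nablaF p (X p) W - nu - gN (F p) (gradf (F p)) (W p) *: tmap F p (X p)).
    by rewrite /ranF /= rpredB // rpredZ //; exact: ran_tmap.
  have dE s : ranF F p s -> gN (F p)
      (nablaF p (X p) W - nu - gN (F p) (gradf (F p)) (W p) *: tmap F p (X p)) s = 0.
    move=> sr; rewrite !(metricDl mN) !(metricNl mN) (nun _ sr) (metricZl mN).
    by rewrite (normal_derivative (X p) sW Wn sr) gf subr0 subrr.
  exact: (metric_eq0 mN (dE _ dr)).
have [_ _ <-] := po (ran_tmap p (nablaM p (X p) Z)).
have [_ _ PC] := bc nun; rewrite -[X in X + _]addrA -PC.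
have EZ := pullback_horizontal p hX hZ; have EY := pullback_horizontal p hX hY.
have ZW : nablaF p (X p) (fun x => tmap F x (Z x)) + nablaF p (X p) W
    = P (F p) (nablaF p (X p) (fun x => tmap F x (Y x))).
  rewrite -(pullback_kahler sF pc kP) // -(connection_additive cF _ _ tZ sW).
  by congr (nablaF p (X p) _); apply/funext => x; rewrite WE addrC subrK.
exact: (complex_structure_cancel (kahler_square kP (F p)) EZ EY DW ZW).
Qed.

Let kerE p u : kerF F p u <-> tmap F p u = 0.
Proof. by split; rewrite /kerF /= memv_ker => /eqP. Qed.

Let hor Y x := adjoint gM gN F x (tmap F x (Y x)).

Let hor_section Y : vector_field Y -> horizontal (hor Y).
Proof. by move=> sY; exact: (adjoint_section mM mN sF (smooth_along_tmap sF sY)). Qed.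

Let tmap_hor Y p : tmap F p (hor Y p) = tmap F p (Y p).
Proof. exact: (tmap_adjoint mM mN sF rF p (Y p)). Qed.

Let ver_section Y : vector_field Y -> section (kerF F) (fun x => Y x + - hor Y x).
Proof.
move=> sY; split.
  exact: (smooth_alongD idM sY (smooth_alongN idM (hor_section sY).1)).
by move=> p; apply/kerE; rewrite linearB /= tmap_hor subrr.
Qed.

Let gradf_eq0 p T X : horizontal X -> tmap F p (X p) = T -> T != 0 ->
  gM p (X p) (X p) *: gradf (F p) = 0 -> gradf (F p) = 0.
Proof.
move=> hX XT T0 /eqP; rewrite scaler_eq0 => /orP[/eqP XX|/eqP//].
by move: T0; rewrite -XT (metric_eq0 mM XX) linear0 eqxx.
Qed.

(** The rank is positive, so some horizontal X has F_*X nonzero at p, and the second fundamental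
    form on (X, X) is - g(X, X) grad f. *)
Let totally_geodesic_gradf p : totally_geodesic_map F nablaM nablaF ->
  gradf (F p) = 0.
Proof.
move=> tgF; have [_ dF _] := rF; have /andP[d0 _] := dF p.
have T0 : vpick (limg (tmap F p)) != 0 by rewrite vpick0 -dimv_eq0 -lt0n.
have [X [hX XT]] := range_extend (memv_pick (limg (tmap F p))).
apply: (gradf_eq0 hX XT T0).
have E := pullback_horizontal p hX hX; have := tgF X X hX.1 hX.1 p.
rewrite E; move: (tmap F p _) (_ *: _) => a b /eqP.
by rewrite addrAC subrr add0r oppr_eq0 => /eqP.
Qed.

Let totally_geodesic_ker X Y p : totally_geodesic_map F nablaM nablaF ->
  vector_field X -> section (kerF F) Y -> kerF F p (nablaM p (X p) Y).
Proof.
move=> tgF sX [sY Y0]; apply/kerE; have := tgF X Y sX sY p.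
have -> : (fun x => tmap F x (Y x)) = (fun=> 0).
  by apply/funext => x; apply/kerE.
by rewrite (connection0 sF cF) sub0r => /eqP; rewrite oppr_eq0 => /eqP.
Qed.

Let horizontal_vertical X Y U p : horizontal Y -> section (kerF F) U ->
  gM p (nablaM p (X p) Y) (U p) = - gM p (Y p) (nablaM p (X p) U).
Proof.
move=> [sY Y0] [sU U0]; apply/eqP; rewrite -addr_eq0; apply/eqP.
apply: (etrans (esym (levi_civita_metric lcM p (X p) sY sU))).
apply: (@dfun_near_cst _ _ _ _ _ 0).
by apply: nearW => x; exact: Y0.
Qed.

(** The vertical part U of nabla_X Y satisfies g(U, U) = g(nabla_X Y, U) = - g(Y, nabla_X U), and
    nabla_X U is vertical by [totally_geodesic_ker]. *)
Let totally_geodesic_horizontal : totally_geodesic_map F nablaM nablaF ->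
  totally_geodesic_distribution nablaM (kerF_perp gM F).
Proof.
move=> tgF X Y hX hY p.
pose Q x := nablaM x (X x) Y.
have sQ : vector_field Q by exact: (connection_smooth cM hX.1 hY.1).
have vQ := ver_section sQ.
have := horizontal_vertical X p hY vQ.
rewrite (hY.2 p _ (totally_geodesic_ker p tgF hX.1 vQ)) oppr0 => QU.
have U0 : Q p + - hor Q p = 0.
  apply: (metric_eq0 mM (q := p)).
  by rewrite (metricDl mM) QU (metricNl mM) ((hor_section sQ).2 p _ (vQ.2 p)) oppr0 addr0.
have -> : nablaM p (X p) Y = hor Q p by exact: subr0_eq U0.
exact: (hor_section sQ).2.
Qed.

Let equation_iii p X Y Z :=
  gM p (X p) (Z p) *: (B p (gradf (F p)) + C p (gradf (F p)))
  = phi p (tmap F p (nablaM p (X p) Z))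
    + omega p (tmap F p (nablaM p (X p) Z))
    + B p (nablaFperp p (X p) (fun x => omega x (tmap F x (Y x))))
    + C p (nablaFperp p (X p) (fun x => omega x (tmap F x (Y x))))
    + tmap F p (nablaM p (X p) Y).

Let totally_geodesic_equation : totally_geodesic_map F nablaM nablaF ->
  forall X Y Z, horizontal X -> horizontal Y -> horizontal Z ->
  (forall p, tmap F p (Z p) = phi p (tmap F p (Y p))) ->
  forall p, equation_iii p X Y Z.
Proof.
move=> tgF X Y Z hX hY hZ ZY p; apply: (etrans _ (esym (key_identity p hX hY hZ ZY))).
have [_ _ PG] := bc (@gradf_normal p).
apply: (etrans (congr1 (fun w => _ *: w) (esym PG))).
rewrite (totally_geodesic_gradf p tgF) linear0 (metric0l mN) !scaler0 scale0r.
by rewrite subr0 addr0.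
Qed.

(** * From (i), (ii), (iii) to total geodesicity *)

Section Converse.
Hypothesis tgk : totally_geodesic_distribution nablaM (kerF F).
Hypothesis tgh : totally_geodesic_distribution nablaM (kerF_perp gM F).
Hypothesis eqn : forall X Y Z, horizontal X -> horizontal Y -> horizontal Z ->
  (forall p, tmap F p (Z p) = phi p (tmap F p (Y p))) ->
  forall p, equation_iii p X Y Z.

(* This is where dim D2 > 1 is used. *)
Let orthogonal_range_vector p : exists T, [/\ ranF F p T, T != 0 &
  gN (F p) (P (F p) (gradf (F p))) T = 0].
Proof.
set a := P (F p) (gradf (F p)).
have [aD _] := projP mN (D2 p) (F p) a; set b := proj gN (D2 p) (F p) a in aD.
have D2r T : T \in D2 p -> ranF F p T.
  by rewrite /ranF /= (semi_invariant_sum si); exact: (subvP (addvSr _ _)).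
have ab T : T \in D2 p -> gN (F p) a T = gN (F p) b T.
  move=> TD; have := proj_orth mN (F p) a TD; rewrite -/b.
  by rewrite (metricDl mN) (metricNl mN) => /subr0_eq.
have /subvPn[T TD Tb] : ~~ (D2 p <= <[b]>)%VS.
  apply: contraL (dD2 p) => /dimvS; rewrite dim_vline -leqNgt => /leq_trans; apply.
  exact: leq_b1.
(* Gram-Schmidt against b, the D2-component of P grad f. The result is nonzero as T is not a
   multiple of b; for b = 0 it is T itself. *)
exists (T - (gN (F p) T b / gN (F p) b b) *: b).
have nD : T - (gN (F p) T b / gN (F p) b b) *: b \in D2 p by rewrite rpredB // rpredZ.
split; first exact: D2r.
  by apply: contra Tb => /eqP/subr0_eq ->; rewrite memvZ // memv_line.
rewrite ab // (metricDr mN) (metricNr mN) (metricZr mN) (metricC mN _ b T).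
have [->|b0] := eqVneq b 0; first by rewrite !(metric0r mN) mulr0 subrr.
by rewrite divfK ?subrr // gt_eqF // (metric_pos mN).
Qed.

Let converse_gradf p : gradf (F p) = 0.
Proof.
have [T [Tr T0 aT]] := orthogonal_range_vector p.
have [X [hX XT]] := range_extend Tr.
apply: (gradf_eq0 hX XT T0).
(* The horizontal lift of phi F_*X, the only choice that (iii) admits. *)
pose Z x := adjoint gM gN F x (P (F x) (tmap F x (X x))).
have hZ : horizontal Z.
  exact: (adjoint_section mM mN sF (smooth_along_kahler sF kP (smooth_along_tmap sF hX.1))).
have ZX x : tmap F x (Z x) = phi x (tmap F x (X x)) by exact/phi_lift/ran_tmap.
have [_ _ PG] := bc (@gradf_normal p).
have E := etrans (eqn hX hX hZ ZX p) (key_identity p hX hX hZ ZX).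
have := etrans (congr1 (fun w => gM p (X p) (Z p) *: w) PG) E.
(* The coefficient of P F_*X vanishes by the choice of T and the g(X, Z) terms cancel, leaving g(X,
   X) grad f = 0. *)
rewrite XT (gradf_range Tr) aT oppr0 scale0r subr0 -[LHS]addr0 => /addrI.
by move=> /esym.
Qed.

(** (i) settles vertical directions only. For the horizontal part of X, let Q be the derivative of Y
    and hQ its horizontal part: g(hQ, Q) is minus the product of Y with the derivative of hQ, which
    is horizontal by (ii). So 0 = g(hQ, Q) = g(F_*Q, F_*Q). *)
Let converse_ker X Y p : vector_field X -> section (kerF F) Y ->
  tmap F p (nablaM p (X p) Y) = 0.
Proof.
move=> sX hY; have hX := hor_section sX; have vX := ver_section sX.
have XE : X p = hor X p + (X p + - hor X p) by rewrite addrC subrK.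
rewrite XE (connectionDu cM _ _ _ hY.1) linearD /=.
have := (kerE _ _).1 (tgk vX hY p) => /= ->; rewrite addr0.
pose Q x := nablaM x (hor X x) Y.
have sQ : vector_field Q by exact: (connection_smooth cM hX.1 hY.1).
have hQ := hor_section sQ.
have := horizontal_vertical (hor X) p hQ hY.
rewrite (tgh hX hQ (hY.2 p)) => /esym/eqP; rewrite oppr_eq0 => /eqP.
rewrite (adjointP F mM mN) => H.
exact: (metric_eq0 mN H).
Qed.

Let sff X Y p := nablaF p (X p) (fun x => tmap F x (Y x)) - tmap F p (nablaM p (X p) Y).

Let sff_hor X Y p : vector_field X -> vector_field Y -> sff X Y p = sff X (hor Y) p.
Proof.
move=> sX sY; rewrite /sff; congr (_ - _).
  by congr (nablaF p (X p) _); apply/funext => x; rewrite tmap_hor.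
have vY := ver_section sY.
have YE : Y = (fun x => hor Y x + (Y x + - hor Y x)).
  by apply/funext => x; rewrite addrC subrK.
apply: (etrans (congr1 (fun Z => tmap F p (nablaM p (X p) Z)) YE)).
apply: (etrans (congr1 (tmap F p) (connection_additive cM p (X p) (hor_section sY).1 vY.1))).
rewrite linearD /=; apply: (etrans _ (addr0 _)); congr (_ + _).
exact: converse_ker.
Qed.

Let sff_sym X Y p : vector_field X -> vector_field Y -> sff X Y p = sff Y X p.
Proof.
move=> sX sY; apply: swap_sub.
exact: (etrans (pullback_torsion sF lcN pc p lcM sX sY) (linearB _ _ _)).
Qed.

(** [sff_hor] makes the second argument horizontal and symmetry does the same for the first; on
    horizontal fields only the gradient term could remain. *)
Lemma totally_geodesic_converse : totally_geodesic_map F nablaM nablaF.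
Proof.
move=> X Y sX sY p; rewrite -/(sff X Y p).
have hX := hor_section sX; have hY := hor_section sY.
apply: (etrans (sff_hor p sX sY)); apply: (etrans (sff_sym p sX hY.1)).
apply: (etrans (sff_hor p hY.1 sX)).
have E := pullback_horizontal p hY hX; rewrite (converse_gradf p) scaler0 subr0 in E.
exact: (etrans (congr1 (fun w => w - _) E) (subrr _)).
Qed.
End Converse.

Lemma totally_geodesic_iff :
  totally_geodesic_map F nablaM nablaF <->
  [/\ totally_geodesic_distribution nablaM (kerF F),
      totally_geodesic_distribution nablaM (kerF_perp gM F) &
      forall X Y Z,
        section (kerF_perp gM F) X -> section (kerF_perp gM F) Y ->
        section (kerF_perp gM F) Z ->
        (forall p, tmap F p (Z p) = phi p (tmap F p (Y p))) ->
        forall p,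
          gM p (X p) (Z p) *: (B p (gradf (F p)) + C p (gradf (F p)))
          = phi p (tmap F p (nablaM p (X p) Z))
            + omega p (tmap F p (nablaM p (X p) Z))
            + B p (nablaFperp p (X p) (fun x => omega x (tmap F x (Y x))))
            + C p (nablaFperp p (X p) (fun x => omega x (tmap F x (Y x))))
            + tmap F p (nablaM p (X p) Y)].
Proof.
split=> [tgF|[H1 H2 H3]]; last exact: totally_geodesic_converse.
split; [|exact: totally_geodesic_horizontal|exact: totally_geodesic_equation].
by move=> X Y hX hY p; exact: (totally_geodesic_ker p tgF hX.1 hY).
Qed.

End SemiInvariant.

Theorem theorem9 (R : realType) (m n : nat)
    (M : manifold R m) (N : manifold R n)
    (gM : M -> 'rV[R]_m -> 'rV[R]_m -> R)
    (gN : N -> 'rV[R]_n -> 'rV[R]_n -> R)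
    (nablaM : M -> 'rV[R]_m -> (M -> 'rV[R]_m) -> 'rV[R]_m)
    (nablaN : N -> 'rV[R]_n -> (N -> 'rV[R]_n) -> 'rV[R]_n)
    (P : N -> 'End('rV[R]_n))
    (F : M -> N)
    (nablaF nablaFperp : M -> 'rV[R]_m -> (M -> 'rV[R]_n) -> 'rV[R]_n)
    (rangeF : N -> {vspace 'rV[R]_n})
    (D1 D2 : M -> {vspace 'rV[R]_n})
    (phi omega B C : M -> 'rV[R]_n -> 'rV[R]_n)
    (f : N -> R) (gradf : N -> 'rV[R]_n) :
  riemannian_metric gM -> levi_civita gM nablaM ->
  riemannian_metric gN -> levi_civita gN nablaN ->
  kahler gN nablaN P ->
  riemannian_map gM gN F ->
  pullback_connection F nablaN nablaF ->
  normal_connection gN F nablaF nablaFperp ->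
  range_distribution F rangeF ->
  semi_invariant gN P F D1 D2 ->
  phi_omega_decomposition P F D1 D2 phi omega ->
  BC_decomposition gN P F D2 B C ->
  smooth_fun f -> gradient gN f gradf ->
  clairaut gN nablaN rangeF (fun q => expR (f q)) ->
  totally_geodesic_distribution nablaN
    (fun q => orth (gN q) [set` rangeF q]) ->
  (forall p, (1 < \dim (D2 p))%N) ->
  totally_geodesic_map F nablaM nablaF <->
  [/\ totally_geodesic_distribution nablaM (kerF F),
      totally_geodesic_distribution nablaM (kerF_perp gM F) &
      forall X Y Z,
        section (kerF_perp gM F) X -> section (kerF_perp gM F) Y ->
        section (kerF_perp gM F) Z ->
        (forall p, tmap F p (Z p) = phi p (tmap F p (Y p))) ->
        forall p,
          gM p (X p) (Z p) *: (B p (gradf (F p)) + C p (gradf (F p)))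
          = phi p (tmap F p (nablaM p (X p) Z))
            + omega p (tmap F p (nablaM p (X p) Z))
            + B p (nablaFperp p (X p) (fun x => omega x (tmap F x (Y x))))
            + C p (nablaFperp p (X p) (fun x => omega x (tmap F x (Y x))))
            + tmap F p (nablaM p (X p) Y)].
Proof.
move=> mM lcM mN lcN kP rF pc nc rD si po bc sf gf cl tg dD2.
exact: (totally_geodesic_iff mM lcM mN lcN kP rF pc nc rD si po bc sf gf cl tg dD2).
Qed.
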